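(* Let $b\ge 1$ be an integer. The three epimorphisms $$\varphi\colon H_1(M_{\mathrm T}(b))=v_1\mathbb{Z}\oplus v_2\mathbb{Z}\oplus h\mathbb{Z}_b\twoheadrightarrow\mathbb{Z}_2$$ such that $\varphi(h)=0$ are equivalent, and the total space of their associated double covering is $M_{\mathrm T}(2b)$, i.e. the covering is $M_{\mathrm T}(2b)\to M_{\mathrm T}(b)$. If $b$ is odd, these three epimorphisms are the only ones. If $b$ is even, the four other epimorphisms $H_1(M_{\mathrm T}(b))\twoheadrightarrow\mathbb{Z}_2$ are equivalent, and their associated double covering is $M_{\mathrm T}(b/2)\to M_{\mathrm T}(b)$.
   Context: Seifert manifolds. Let $b\in\mathbb{Z}$, $\varepsilon\in\{\pm1\}$, and let $S$ be a closed connected surface of genus $g$, orientable if $\varepsilon=+1$ and non-orientable (with $g\ge1$) if $\varepsilon=-1$; put $g'=2g$ if $\varepsilon=+1$, $g'=g$ if $\varepsilon=-1$. Let $(a_i,b_i)$, $1\le i\le n$, be pairs of coprime integers with $0<b_i<a_i$. The orientable Seifert manifold with invariant $(b,\varepsilon,g',a_1,b_1,\dots,a_n,b_n)$ is obtained as follows: take the circle bundle with orientable total space, with a section, over $S$ minus $n+1$ open discs, let $s_0,s_1,\dots,s_n$ be the boundary curves of the section and $h$ the fibre, and glue in $n+1$ solid tori whose meridians are $s_0h^{b}$ and $s_i^{a_i}h^{b_i}$ ($1\le i\le n$). Its fundamental group is generated by $s_1,\dots,s_n,v_1,\dots,v_{g'},h$ with relations $[s_i,h]=1$, $s_i^{a_i}h^{b_i}=1$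 ($1\le i\le n$), $v_jhv_j^{-1}=h^{\varepsilon}$ ($1\le j\le g'$), $s_1\cdots s_nVh^{-b}=1$, where $V=[v_1,v_2]\cdots[v_{2g-1},v_{2g}]$ if $\varepsilon=+1$ and $V=v_1^2\cdots v_g^2$ if $\varepsilon=-1$. The same letters denote the classes of the generators in $H_1$. $M_{\mathrm T}(b)$ ($b\ge1$) is the Seifert manifold with invariant $(b,+1,2)$ (no critical fibre; generators $v_1,v_2,h$). $x\mathbb{Z}_m$ denotes a cyclic group of order $m$ generated by $x$. Double coverings. An epimorphism $\varphi\colon H_1(N)\twoheadrightarrow\mathbb{Z}_2$ is identified with the composite $\pi_1(N)\to H_1(N)\to\mathbb{Z}_2$; its associated double covering $N_\varphi\to N$ is the connected one whose fundamental group is $\ker\varphi$. Total spaces are identified up to homeomorphism. Two epimorphisms $\varphi_1,\varphi_2\colon\pi_1(N)\twoheadrightarrow\mathbb{Z}_2$ are equivalent if the two associated double coverings are isomorphic as bundles (over a possibly non-identity homeomorphism of the base); equivalently, there is a homeomorphism $F\colon N\to N$ with $\varphi_2\circ F_\sharp=\varphi_1$, where $F_\sharp$ is the induced map on $\pi_1$. *)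

(* Defs.v *)
From HB Require Import structures.
From Stdlib Require Import Relation_Operators.
From mathcomp Require Import all_boot all_order all_algebra.
From mathcomp Require Import all_classical all_reals all_analysis.
From mathcomp Require Import lra.
Set Implicit Arguments.
Unset Strict Implicit.
Unset Printing Implicit Defensive.
Import Order.TTheory GRing.Theory Num.Theory.
Import numFieldNormedType.Exports.
Local Open Scope classical_set_scope.
Local Open Scope ring_scope.
Local Open Scope quotient_scope.

Lemma within_comp (Y Z W : topologicalType) (A : set Y) (B : set Z)
    (u : Y -> Z) (v : Z -> W) :
  {within A, continuous u} -> (forall y, A y -> B (u y)) ->
  {within B, continuous v} -> {within A, continuous (v \o u)}.
Proof.
move=> /subspace_continuousP cu AB /subspace_continuousP cv.
apply/subspace_continuousP => y Ay.
apply: cvg_comp (cv _ (AB _ Ay)).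
move=> P /(cu _ Ay).
rewrite /nbhs /= /within /=.
by apply: filterS => z /[swap] Az /(_ Az); apply; exact: AB.
Qed.

(* lra fails on contexts with equations whose type is not an ordered ring. *)
Local Ltac lra_ :=
  repeat match goal with H : @eq (Topological.sort _) _ _ |- _ => clear H end;
  (lazymatch goal with |- @eq (Topological.sort _) _ _ => exfalso | _ => idtac end);
  lra.

Lemma continuous_pair (Y Z W : topologicalType) (u : Y -> Z) (v : Y -> W) :
  continuous u -> continuous v -> continuous (fun y => (u y, v y)).
Proof. by move=> cu cv y; exact: cvg_pair (cu y) (cv y). Qed.

Section Loops.
Context {R : realType} {X : topologicalType}.
Implicit Types (x : X) (f g h : R -> X).

Local Notation I01 := (`[0, 1]%classic : set R).

(* Paths are functions on R of which only the values on [0, 1] matter. *)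
Definition is_loop x f :=
  [/\ {within I01, continuous f}, f 0 = x & f 1 = x].

Definition loop_homotopic x f g := exists H : R * R -> X,
  [/\ {within I01 `*` I01, continuous H},
      forall t, I01 t -> H (0, t) = f t,
      forall t, I01 t -> H (1, t) = g t &
      forall s, I01 s -> H (s, 0) = x /\ H (s, 1) = x].

Definition concat f g : R -> X :=
  fun t => if t <= 2^-1 then f (2 * t) else g (2 * t - 1).

Definition reverse f : R -> X := fun t => f (1 - t).

Lemma piecewise_continuous (Y : topologicalType) (c : Y -> R) (A : set Y)
    (u v : Y -> X) : continuous c ->
  {within A `&` [set y | c y <= 2^-1], continuous u} ->
  {within A `&` [set y | 2^-1 <= c y], continuous v} -> closed A ->
  (forall y, A y -> c y = 2^-1 -> u y = v y) ->
  {within A, continuous (fun y => if c y <= 2^-1 then u y else v y)}.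
Proof.
move=> cc cu cv cA uv.
have -> : A = (A `&` [set y | c y <= 2^-1]) `|` (A `&` [set y | 2^-1 <= c y]).
  apply/seteqP; split=> [y Ay|y [] []//].
  by have [l|l] := leP (c y) 2^-1; [left|right; split=> //=; exact: ltW].
apply: withinU_continuous.
- apply: closedI => //; apply: (@closed_comp _ _ c [set r | r <= 2^-1]).
    by move=> y _; exact: cc.
  exact: closed_le.
- apply: closedI => //; apply: (@closed_comp _ _ c [set r | 2^-1 <= r]).
    by move=> y _; exact: cc.
  exact: closed_ge.
- apply: subspace_eq_continuous cu => y; rewrite inE => -[_ /= cy].
  by rewrite /from_subspace /= cy.
- apply: subspace_eq_continuous cv => y; rewrite inE => -[Ay /= cy].
  rewrite /from_subspace /=; case: ifPn => // cy'; rewrite uv //.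
  by apply/eqP; rewrite eq_le cy cy'.
Qed.

Lemma concat_loop x f g : is_loop x f -> is_loop x g -> is_loop x (concat f g).
Proof.
move=> [cf f0 f1] [cg g0 g1]; split; last 2 first.
- by rewrite /concat invr_ge0 ler0n mulr0.
- by rewrite /concat; case: ifPn => [?|_]; [lra_|rewrite mulr1 -g1; congr g; lra_].
apply: (@piecewise_continuous R id I01 (fun t => f (2 * t))
  (fun t => g (2 * t - 1))).
- exact: (fun y => cvg_id).
- refine (@within_comp R R X _ I01 (fun t => 2 * t) f _ _ _) => //.
    apply: continuous_subspaceT => t; apply: cvgM; [exact: cvg_cst|exact: cvg_id].
  by move=> t /= []; rewrite !in_itv /= => *; lra_.
- refine (@within_comp R R X _ I01 (fun t => 2 * t - 1) g _ _ _) => //.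
    apply: continuous_subspaceT => t; apply: cvgB; last exact: cvg_cst.
    by apply: cvgM; [exact: cvg_cst|exact: cvg_id].
  by move=> t /= []; rewrite !in_itv /= => *; lra_.
- exact: interval_closed.
- by move=> t _ ->; rewrite divff// f1 subrr g0.
Qed.

Lemma reverse_loop x f : is_loop x f -> is_loop x (reverse f).
Proof.
move=> [cf f0 f1]; split; rewrite /reverse ?subr0 ?subrr //.
refine (@within_comp R R X _ I01 (fun t => 1 - t) f _ _ _) => //.
  by apply: continuous_subspaceT => t; apply: cvgB; [exact: cvg_cst|exact: cvg_id].
by move=> t /=; rewrite !in_itv /= => *; lra_.
Qed.

Lemma cst_loop x : is_loop x (fun=> x).
Proof. by split=> //; apply: continuous_subspaceT => t; exact: cvg_cst. Qed.

Lemma loop_homotopic_ext x f f' g g' :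
  (forall t, I01 t -> f t = f' t) -> (forall t, I01 t -> g t = g' t) ->
  loop_homotopic x f g -> loop_homotopic x f' g'.
Proof.
move=> ff gg [H [cH H0 H1 Hx]]; exists H; split => // t It.
  by rewrite H0 // ff.
by rewrite H1 // gg.
Qed.

Lemma loop_homotopic_reparam x f (p q : R -> R) :
  {within I01, continuous f} ->
  continuous p -> continuous q ->
  (forall t, I01 t -> I01 (p t)) -> (forall t, I01 t -> I01 (q t)) ->
  p 0 = q 0 -> p 1 = q 1 -> f (p 0) = x -> f (p 1) = x ->
  loop_homotopic x (f \o p) (f \o q).
Proof.
move=> cf cp cq Ip Iq e0 e1 f0 f1.
pose r (z : R * R) := (1 - z.1) * p z.2 + z.1 * q z.2.
exists (f \o r); split.
- refine (@within_comp (R * R)%type R X _ I01 r f _ _ _) => //.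
    apply: continuous_subspaceT => z; apply: cvgD.
      apply: cvgM; first by apply: cvgB; [exact: cvg_cst|exact: cvg_fst].
      by apply: (@continuous_comp _ _ _ snd p); [exact: cvg_snd|exact: cp].
    apply: cvgM; first exact: cvg_fst.
    by apply: (@continuous_comp _ _ _ snd q); [exact: cvg_snd|exact: cq].
  move=> [s t] [Is It]; have := Iq _ It; have := Ip _ It; move: Is.
  rewrite /= !in_itv /= /r /=; move: (p t) (q t) => u v.
  move=> /andP[s0 s1] /andP[u0 u1] /andP[v0 v1].
  apply/andP; split; first by rewrite addr_ge0 ?mulr_ge0 ?subr_ge0.
  have : (1 - s) * u <= 1 - s by rewrite ler_piMr ?subr_ge0.
  have : s * v <= s by rewrite ler_piMr.
  lra.
- by move=> t _; rewrite /r /= subr0 mul1r mul0r addr0.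
- by move=> t _; rewrite /r /= subrr mul1r mul0r add0r.
- move=> s _; rewrite /r /= -e0 -e1 -!mulrDl subrK !mul1r; split => //.
Qed.

Lemma loop_homotopic_refl x f : is_loop x f -> loop_homotopic x f f.
Proof.
move=> [cf f0 f1]; apply: (@loop_homotopic_reparam x f id id) => // t;
  exact: cvg_id.
Qed.

Lemma closed_I01I01 : closed (I01 `*` I01).
Proof.
have -> : I01 `*` I01 = (fst @^-1` I01) `&` (snd @^-1` I01) by [].
by apply: closedI; apply: closed_comp; try exact: interval_closed;
  move=> z _; [exact: cvg_fst|exact: cvg_snd].
Qed.

Lemma loop_homotopic_sym x f g : loop_homotopic x f g -> loop_homotopic x g f.
Proof.
move=> [H [cH H0 H1 Hx]]; exists (fun z => H (1 - z.1, z.2)); split.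
- refine (@within_comp (R * R)%type (R * R)%type X _ (I01 `*` I01)
    (fun z : R * R => (1 - z.1, z.2)) H _ _ _) => //.
    apply: continuous_subspaceT; apply: continuous_pair => z; last exact: cvg_snd.
    by apply: cvgB; [exact: cvg_cst|exact: cvg_fst].
  by move=> [s t]; rewrite /= !in_itv /= => -[? ?]; split; lra_.
- by move=> t It; rewrite /= subr0 H1.
- by move=> t It; rewrite /= subrr H0.
- by move=> s Is; apply: Hx; move: Is; rewrite /= !in_itv /= => ?; lra_.
Qed.

Lemma loop_homotopic_trans x f g h :
  loop_homotopic x f g -> loop_homotopic x g h -> loop_homotopic x f h.
Proof.
move=> [H [cH H0 H1 Hx]] [K [cK K0 K1 Kx]].
exists (fun z => if z.1 <= 2^-1 then H (2 * z.1, z.2) else K (2 * z.1 - 1, z.2)).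
have c2 : continuous (fun z : R * R => 2 * z.1).
  by move=> z; apply: cvgM; [exact: cvg_cst|exact: cvg_fst].
split.
- apply: (@piecewise_continuous _ fst (I01 `*` I01)
    (fun z => H (2 * z.1, z.2)) (fun z => K (2 * z.1 - 1, z.2))); last 2 first.
  + exact: closed_I01I01.
  + by move=> [s t] /= [_ It] ->; rewrite divff // subrr H1 // K0.
  + by move=> z; exact: cvg_fst.
  + refine (@within_comp (R * R)%type (R * R)%type X _ (I01 `*` I01)
      (fun z : R * R => (2 * z.1, z.2)) H _ _ _) => //.
      apply: continuous_subspaceT; apply: continuous_pair => z; [exact: c2|exact: cvg_snd].
    by move=> [s t]; rewrite /= !in_itv /= => -[[? ?] ?]; split; lra_.
  + refine (@within_comp (R * R)%type (R * R)%type X _ (I01 `*` I01)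
      (fun z : R * R => (2 * z.1 - 1, z.2)) K _ _ _) => //.
      apply: continuous_subspaceT; apply: continuous_pair => z; last exact: cvg_snd.
      by apply: cvgB; [exact: c2|exact: cvg_cst].
    by move=> [s t]; rewrite /= !in_itv /= => -[[? ?] ?]; split; lra_.
- by move=> t It /=; rewrite invr_ge0 ler0n mulr0 H0.
- move=> t It /=; case: ifPn => [?|_]; first lra_.
  by rewrite mulr1 -K1 //; congr (K (_, _)); lra_.
- move=> s Is /=; case: ifPn => hs; [apply: Hx|apply: Kx];
    move: Is hs; rewrite /= !in_itv /= => *; lra_.
Qed.

Lemma loop_homotopic_concat x f f' g g' :
  loop_homotopic x f f' -> loop_homotopic x g g' ->
  loop_homotopic x (concat f g) (concat f' g').
Proof.
move=> [H [cH H0 H1 Hx]] [K [cK K0 K1 Kx]].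
exists (fun z => if z.2 <= 2^-1 then H (z.1, 2 * z.2) else K (z.1, 2 * z.2 - 1)).
have c2 : continuous (fun z : R * R => 2 * z.2).
  by move=> z; apply: cvgM; [exact: cvg_cst|exact: cvg_snd].
split.
- apply: (@piecewise_continuous _ snd (I01 `*` I01)
    (fun z => H (z.1, 2 * z.2)) (fun z => K (z.1, 2 * z.2 - 1))); last 2 first.
  + exact: closed_I01I01.
  + move=> [s t] /= [Is _] ->; rewrite divff // subrr.
    by have [_ ->] := Hx _ Is; have [-> _] := Kx _ Is.
  + by move=> z; exact: cvg_snd.
  + refine (@within_comp (R * R)%type (R * R)%type X _ (I01 `*` I01)
      (fun z : R * R => (z.1, 2 * z.2)) H _ _ _) => //.
      apply: continuous_subspaceT; apply: continuous_pair => z; [exact: cvg_fst|exact: c2].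
    by move=> [s t]; rewrite /= !in_itv /= => -[[? ?] ?]; split; lra_.
  + refine (@within_comp (R * R)%type (R * R)%type X _ (I01 `*` I01)
      (fun z : R * R => (z.1, 2 * z.2 - 1)) K _ _ _) => //.
      apply: continuous_subspaceT; apply: continuous_pair => z; first exact: cvg_fst.
      by apply: cvgB; [exact: c2|exact: cvg_cst].
    by move=> [s t]; rewrite /= !in_itv /= => -[[? ?] ?]; split; lra_.
- move=> t It /=; rewrite /concat; case: ifPn => ht; [apply: H0|apply: K0];
    move: It ht; rewrite /= !in_itv /= => *; lra_.
- move=> t It /=; rewrite /concat; case: ifPn => ht; [apply: H1|apply: K1];
    move: It ht; rewrite /= !in_itv /= => *; lra_.
- move=> s Is /=; rewrite invr_ge0 ler0n mulr0; split.
    by have [] := Hx _ Is.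
  case: ifPn => [?|_]; first lra_.
  by have [_ <-] := Kx _ Is; congr (K (_, _)); lra_.
Qed.

Lemma loop_homotopic_reverse x f g :
  loop_homotopic x f g -> loop_homotopic x (reverse f) (reverse g).
Proof.
move=> [H [cH H0 H1 Hx]]; exists (fun z => H (z.1, 1 - z.2)); split.
- refine (@within_comp (R * R)%type (R * R)%type X _ (I01 `*` I01)
    (fun z : R * R => (z.1, 1 - z.2)) H _ _ _) => //.
    apply: continuous_subspaceT; apply: continuous_pair => z; first exact: cvg_fst.
    by apply: cvgB; [exact: cvg_cst|exact: cvg_snd].
  by move=> [s t]; rewrite /= !in_itv /= => -[? ?]; split; lra_.
- by move=> t It; apply: H0; move: It; rewrite /= !in_itv /= => *; lra_.
- by move=> t It; apply: H1; move: It; rewrite /= !in_itv /= => *; lra_.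
- by move=> s Is /=; rewrite subr0 subrr; have [-> ->] := Hx _ Is.
Qed.

Let continuous_lin (a b : R) : continuous (fun t : R => a * t + b).
Proof.
move=> t; apply: cvgD; last exact: cvg_cst.
by apply: cvgM; [exact: cvg_cst|exact: cvg_id].
Qed.

Let continuous_minl (u v : R -> R) :
  continuous u -> continuous v -> continuous (fun t => Num.min (u t) (v t)).
Proof. by move=> cu cv t; exact: (continuous_min (cu t) (cv t)). Qed.

Let minP (a b : R) :
  (Num.min a b = a /\ a <= b) \/ (Num.min a b = b /\ b <= a).
Proof. by case: leP => h; [left|right; split=> //; exact: ltW]. Qed.

Lemma concatA x f g h : is_loop x f -> is_loop x g -> is_loop x h ->
  loop_homotopic x (concat f (concat g h)) (concat (concat f g) h).
Proof.
move=> lf lg lh.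
have lk := concat_loop lf (concat_loop lg lh).
have [cf f0 f1] := lf; have [cg g0 g1] := lg; have [ch h0 h1] := lh.
have [ck k0 k1] := lk.
pose p (t : R) : R :=
  Num.min (2 * t + 0) (Num.min (1 * t + 4^-1) (2^-1 * t + 2^-1)).
have pE t : p t = if t <= 4^-1 then 2 * t else
    if t <= 2^-1 then t + 4^-1 else (t + 1) / 2.
  rewrite /p; case: (minP (1 * t + 4^-1) (2^-1 * t + 2^-1)) => -[-> ?].
    by case: (minP (2 * t + 0) (1 * t + 4^-1)) => -[-> ?];
      do !case: ifPn => ?; lra_.
  by case: (minP (2 * t + 0) (2^-1 * t + 2^-1)) => -[-> ?];
    do !case: ifPn => ?; lra_.
have p0 : p 0 = 0 by rewrite pE; do !case: ifPn => ?; lra_.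
have p1 : p 1 = 1 by rewrite pE; do !case: ifPn => ?; lra_.
apply: (@loop_homotopic_ext x (concat f (concat g h) \o id) _
  (concat f (concat g h) \o p)) => //; last first.
  apply: loop_homotopic_reparam; rewrite ?p0 ?p1 //.
  - by move=> t; exact: cvg_id.
  - apply: continuous_minl; first exact: continuous_lin.
    by apply: continuous_minl; exact: continuous_lin.
  - by move=> t; rewrite /= !in_itv /= pE => ?;
      do !case: ifPn => *; lra_.
move=> t; rewrite /= in_itv /= => It.
rewrite pE /concat.
have [t4|t4] := leP t 4^-1.
  do 3?[case: ifPn => ?; last first; first lra_].
  by congr f; lra_.
have [t2|t2] := leP t 2^-1.
  case: ifPn => ?; first lra_.
  case: ifPn => ?; last first; first lra_.
  case: ifPn => ?; first lra_.
  by congr g; lra_.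
case: ifPn => ?; first lra_.
case: ifPn => ?; first lra_.
by congr h; lra_.
Qed.

Lemma concat1l x f : is_loop x f -> loop_homotopic x (concat (fun=> x) f) f.
Proof.
move=> [cf f0 f1].
pose p (t : R) : R := - Num.min (0 * t + 0) (-2 * t + 1).
have p0 : p 0 = 0 by rewrite /p !minEle; do !case: ifPn => *; lra_.
have p1 : p 1 = 1 by rewrite /p !minEle; do !case: ifPn => *; lra_.
apply: (@loop_homotopic_ext x (f \o p) _ (f \o id)) => //; last first.
  apply: loop_homotopic_reparam; rewrite ?p0 ?p1 //.
  - by move=> t; apply: cvgN; apply: (continuous_minl (u := fun t => 0 * t + 0)
      (v := fun t => -2 * t + 1)); exact: continuous_lin.
  - by move=> t; exact: cvg_id.
  - by move=> t; rewrite /= !in_itv /= /p !minEle => ?;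
      do !case: ifPn => *; lra_.
move=> t; rewrite /= in_itv /= => It; rewrite /concat /p minEle.
case: ifPn => ?; case: ifPn => ?; try lra_.
- by rewrite -[RHS]f0; congr f; lra_.
- by congr f; lra_.
Qed.

Lemma concat1r x f : is_loop x f -> loop_homotopic x (concat f (fun=> x)) f.
Proof.
move=> [cf f0 f1].
pose p (t : R) : R := Num.min (2 * t + 0) (0 * t + 1).
have p0 : p 0 = 0 by rewrite /p !minEle; do !case: ifPn => *; lra_.
have p1 : p 1 = 1 by rewrite /p !minEle; do !case: ifPn => *; lra_.
apply: (@loop_homotopic_ext x (f \o p) _ (f \o id)) => //; last first.
  apply: loop_homotopic_reparam; rewrite ?p0 ?p1 //.
  - by apply: continuous_minl; exact: continuous_lin.
  - by move=> t; exact: cvg_id.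
  - by move=> t; rewrite /= !in_itv /= /p !minEle => ?;
      do !case: ifPn => *; lra_.
move=> t; rewrite /= in_itv /= => It; rewrite /concat /p minEle.
case: ifPn => ?; case: ifPn => ?; try lra_.
- by congr f; lra_.
- by rewrite -[RHS]f1; congr f; lra_.
Qed.

Lemma concatV x f : is_loop x f ->
  loop_homotopic x (concat f (reverse f)) (fun=> x).
Proof.
move=> [cf f0 f1].
pose p (t : R) : R := Num.min (2 * t + 0) (-2 * t + 2).
have p0 : p 0 = 0 by rewrite /p !minEle; do !case: ifPn => *; lra_.
have p1 : p 1 = 0 by rewrite /p !minEle; do !case: ifPn => *; lra_.
apply: (@loop_homotopic_ext x (f \o p) _ (f \o (fun=> 0))) => //; last first.
  apply: loop_homotopic_reparam; rewrite ?p0 ?p1 //.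
  - by apply: continuous_minl; exact: continuous_lin.
  - by move=> t; exact: cvg_cst.
  - by move=> t; rewrite /= !in_itv /= /p !minEle => ?;
      do !case: ifPn => *; lra_.
  - by move=> t _; rewrite /= in_itv /= lexx ler01.
move=> t; rewrite /= in_itv /= => It; rewrite /concat /reverse /p minEle.
by case: ifPn => ?; case: ifPn => ?; congr f; lra_.
Qed.

Lemma concatVl x f : is_loop x f ->
  loop_homotopic x (concat (reverse f) f) (fun=> x).
Proof.
move=> lf; have /concatV := reverse_loop lf.
apply: loop_homotopic_ext => // t _; rewrite /concat /reverse.
by case: ifPn => // _; congr f; lra_.
Qed.

End Loops.

Section FundamentalGroup.
Context {R : realType} {X : topologicalType} (x : X).

Record loop := Loop { loop_fun :> R -> X; loopP : is_loop x loop_fun }.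

HB.instance Definition _ := gen_eqMixin loop.
HB.instance Definition _ := gen_choiceMixin loop.

Definition loop_rel (f g : loop) : bool := `[< loop_homotopic x f g >].

Lemma loop_relP : equiv_class_of loop_rel.
Proof.
split.
- by move=> f; apply/asboolP/loop_homotopic_refl/loopP.
- by move=> f g; apply/asboolP/asboolP => /loop_homotopic_sym.
- move=> g f h /asboolP fg /asboolP gh; apply/asboolP.
  exact: loop_homotopic_trans fg gh.
Qed.

Canonical loop_equiv := EquivRelPack loop_relP.

Definition pi1 := {eq_quot loop_rel}.

HB.instance Definition _ := Choice.on pi1.

Definition loop_class (f : loop) : pi1 := \pi_pi1 f.

Lemma loop_classP (f g : loop) :
  loop_class f = loop_class g <-> loop_homotopic x f g.
Proof. by split=> [/eqmodP/asboolP|h]; last exact/eqmodP/asboolP. Qed.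

Lemma loop_classW (P : pi1 -> Prop) :
  (forall f, P (loop_class f)) -> forall a, P a.
Proof. exact: quotW. Qed.

Definition loop_one := Loop (cst_loop (R := R) x).
Definition loop_mul (f g : loop) := Loop (concat_loop (loopP f) (loopP g)).
Definition loop_inv (f : loop) := Loop (reverse_loop (loopP f)).

Definition pi1_one : pi1 := loop_class loop_one.
Definition pi1_mul (a b : pi1) : pi1 := loop_class (loop_mul (repr a) (repr b)).
Definition pi1_inv (a : pi1) : pi1 := loop_class (loop_inv (repr a)).

Lemma pi1_mulE (f g : loop) :
  pi1_mul (loop_class f) (loop_class g) = loop_class (loop_mul f g).
Proof.
by apply/loop_classP/loop_homotopic_concat; apply/loop_classP;
  rewrite /loop_class reprK.
Qed.

Lemma pi1_invE (f : loop) : pi1_inv (loop_class f) = loop_class (loop_inv f).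
Proof.
by apply/loop_classP/loop_homotopic_reverse; apply/loop_classP;
  rewrite /loop_class reprK.
Qed.

Lemma pi1_mulA : associative pi1_mul.
Proof.
elim/loop_classW=> f; elim/loop_classW=> g; elim/loop_classW=> h.
rewrite !pi1_mulE.
by apply/loop_classP/concatA; exact: loopP.
Qed.

Lemma pi1_mul1 : left_id pi1_one pi1_mul.
Proof.
by elim/loop_classW=> f; rewrite pi1_mulE; apply/loop_classP/concat1l/loopP.
Qed.

Lemma pi1_mulr1 : right_id pi1_one pi1_mul.
Proof.
by elim/loop_classW=> f; rewrite pi1_mulE; apply/loop_classP/concat1r/loopP.
Qed.

Lemma pi1_mulV : left_inverse pi1_one pi1_inv pi1_mul.
Proof.
elim/loop_classW=> f; rewrite pi1_invE pi1_mulE.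
exact/loop_classP/concatVl/loopP.
Qed.

Lemma pi1_mulrV : right_inverse pi1_one pi1_inv pi1_mul.
Proof.
elim/loop_classW=> f; rewrite pi1_invE pi1_mulE.
exact/loop_classP/concatV/loopP.
Qed.

HB.instance Definition _ := isGroup.Build pi1
  pi1_mulA pi1_mul1 pi1_mulr1 pi1_mulV pi1_mulrV.

End FundamentalGroup.
Arguments loop : clear implicits.
Arguments loop R {X} x.
Arguments pi1 : clear implicits.
Arguments pi1 R {X} x.

Section Abelianization.
Local Open Scope group_scope.
Context {G : groupType}.
Implicit Types a b c : G.

Inductive derived : G -> Prop :=
| derived1 : derived 1
| derivedM a b : derived a -> derived b -> derived (a * b)
| derivedV a : derived a -> derived a^-1
| derivedR a b : derived [~ a, b].

Lemma derivedJ a b : derived a -> derived (a ^ b).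
Proof.
move=> da; have -> : a ^ b = a * [~ a, b] by rewrite commgEl mulVKg.
exact: derivedM (derivedR _ _).
Qed.

Definition ab_rel a b : bool := `[< derived (a / b) >].

Lemma ab_relP : equiv_class_of ab_rel.
Proof.
split.
- by move=> a; apply/asboolP; rewrite divgg; exact: derived1.
- by move=> a b; apply/asboolP/asboolP => /derivedV; rewrite invgF.
- move=> b a c /asboolP ab /asboolP bc; apply/asboolP.
  by have := derivedM ab bc; rewrite mulgA mulgVK.
Qed.

Canonical ab_equiv := EquivRelPack ab_relP.

Definition abelianization := {eq_quot ab_rel}.

HB.instance Definition _ := Choice.on abelianization.

Definition to_ab a : abelianization := \pi_abelianization a.

Lemma to_ab_eqP a b : to_ab a = to_ab b <-> derived (a / b).
Proof. by split=> [/eqmodP/asboolP|h]; last exact/eqmodP/asboolP. Qed.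

Lemma to_abW (P : abelianization -> Prop) :
  (forall a, P (to_ab a)) -> forall u, P u.
Proof. exact: quotW. Qed.

Definition ab_zero : abelianization := to_ab 1.
Definition ab_add (u v : abelianization) := to_ab (repr u * repr v).
Definition ab_opp (u : abelianization) := to_ab (repr u)^-1.

Lemma ab_addE a b : ab_add (to_ab a) (to_ab b) = to_ab (a * b).
Proof.
apply/to_ab_eqP.
set a' := repr _; set b' := repr _.
have da : derived (a' / a) by apply/to_ab_eqP; rewrite /to_ab reprK.
have db : derived (b' / b) by apply/to_ab_eqP; rewrite /to_ab reprK.
have -> : a' * b' / (a * b) = (b' / b) ^ a'^-1 * (a' / a).
  by rewrite conjgE invgK invgM !mulgA !mulgVK.
exact: derivedM (derivedJ _ db) da.
Qed.

Lemma ab_oppE a : ab_opp (to_ab a) = to_ab a^-1.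
Proof.
apply/to_ab_eqP; set a' := repr _.
have da : derived (a / a') by apply/to_ab_eqP; rewrite /to_ab reprK.
have -> : a'^-1 / a^-1 = (a / a') ^ a'.
  by rewrite conjgE invgK !mulgA mulgVK.
exact: derivedJ.
Qed.

Lemma ab_addA : associative ab_add.
Proof.
elim/to_abW=> a; elim/to_abW=> b; elim/to_abW=> c.
by rewrite !ab_addE mulgA.
Qed.

Lemma ab_addC : commutative ab_add.
Proof.
elim/to_abW=> a; elim/to_abW=> b; rewrite !ab_addE.
apply/to_ab_eqP; have := derivedR a^-1 b^-1.
by rewrite /commg /conjg !invgK invgM !mulgA.
Qed.

Lemma ab_add0 : left_id ab_zero ab_add.
Proof. by elim/to_abW=> a; rewrite ab_addE mul1g. Qed.

Lemma ab_addN : left_inverse ab_zero ab_opp ab_add.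
Proof.
by elim/to_abW=> a; rewrite ab_oppE ab_addE mulVg.
Qed.

HB.instance Definition _ := GRing.isZmodule.Build abelianization
  ab_addA ab_addC ab_add0 ab_addN.

End Abelianization.
Arguments abelianization : clear implicits.

(* H_1 of a path-connected space, as the abelianized fundamental group. *)
Definition H1 (R : realType) (X : topologicalType) (x : X) : zmodType :=
  abelianization (pi1 R x).
Arguments H1 R {X} x.

Definition hurewicz {R : realType} {X : topologicalType} {x : X}
  (c : pi1 R x) : H1 R x := to_ab c.

Section Coverings.
Context {R : realType}.

Definition homeomorphism (X Y : topologicalType) (f : X -> Y) :=
  continuous f /\
  exists g : Y -> X, [/\ continuous g, cancel f g & cancel g f].

(* Every point has an open neighbourhood U whose preimage is the disjoint union
   of two open sheets, each mapped homeomorphically onto U by p. *)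
Definition double_covering (E N : topologicalType) (p : E -> N) :=
  continuous p /\
  forall y, exists (U : set N) (V : bool -> set E),
    [/\ open U /\ U y, forall i, open (V i), V false `&` V true = set0,
        p @^-1` U = V false `|` V true &
        forall i, exists s : N -> E,
          [/\ {within U, continuous s},
              forall z, U z -> V i (s z) /\ p (s z) = z &
              forall e, V i e -> s (p e) = e]].

Definition epimorphism (A : zmodType) (phi : A -> 'Z_2) :=
  zmod_morphism phi /\ forall c, exists a, phi a = c.

(* p is the connected double covering with p_* (pi_1(E, e)) = ker phi, where phi
   is seen on pi_1(N, y); ker phi being normal, the choice of e is irrelevant. *)
Definition associated_covering (N : topologicalType) (y : N)
    (phi : H1 R y -> 'Z_2) (E : topologicalType) (p : E -> N) :=
  [/\ double_covering p, connected [set: E] &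
      exists2 e : E, p e = y &
        forall c : loop R y,
          phi (hurewicz (loop_class c)) = 0 <->
          exists d : loop R e, loop_homotopic y (p \o d) c].

(* The homeomorphism F of the base need not be the identity, nor fix y. *)
Definition equivalent_epi (N : topologicalType) (y : N)
    (phi psi : H1 R y -> 'Z_2) :=
  exists (E1 E2 : topologicalType) (p1 : E1 -> N) (p2 : E2 -> N),
    [/\ associated_covering phi p1, associated_covering psi p2 &
        exists (F : N -> N) (F' : E1 -> E2),
          [/\ homeomorphism F, homeomorphism F' & p2 \o F' = F \o p1]].

End Coverings.

Section SeifertManifold.
Context (R : realType).

Definition circle_set : set (R * R) := [set z | z.1 ^+ 2 + z.2 ^+ 2 = 1].
Definition disc_set : set (R * R) := [set z | z.1 ^+ 2 + z.2 ^+ 2 <= 1].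

Definition circle : topologicalType := set_type circle_set.
Definition disc : topologicalType := set_type disc_set.
Definition torus : topologicalType := (circle * circle)%type.

Lemma circle_set_cos_sin (t : R) : circle_set (cos t, sin t).
Proof. exact: cos2Dsin2. Qed.

Definition ang (t : R) : circle :=
  exist _ (cos t, sin t) (mem_set (circle_set_cos_sin t)).

Definition disc_in_torus (z : R * R) : torus := (ang z.1, ang z.2).

(* The circles have length 2 pi: the closed unit disc embeds in the torus because 1 < pi. *)
Definition punctured_torus_set : set torus :=
  ~` (disc_in_torus @` [set z | z.1 ^+ 2 + z.2 ^+ 2 < 1]).
Definition punctured_torus : topologicalType := set_type punctured_torus_set.

Definition piece (i : bool) : topologicalType :=
  if i then ((punctured_torus * circle)%type : topologicalType)
  else ((disc * circle)%type : topologicalType).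

(* A circle bundle with orientable total space over the punctured torus P is
   trivial; it is P x S^1, with section P x {1}.  The curve s_0 is the boundary
   of the removed disc run clockwise, s |-> disc_in_torus (cos s, - sin s), so
   that s_0 [v_1, v_2] = 1 in pi_1(P).  The solid torus is D x S^1, and the glue
   is (cos s, sin s) x e^{it} ~ s_0(s) x e^{i(bs + t)}: the meridian (t fixed)
   goes to s_0 h^b and the fibre (s fixed) to h. *)
Definition meridian_glue (b : int) (a c : {i : bool & piece i}) : Prop :=
  exists (u : punctured_torus * circle) (w : disc * circle) (s t : R),
    [/\ a = existT piece true u, c = existT piece false w,
        set_val u.1 = disc_in_torus (cos s, - sin s) /\
          u.2 = ang (b%:~R * s + t) &
        set_val w.1 = (cos s, sin s) /\ w.2 = ang t].

Definition MT_rel (b : int) (a c : {i : bool & piece i}) : bool :=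
  `[< clos_refl_sym_trans _ (meridian_glue b) a c >].

Lemma MT_relP b : equiv_class_of (MT_rel b).
Proof.
split.
- by move=> a; apply/asboolP/rst_refl.
- by move=> a c; apply/idP/idP => h; apply/asboolP; apply: rst_sym; exact: asboolW h.
- move=> c a d ac cd; apply/asboolP.
  exact: rst_trans (asboolW ac) (asboolW cd).
Qed.

Canonical MT_equiv b := EquivRelPack (MT_relP b).

Definition MT (b : int) : topologicalType :=
  quotient_topology {eq_quot MT_rel b}.

Definition MT_mk (b : int) (a : {i : bool & piece i}) : MT b :=
  \pi_(quotient_topology {eq_quot MT_rel b}) a.

Lemma ang_continuous : continuous ang.
Proof.
apply: continuous_comp_initial.
by apply: continuous_pair; [exact: continuous_cos|exact: continuous_sin].
Qed.

Lemma ang2pi t : ang (t + 2 * pi) = ang t.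
Proof.
by apply: val_inj => /=; rewrite -[2]/(2%:R) mulr_natl cosD2pi sinD2pi.
Qed.

Lemma ang_pi_neq (y : R) : y ^+ 2 < 1 -> ang y <> ang pi.
Proof.
move=> y1 /(congr1 set_val) [] + _; rewrite cospi => cy.
have pi1 := pihalf_ge1 R.
have ylo : -1 < y by nra.
have yhi : y < 1 by nra.
have : 0 < cos y by apply: cos_gt0_pihalf; lra.
lra.
Qed.

Lemma punctured_torus_v1 (t : R) : punctured_torus_set (ang t, ang pi).
Proof.
move=> [[x y] /= xy] /(congr1 snd); apply: ang_pi_neq.
by apply: le_lt_trans xy; rewrite lerDr sqr_ge0.
Qed.

Lemma punctured_torus_v2 (t : R) : punctured_torus_set (ang pi, ang t).
Proof.
move=> [[x y] /= xy] /(congr1 fst); apply: ang_pi_neq.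
by apply: le_lt_trans xy; rewrite lerDl sqr_ge0.
Qed.

Definition on_v1 (t : R) : punctured_torus :=
  exist _ (ang t, ang pi) (mem_set (@punctured_torus_v1 t)).
Definition on_v2 (t : R) : punctured_torus :=
  exist _ (ang pi, ang t) (mem_set (@punctured_torus_v2 t)).

Lemma on_v1_continuous : continuous on_v1.
Proof.
apply: continuous_comp_initial; apply: continuous_pair.
  exact: ang_continuous.
by move=> t; exact: cvg_cst.
Qed.

Lemma on_v2_continuous : continuous on_v2.
Proof.
apply: continuous_comp_initial; apply: continuous_pair.
  by move=> t; exact: cvg_cst.
exact: ang_continuous.
Qed.

Section Generators.
Variable b : int.

Definition over_torus (u : punctured_torus) (w : circle) : MT b :=
  MT_mk b (existT piece true (u, w)).

Definition MT_base : MT b := over_torus (on_v1 pi) (ang 0).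

(* The three loops are based at the point of the section over (-1, -1). *)
Definition v1_path (t : R) : MT b :=
  over_torus (on_v1 (pi + t * (2 * pi))) (ang 0).
Definition v2_path (t : R) : MT b :=
  over_torus (on_v2 (pi + t * (2 * pi))) (ang 0).
Definition h_path (t : R) : MT b :=
  over_torus (on_v1 pi) (ang (t * (2 * pi))).

Lemma over_torus_continuous (u : R -> punctured_torus) (w : R -> circle) :
  continuous u -> continuous w -> continuous (fun t => over_torus (u t) (w t)).
Proof.
move=> cu cw t.
have cuw : {for t, continuous (fun t => (u t, w t))}.
  exact: continuous_pair.
apply: (@continuous_comp _ _ _ (fun t => (u t, w t))
  (fun uw => MT_mk b (existT piece true uw))) => //.
apply: (@continuous_comp _ _ _ (existT piece true) (MT_mk b)).
  exact: existT_continuous.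
exact: pi_continuous.
Qed.

Let affine_continuous (c : R) : continuous (fun t : R => c + t * (2 * pi)).
Proof.
move=> t; apply: cvgD; first exact: cvg_cst.
by apply: cvgM; [exact: cvg_id|exact: cvg_cst].
Qed.

Lemma v1_loop : is_loop MT_base v1_path.
Proof.
split; rewrite /v1_path /MT_base ?mul0r ?addr0 ?mul1r //.
- apply/continuous_subspaceT/over_torus_continuous => [t|t].
    apply: (@continuous_comp R R _ (fun t => pi + t * (2 * pi)) on_v1).
      exact: affine_continuous.
    exact: on_v1_continuous.
  exact: cvg_cst.
- by congr over_torus; apply: val_inj; rewrite /= ang2pi.
Qed.

Lemma v2_loop : is_loop MT_base v2_path.
Proof.
split; rewrite /v2_path /MT_base ?mul0r ?addr0 ?mul1r //.
- apply/continuous_subspaceT/over_torus_continuous => [t|t].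
    apply: (@continuous_comp R R _ (fun t => pi + t * (2 * pi)) on_v2).
      exact: affine_continuous.
    exact: on_v2_continuous.
  exact: cvg_cst.
- by congr over_torus; exact: val_inj.
- by congr over_torus; apply: val_inj; rewrite /= ang2pi.
Qed.

Lemma h_loop : is_loop MT_base h_path.
Proof.
split; rewrite /h_path /MT_base ?mul0r ?mul1r //.
- apply/continuous_subspaceT/over_torus_continuous => [t|t].
    exact: cvg_cst.
  apply: (@continuous_comp R R _ (fun t => t * (2 * pi)) ang).
    by apply: cvgM; [exact: cvg_id|exact: cvg_cst].
  exact: ang_continuous.
- by rewrite -[2 * pi]add0r ang2pi.
Qed.

Definition gen_v1 : H1 R MT_base := hurewicz (loop_class (Loop v1_loop)).
Definition gen_v2 : H1 R MT_base := hurewicz (loop_class (Loop v2_loop)).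
Definition gen_h : H1 R MT_base := hurewicz (loop_class (Loop h_loop)).

End Generators.
End SeifertManifold.

(* Main.v *)
(** Idea: [M_T(b)] is the quotient of [R^3] by the integral Heisenberg group, acting
    by [(m, n, k).(x, y, z) = (x + m, y + n, z + k - b n x)].  The quotient map is
    found by embedding [M_T(b)] in [R^8]: next to the point of the torus one
    records the fibre coordinate times the [b]-th power of a section of the line
    bundle of Chern number one whose only zero is the centre of the disc, and the
    fibre coordinate of the solid torus times a bump function.  Lifting loops
    identifies [pi_1] with the Heisenberg group, whose commutator subgroup is
    generated by [h^b], which gives [H_1].  The maps [(2x, y, z)] and [(x, y, 2z)]
    carry the Heisenberg groups of [2b] and [b/2] onto subgroups of index two of
    that of [b], hence induce the two coverings; the automorphisms
    [(y, x, -z - bxy)], [(x, y + x, z - b x (x - 1) / 2)] and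
    [(x, y, z + s x + t y)] of [R^3] normalize the group and permute transitively
    the epimorphisms of each of the two kinds. *)
Require Import Defs.
From Stdlib Require Import Relation_Operators.
From mathcomp Require Import all_boot all_order all_algebra.
From mathcomp Require Import all_classical all_reals all_analysis.
From mathcomp Require Import ring lra zify.
Set Implicit Arguments.
Unset Strict Implicit.
Unset Printing Implicit Defensive.
Import Order.TTheory GRing.Theory Num.Theory.
Import numFieldNormedType.Exports.
Local Open Scope classical_set_scope.
Local Open Scope card_scope.
Local Open Scope ring_scope.

(** * Angles and complex arithmetic *)

(** [MT] is a quotient by a generated equivalence relation, so neither equality of its points nor
    their separation can be read off the definition. The embedding reduces both to equations between
    coordinates. Compactness then takes the place of charts: a map into [MT] is continuous as soon
    as its coordinates are, and the quotient map from [R^3] is open because the unit cube meets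
    every orbit. The twist [b n x] in the action has a single source: the section of the line bundle
    gains the factor [e^(2 pi i x)] between the two horizontal edges of the unit square, and its
    [b]-th power enters the fibre coordinate. Since [R^3] is convex, a loop is determined up to
    homotopy by the end point of its lift, so no presentation of the fundamental group has to be
    derived from the gluing. All coverings of one kind are built with literally the same total
    space, as [descend b (A \o L)] with a fixed [L]; two of them therefore differ by a homeomorphism
    of the base alone, and the identity covers it. *)

Section Angles.
Context {R : realType}.
Implicit Types t c s : R.

Lemma le_sinr t : 0 <= t -> sin t <= t.
Proof.
move=> t0.
have [c _] := @MVT_segment R sin cos 0 t t0 (fun x _ => is_derive_sin x)
  (continuous_subspaceT (@continuous_sin R)).
rewrite sin0 !subr0 => ->.
by rewrite ler_piMl // cos_le1.
Qed.

(** By [cos t = 1 - 2 sin^2 (t / 2)] and [sin u <= u]. It places the disc of radius 1 in the region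
    where both cosines are at least [2^-1], which is where [ramp] has reached 1. *)
Lemma cos_ge_half t : `|t| <= 1 -> 2^-1 <= cos t.
Proof.
rewrite -(cos_norm t); have := normr_ge0 t; move: `|t| => u u0 u1.
have -> : u = (u / 2) *+ 2 by rewrite -[_ *+ 2]mulr_natr divfK.
rewrite cos_mulr2n cos2sin2.
have := @le_sinr (u / 2); rewrite divr_ge0 // => /(_ isT) h.
have : 0 <= sin (u / 2).
  by apply: sin_ge0_pi; have := @pi_ge2 R; lra.
nra.
Qed.

Lemma cos_sin_surj c s : c ^+ 2 + s ^+ 2 = 1 ->
  exists t, [/\ - pi <= t, t <= pi, cos t = c & sin t = s].
Proof.
move=> cs.
have c1 : -1 <= c <= 1 by apply/andP; split; nra.
have sE : sin (acos c) = `|s|.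
  by rewrite sin_acos // -sqrtr_sqr; congr Num.sqrt; lra.
have := acos_ge0 c1; have := acos_lepi c1; have pi0 := @pi_ge0 R => ap a0.
have cK : cos (acos c) = c by rewrite acosK // in_itv.
have [s0|s0] := leP 0 s.
  by exists (acos c); split=> //; [lra|rewrite sE ger0_norm].
by exists (- acos c); split; [lra|lra|rewrite cosN|rewrite sinN sE ltr0_norm // opprK].
Qed.

Lemma cos_sin_int t (k : int) :
  cos (t + k%:~R * (2 * pi)) = cos t /\ sin (t + k%:~R * (2 * pi)) = sin t.
Proof.
have nat (n : nat) (u : R) : cos (u + n%:R * (2 * pi)) = cos u /\
    sin (u + n%:R * (2 * pi)) = sin u.
  have -> : n%:R * (2 * pi) = (pi *+ 2) *+ n :> R by rewrite -[in RHS]mulr_natl -[pi *+ 2]mulr_natl.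
  by split; [exact: (periodicn (@cosD2pi R))|exact: (periodicn (@sinD2pi R))].
case: k => n; first exact: nat.
rewrite NegzE mulrNz mulNr.
by have [<- <-] := nat n.+1 (t - n.+1%:R * (2 * pi)); rewrite subrK.
Qed.

Lemma cos_sin_inj (t u : R) : cos t = cos u -> sin t = sin u ->
  exists k : int, t = u + k%:~R * (2 * pi).
Proof.
move=> ct st; have pi0 := @pi_gt0 R.
(* The number of turns, rounded to the nearest integer, so that the remainder [d] lies in
   [[- pi, pi]], where [cos d = 1] forces [d = 0]. *)
pose k := Num.floor ((t - u) / (2 * pi) + 2^-1); exists k.
have : cos (t - u) = 1 by rewrite cosB ct st -!expr2 cos2Dsin2.
have := @floor_le _ ((t - u) / (2 * pi) + 2^-1).
have := @floorD1_gt _ ((t - u) / (2 * pi) + 2^-1).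
rewrite -/k rmorphD /= => h1 h2.
have [<- _] := cos_sin_int (t - u) (- k).
rewrite rmorphN mulNr.
set d := _ - _ => cd.
have e : (t - u) = (t - u) / (2 * pi) * (2 * pi) by rewrite divfK // gt_eqF // mulr_gt0.
have dlo : - pi <= d by rewrite /d e; nra.
have dhi : d <= pi by rewrite /d e; nra.
suff d0 : d = 0 by move: d0; rewrite /d; lra.
apply/eqP; rewrite -normr_eq0; apply/eqP; apply: cos_inj.
- by rewrite in_itv /= normr_ge0 ler_norml dlo dhi.
- by rewrite in_itv /= lexx ltW.
- by rewrite cos_norm cos0.
Qed.

(* The angle of a point of the right half of the unit circle, by
   [tan (t / 2) = sin t / (1 + cos t)]; on the left half only the sign matters. *)
Definition half_angle (p : R * R) : R := 2 * atan (p.2 / (1 + `|p.1|)).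

Lemma half_angle_continuous : continuous half_angle.
Proof.
move=> p; apply: cvgM; first exact: cvg_cst.
apply: (@continuous_comp _ _ _ (fun p : R * R => p.2 / (1 + `|p.1|)) atan);
  last exact: continuous_atan.
apply: cvgM; first exact: cvg_snd.
apply: cvgV; first by rewrite gt_eqF // ltr_pwDl.
by apply: cvgD; [exact: cvg_cst|apply: cvg_norm; exact: cvg_fst].
Qed.

Lemma half_angleE t : - pi <= t -> t <= pi -> 0 <= cos t ->
  half_angle (cos t, sin t) = t.
Proof.
move=> tl tr ct; rewrite /half_angle /= ger0_norm //.
have tpi : `|t| < pi.
  rewrite lt_neqAle ler_norml tl tr !andbT; apply/eqP => tp.
  by move: ct; rewrite -cos_norm tp cospi; lra.
move: tpi; rewrite ltr_norml => /andP[tl' tr'].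
have -> : t = (t / 2) *+ 2 by rewrite -[_ *+ 2]mulr_natr divfK.
set u := t / 2.
have cu : 0 < cos u by apply: cos_gt0_pihalf; rewrite /u; lra.
rewrite sin_mulr2n cos_mulr2n addrC subrK.
have -> : (cos u * sin u) *+ 2 / (cos u ^+ 2 *+ 2) = tan u.
  have c0 : cos u != 0 by rewrite gt_eqF.
  rewrite /tan; apply/eqP; rewrite eqr_div ?mulrn_eq0 ?expf_eq0 //=.
  by apply/eqP; rewrite mulrnAl mulrnAr mulrAC -expr2 mulrC.
by rewrite tanK ?mulr_natl // in_itv /= /u; lra.
Qed.

Lemma half_angle_ge0 (p : R * R) : 0 <= p.2 -> 0 <= half_angle p.
Proof.
move=> p0; rewrite mulr_ge0 // -atan0; apply: le_atan.
by rewrite divr_ge0 // addr_ge0.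
Qed.

Lemma half_angle_le0 (p : R * R) : p.2 <= 0 -> half_angle p <= 0.
Proof.
move=> p0; rewrite mulr_ge0_le0 // -atan0; apply: le_atan.
by rewrite mulr_le0_ge0 // invr_ge0 addr_ge0.
Qed.

Lemma half_angle_eq0 (p : R * R) : half_angle p = 0 -> p.2 = 0.
Proof.
move/eqP; rewrite /half_angle mulf_eq0 pnatr_eq0 /= => /eqP h.
have : p.2 / (1 + `|p.1|) = 0 by rewrite -(atanK (_ / _)) h tan0.
by move/eqP; rewrite mulf_eq0 invr_eq0 (gt_eqF (ltr_pwDl _ _)) // orbF => /eqP.
Qed.

End Angles.

(** * Compactness, separation and limits of pairs *)

Lemma set_type_compact (T : topologicalType) (A : set T) :
  compact A -> compact [set: set_type A].
Proof.
move=> cA F PF _.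
have FA : (set_val @ F) A.
  apply: (@filterS _ F _ setT) => [a _ /=|]; last exact: filterT.
  exact: set_valP.
have [t [At clt]] := cA (set_val @ F) _ FA.
exists (exist _ t (mem_set At)); split=> // B N FB.
rewrite /nbhs /= => -[_ [[N' oN' <-] /= N't] NN].
have [_ [[a Ba <-] N'a]] : (set_val @` B) `&` N' !=set0.
  apply: clt; last exact: open_nbhs_nbhs.
  have sB : B `<=` set_val @^-1` (set_val @` B) by move=> a Ba; exists a.
  exact: (filterS sB FB).
by exists a; split=> //; exact: NN.
Qed.

Lemma inj_hausdorff (T Z : topologicalType) (f : T -> Z) :
  continuous f -> injective f -> hausdorff_space Z -> hausdorff_space T.
Proof.
move=> cf fI hZ p q clpq; apply/fI/hZ => A B Ap Bq.
have [x [Ax Bx]] := clpq _ _ (cf _ _ Ap) (cf _ _ Bq).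
by exists (f x).
Qed.

Section PairLimits.
Context {T : Type} {F : set_system T} {FF : Filter F} {Y Z : topologicalType}.

Lemma cvg_pair_fun (f : T -> Y) (g : T -> Z) (y : Y) (z : Z) :
  f @ F --> y -> g @ F --> z -> (fun x => (f x, g x)) @ F --> (y, z).
Proof. by move=> fy gz; exact: cvg_pair fy gz. Qed.

Lemma cvg_fst_fun (f : T -> Y * Z) (p : Y * Z) : f @ F --> p -> (fun x => (f x).1) @ F --> p.1.
Proof. by move=> fp; apply: (@cvg_comp _ _ _ f fst F (nbhs p)) => //; exact: cvg_fst. Qed.

Lemma cvg_snd_fun (f : T -> Y * Z) (p : Y * Z) : f @ F --> p -> (fun x => (f x).2) @ F --> p.2.
Proof. by move=> fp; apply: (@cvg_comp _ _ _ f snd F (nbhs p)) => //; exact: cvg_snd. Qed.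

End PairLimits.

Section ComplexArithmetic.
Context {R : realType}.
Implicit Types (p q r : R * R) (t : R) (n : nat).

Definition cmul p q := (p.1 * q.1 - p.2 * q.2, p.1 * q.2 + p.2 * q.1).
Definition cscale t p := (t * p.1, t * p.2).
Definition cpow p n := iter n (cmul p) (1, 0).
Definition sqnorm p := p.1 ^+ 2 + p.2 ^+ 2.
Definition cis t := (cos t, sin t).

Lemma cmulC : commutative cmul.
Proof. by move=> p q; congr pair; rewrite /=; ring. Qed.

Lemma cmulA : associative cmul.
Proof. by move=> p q r; congr pair; rewrite /=; ring. Qed.

Lemma cmul1 : left_id (1, 0) cmul.
Proof. by move=> [a c]; congr pair; rewrite /=; ring. Qed.

Lemma cmulZ t p q : cmul (cscale t p) q = cscale t (cmul p q).
Proof. by congr pair; rewrite /=; ring. Qed.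

Lemma cscaleI t : t != 0 -> injective (cscale t).
Proof.
by move=> t0 [a c] [a' c'] [/(mulfI t0) -> /(mulfI t0) ->].
Qed.

Lemma sqnorm_ge0 p : 0 <= sqnorm p.
Proof. by rewrite addr_ge0 ?sqr_ge0. Qed.

Lemma sqnorm_eq0 p : sqnorm p = 0 -> p = (0, 0).
Proof.
case: p => a c /eqP; rewrite paddr_eq0 ?sqr_ge0 // !sqrf_eq0 /=.
by move=> /andP[/eqP -> /eqP ->].
Qed.

Lemma sqnormM p q : sqnorm (cmul p q) = sqnorm p * sqnorm q.
Proof. by rewrite /sqnorm /=; ring. Qed.

Lemma sqnormZ t p : sqnorm (cscale t p) = t ^+ 2 * sqnorm p.
Proof. by rewrite /sqnorm /=; ring. Qed.

Lemma sqnormX p n : sqnorm (cpow p n) = sqnorm p ^+ n.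
Proof.
elim: n => [|n ih]; first by rewrite /sqnorm /=; ring.
by rewrite /= sqnormM ih exprS.
Qed.

Lemma sqnorm_cis t : sqnorm (cis t) = 1.
Proof. exact: cos2Dsin2. Qed.

Lemma cmul_cancel p q r : sqnorm r != 0 -> cmul p r = cmul q r -> p = q.
Proof.
(* Multiplication by the conjugate of [r]. *)
move=> r0 /(congr1 (cmul^~ (r.1, - r.2))); rewrite -!cmulA.
have -> : cmul r (r.1, - r.2) = cscale (sqnorm r) (1, 0).
  by rewrite /cmul /cscale /sqnorm /=; congr pair; ring.
by rewrite !(cmulC _ (cscale _ _)) !cmulZ !cmul1 => /(cscaleI r0).
Qed.

Lemma cpowM p q n : cpow (cmul p q) n = cmul (cpow p n) (cpow q n).
Proof.
elim: n => [|n ih]; first by rewrite cmul1.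
by rewrite /= ih !cmulA; congr cmul; rewrite -!cmulA; congr cmul; rewrite cmulC.
Qed.

Lemma cisD t u : cis (t + u) = cmul (cis t) (cis u).
Proof. by rewrite /cis cosD sinD; congr pair => /=; ring. Qed.

Lemma cpow_cis t n : cpow (cis t) n = cis (n%:R * t).
Proof.
elim: n => [|n ih]; first by rewrite mul0r /cis cos0 sin0.
by rewrite /= ih -cisD -natr1 mulrDl mul1r addrC.
Qed.

Lemma cis_int t (k : int) : cis (t + k%:~R * (2 * pi)) = cis t.
Proof. by rewrite /cis; have [-> ->] := cos_sin_int t k. Qed.

Lemma cis_inj t u : cis t = cis u -> exists k : int, t = u + k%:~R * (2 * pi).
Proof. by move=> [ct st]; exact: cos_sin_inj. Qed.

Lemma cis_surj p : sqnorm p = 1 -> exists t, [/\ - pi <= t, t <= pi & cis t = p].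
Proof.
case: p => a c /cos_sin_surj[t [tl tr ct st]]; exists t; split=> //.
by rewrite /cis ct st.
Qed.

Section Limits.
Context {T : Type} {F : set_system T} {FF : Filter F}.
Implicit Types (f g : T -> R * R).

Lemma cvg_cmul f g p q : f @ F --> p -> g @ F --> q ->
  (fun x => cmul (f x) (g x)) @ F --> cmul p q.
Proof.
move=> fp gq.
have f1 := cvg_fst_fun fp.
have f2 := cvg_snd_fun fp.
have g1 := cvg_fst_fun gq.
have g2 := cvg_snd_fun gq.
apply: cvg_pair_fun.
  by apply: cvgB; apply: cvgM.
by apply: cvgD; apply: cvgM.
Qed.

Lemma cvg_cscale (u : T -> R) f t p : u @ F --> t -> f @ F --> p ->
  (fun x => cscale (u x) (f x)) @ F --> cscale t p.
Proof.
move=> ut fp.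
have f1 := cvg_fst_fun fp.
have f2 := cvg_snd_fun fp.
by apply: cvg_pair_fun; apply: cvgM.
Qed.

Lemma cvg_cpow f p n : f @ F --> p -> (fun x => cpow (f x) n) @ F --> cpow p n.
Proof.
by move=> fp; elim: n => [|n ih]; [exact: cvg_cst|exact: cvg_cmul].
Qed.

Lemma cvg_cis (u : T -> R) t : u @ F --> t -> (fun x => cis (u x)) @ F --> cis t.
Proof.
move=> ut; apply: cvg_pair_fun.
  by apply: (cvg_comp _ (@cos R) ut); exact: continuous_cos.
by apply: (cvg_comp _ (@sin R) ut); exact: continuous_sin.
Qed.

Lemma cvg_sqnorm f p : f @ F --> p -> (fun x => sqnorm (f x)) @ F --> sqnorm p.
Proof.
move=> fp.
have f1 := cvg_fst_fun fp.
have f2 := cvg_snd_fun fp.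
by apply: cvgD; apply: cvgM.
Qed.

End Limits.

Lemma cis_small_inj t u : `|t| <= 1 -> `|u| <= 1 -> cis t = cis u -> t = u.
Proof.
move=> t1 u1 tu; have pi2 := @pi_ge2 R.
have hE v : `|v| <= 1 -> half_angle (cis v) = v.
  move=> v1; have := cos_ge_half v1; move: v1; rewrite ler_norml => /andP[? ?] ?.
  by apply: half_angleE; lra.
by rewrite -(hE t) // -(hE u) // tu.
Qed.

End ComplexArithmetic.

(** * An embedding of [M_T(b)] in Euclidean space *)

Section Model.
Context {R : realType}.

Lemma disc_compact : compact (@disc_set R).
Proof.
apply: (@subclosed_compact _ _ ((`[-1, 1]%classic : set R) `*` (`[-1, 1]%classic : set R))).
- apply: (@preimage_closed _ _ sqnorm [set r | r <= 1]); last exact: closed_le.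
  by move=> z _; apply: cvg_sqnorm; exact: cvg_id.
- by apply: compact_setX; exact: segment_compact.
- by move=> [x y] /=; rewrite /disc_set !in_itv /= => xy; split;
    apply/andP; split; nra.
Qed.

Lemma circle_compact : compact (@circle_set R).
Proof.
apply: (@subclosed_compact _ _ (@disc_set R)).
- apply: (@preimage_closed _ _ sqnorm [set r | r = 1]); last exact: closed_eq.
  by move=> z _; apply: cvg_sqnorm; exact: cvg_id.
- exact: disc_compact.
- by move=> z; rewrite /circle_set /disc_set /= => ->.
Qed.

Lemma set_val_continuous (T : topologicalType) (A : set T) :
  continuous (set_val : set_type A -> T).
Proof. exact: initial_continuous. Qed.

Lemma torus_compact : compact [set: torus R].
Proof.
by rewrite -setXTT; apply: compact_setX; exact/set_type_compact/circle_compact.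
Qed.

Definition torus_val (p : torus R) : (R * R) * (R * R) :=
  (set_val p.1, set_val p.2).

Lemma torus_val_inj : injective torus_val.
Proof. by move=> [p p'] [q q'] [] /val_inj -> /val_inj ->. Qed.

Lemma torus_val_continuous : continuous torus_val.
Proof.
move=> p; apply: cvg_pair_fun.
  by apply: (cvg_comp _ set_val (@cvg_fst _ _ _ _ _)); exact: set_val_continuous.
by apply: (cvg_comp _ set_val (@cvg_snd _ _ _ _ _)); exact: set_val_continuous.
Qed.

(* On the right half circle this is the absolute value of the angle if that is
   at most 1, and it is at least 1 at all other points of the circle. *)
Definition angle_size (p : R * R) : R :=
  `|half_angle p| + 2 * Num.max 0 (2^-1 - p.1).

(** A continuous function that is the squared norm on the closed disc and at least 1 on the rest of
    the torus; it turns membership in the punctured torus into a closed condition. *)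
Definition radius2 (p : (R * R) * (R * R)) : R :=
  angle_size p.1 ^+ 2 + angle_size p.2 ^+ 2.

Lemma angle_size_continuous : continuous angle_size.
Proof.
move=> p; apply: cvgD; first by apply: cvg_norm; exact: half_angle_continuous.
apply: cvgM; first exact: cvg_cst.
apply: (@continuous_max _ _ (fun=> 0) (fun p : R * R => 2^-1 - p.1)).
  exact: cvg_cst.
by apply: cvgB; [exact: cvg_cst|exact: cvg_fst].
Qed.

Lemma radius2_continuous : continuous radius2.
Proof.
move=> p.
have c1 : {for p, continuous (fun p : (R * R) * (R * R) => angle_size p.1)}.
  by apply: (@continuous_comp _ _ _ fst angle_size);
    [exact: cvg_fst|exact: angle_size_continuous].
have c2 : {for p, continuous (fun p : (R * R) * (R * R) => angle_size p.2)}.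
  by apply: (@continuous_comp _ _ _ snd angle_size);
    [exact: cvg_snd|exact: angle_size_continuous].
exact: cvgD (cvgM c1 c1) (cvgM c2 c2).
Qed.

Lemma half_angle_cis (t : R) : `|t| <= 1 -> half_angle (cis t) = t.
Proof.
move=> t1; have := cos_ge_half t1; have pi2 := @pi_ge2 R.
by move: t1; rewrite ler_norml => /andP[? ?] ?; apply: half_angleE; lra.
Qed.

Lemma angle_size_cis (t : R) : `|t| <= 1 -> angle_size (cis t) = `|t|.
Proof.
move=> t1; rewrite /angle_size half_angle_cis //.
by have := cos_ge_half t1; rewrite maxEle /=; case: ifPn; lra.
Qed.

Lemma angle_size_ge0 (p : R * R) : 0 <= angle_size p.
Proof. by rewrite addr_ge0 // mulr_ge0 // le_max lexx. Qed.

Lemma angle_size_lt1 (p : R * R) : sqnorm p = 1 -> angle_size p < 1 ->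
  p = cis (half_angle p) /\ `|half_angle p| <= 1.
Proof.
move=> /cis_surj[t [tl tr <-]] d1.
have h : `|half_angle (cis t)| <= angle_size (cis t).
  by rewrite lerDl mulr_ge0 // le_max lexx.
(* A negative cosine would make the second summand of [angle_size] exceed 1. *)
have c0 : 0 <= cos t.
  move: d1; rewrite /angle_size maxEle /=; have := normr_ge0 (half_angle (cis t)).
  by case: ifPn; lra.
have e : half_angle (cis t) = t by exact: half_angleE.
by split; [rewrite e|apply: ltW; apply: le_lt_trans h d1].
Qed.

Lemma radius2_disc (s t : R) : s ^+ 2 + t ^+ 2 <= 1 ->
  radius2 (cis s, cis t) = s ^+ 2 + t ^+ 2.
Proof.
move=> st; rewrite /radius2 !angle_size_cis ?sqr_normr ?real_normK ?num_real //.
- by rewrite -(@expr_le1 _ 2) // real_normK ?num_real //; have := sqr_ge0 s; lra.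
- by rewrite -(@expr_le1 _ 2) // real_normK ?num_real //; have := sqr_ge0 t; lra.
Qed.

Lemma radius2_lt1 (p : (R * R) * (R * R)) :
  sqnorm p.1 = 1 -> sqnorm p.2 = 1 -> radius2 p < 1 ->
  p = (cis (half_angle p.1), cis (half_angle p.2)) /\
  radius2 p = half_angle p.1 ^+ 2 + half_angle p.2 ^+ 2.
Proof.
case: p => p q /= p1 q1 r1.
have := angle_size_ge0 p; have := angle_size_ge0 q.
move: (r1); rewrite /radius2 /= => r1' q0 p0.
have [|pE hp] := angle_size_lt1 p1; first nra.
have [|qE hq] := angle_size_lt1 q1; first nra.
rewrite -pE -qE; split=> //.
by rewrite pE qE !angle_size_cis // !half_angle_cis // !real_normK ?num_real.
Qed.

Lemma torus_val_disc (z : R * R) : torus_val (disc_in_torus z) = (cis z.1, cis z.2).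
Proof. by []. Qed.

Lemma sqnorm_torus_val (p : torus R) :
  sqnorm (torus_val p).1 = 1 /\ sqnorm (torus_val p).2 = 1.
Proof. by case: p => p q; split; [exact: (set_valP p)|exact: (set_valP q)]. Qed.

Lemma punctured_torusE (p : torus R) :
  punctured_torus_set p <-> 1 <= radius2 (torus_val p).
Proof.
split=> [pP|r1].
  have [//|r1] := leP 1 (radius2 (torus_val p)); exfalso; apply: pP.
  have [n1 n2] := sqnorm_torus_val p.
  have [pE rE] := radius2_lt1 n1 n2 r1.
  exists (half_angle (torus_val p).1, half_angle (torus_val p).2).
    by rewrite /= -rE.
  by apply: torus_val_inj; rewrite torus_val_disc /= -pE.
move=> [[s t] /= st pE]; move: r1.
by rewrite -pE torus_val_disc radius2_disc ?(ltW st) //= => /le_lt_trans/(_ st); rewrite ltxx.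
Qed.

Lemma punctured_torus_compact : compact (@punctured_torus_set R).
Proof.
apply: (subclosed_compact _ torus_compact) => //.
have -> : @punctured_torus_set R =
    (radius2 \o torus_val) @^-1` [set r | 1 <= r].
  by apply/seteqP; split=> p /punctured_torusE.
apply: preimage_closed; last exact: closed_ge.
move=> p _; apply: continuous_comp; first exact: torus_val_continuous.
exact: radius2_continuous.
Qed.

End Model.

Lemma pair_ext (A B : Type) (p q : A * B) : p.1 = q.1 -> p.2 = q.2 -> p = q.
Proof. by case: p q => [a c] [a' c'] /= -> ->. Qed.

Section Embedding.
Context {R : realType}.
Variable b : nat.
Local Notation model := (((R * R) * (R * R)) * ((R * R) * (R * R)))%type.

(** For [z = e^(is)] and [w = e^(it)] the product [w z^b] is [e^(i(bs + t))], the fibre coordinate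
    prescribed by the glue; the sign of the second disc coordinate reflects that [s_0] runs
    clockwise. The last entry vanishes on the boundary, and it retains [w] at the centre, where
    [z^b] may be zero. *)
Definition piece_embed (i : bool) : piece R i -> model :=
  if i is true then fun u : punctured_torus R * circle R =>
      (torus_val (set_val u.1), (set_val u.2, (0, 0)))
  else fun w : disc R * circle R =>
      ((cis (set_val w.1).1, cis (- (set_val w.1).2)),
       (cmul (set_val w.2) (cpow (set_val w.1) b),
        cscale (1 - Num.sqrt (sqnorm (set_val w.1))) (set_val w.2))).

Definition sum_embed (a : {i : bool & piece R i}) : model := @piece_embed (projT1 a) (projT2 a).

Definition MT_embed (x : MT R b%:Z) : model := sum_embed (repr x).

Lemma piece_embed_continuous i : continuous (@piece_embed i).
Proof.
case: i => -[u w] /=; apply: cvg_pair_fun.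
- apply: (@continuous_comp _ _ _ (set_val \o fst) torus_val).
    apply: (@continuous_comp _ _ _ fst set_val); first exact: cvg_fst.
    exact: set_val_continuous.
  exact: torus_val_continuous.
- apply: cvg_pair_fun; last exact: cvg_cst.
  apply: (@continuous_comp _ _ _ snd set_val); first exact: cvg_snd.
  exact: set_val_continuous.
- have c1 : {for (u, w), continuous (fun v : disc R * circle R => set_val v.1)}.
    apply: (@continuous_comp _ _ _ fst set_val); first exact: cvg_fst.
    exact: set_val_continuous.
  apply: cvg_pair_fun; apply: cvg_cis; first exact: cvg_fst_fun c1.
  by apply: cvgN; exact: cvg_snd_fun c1.
- have c1 : {for (u, w), continuous (fun v : disc R * circle R => set_val v.1)}.
    apply: (@continuous_comp _ _ _ fst set_val); first exact: cvg_fst.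
    exact: set_val_continuous.
  have c2 : {for (u, w), continuous (fun v : disc R * circle R => set_val v.2)}.
    apply: (@continuous_comp _ _ _ snd set_val); first exact: cvg_snd.
    exact: set_val_continuous.
  apply: cvg_pair_fun; first by apply: cvg_cmul => //; exact: cvg_cpow.
  apply: cvg_cscale => //; apply: cvgB; first exact: cvg_cst.
  apply: (@continuous_comp _ _ _ (fun v : disc R * circle R => sqnorm (set_val v.1))
    Num.sqrt); last exact: sqrt_continuous.
  exact: cvg_sqnorm.
Qed.

Lemma sum_embed_glue a c : meridian_glue b%:Z a c -> sum_embed a = sum_embed c.
Proof.
move=> [u [w [s [t [-> -> [u1 u2] [w1 w2]]]]]].
rewrite /sum_embed /= u1 u2 w1 w2 torus_val_disc /=.
have -> : sqnorm (cos s, sin s) = 1 := sqnorm_cis s.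
rewrite sqrtr1 subrr; congr (_, (_, _)); last by rewrite /cscale !mul0r.
by rewrite -/(cis s) -/(cis t) cpow_cis -cisD addrC.
Qed.

Lemma sum_embed_rel a c : MT_rel b%:Z a c -> sum_embed a = sum_embed c.
Proof.
move=> /asboolP; elim=> {a c} [a c|//|//|a c d _ -> //]; exact: sum_embed_glue.
Qed.

Lemma MT_embed_mk a : MT_embed (MT_mk b%:Z a) = sum_embed a.
Proof.
by apply: sum_embed_rel; apply/eqmodP; rewrite reprK.
Qed.

Lemma MT_embed_continuous : continuous MT_embed.
Proof.
apply/quotient_continuous.
rewrite (_ : _ \o _ = sum_embed); last exact/funext/MT_embed_mk.
by apply: sigT_continuous; exact: piece_embed_continuous.
Qed.

(** The torus point determines [z]. On the boundary [z^b] is invertible and the third entry gives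
    [w]; in the interior the factor [1 - |z|] is nonzero and the last entry does. *)
Lemma disc_circle_inj (z z' : disc R) (w w' : circle R) :
  piece_embed (i := false) (z, w) = piece_embed (i := false) (z', w') ->
  (z, w) = (z', w').
Proof.
have dz : sqnorm (set_val z) <= 1 := set_valP z.
have dz' : sqnorm (set_val z') <= 1 := set_valP z'.
have small (p : R * R) : sqnorm p <= 1 -> `|p.1| <= 1 /\ `|- p.2| <= 1.
  by rewrite /sqnorm normrN !ler_norml => h; split; apply/andP; split; nra.
have [a1 a2] := small _ dz; have [a1' a2'] := small _ dz'.
move=> h.
have e1 := cis_small_inj a1 a1' (congr1 (fun m : model => m.1.1) h).
have e2 := oppr_inj (cis_small_inj a2 a2' (congr1 (fun m : model => m.1.2) h)).
have zz : z = z' by apply: val_inj; exact: pair_ext e1 e2.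
rewrite {a1 a2 e1 e2}zz in h dz *; congr pair; apply: val_inj.
have [z1|z1] := eqVneq (sqnorm (set_val z')) 1.
  apply: (@cmul_cancel _ _ _ (cpow (set_val z') b)).
    by rewrite sqnormX z1 expr1n oner_neq0.
  exact: (congr1 (fun m : model => m.2.1) h).
apply: (@cscaleI _ (1 - Num.sqrt (sqnorm (set_val z')))).
  rewrite subr_eq0 eq_sym; apply: contra z1 => /eqP z1.
  by rewrite -(sqr_sqrtr (sqnorm_ge0 _)) z1 expr1n.
exact: (congr1 (fun m : model => m.2.2) h).
Qed.

(** The disc bounds the norm of the common torus point by 1 from above and the punctured torus from
    below, so the disc coordinate is some [e^(it)] and the glue applies. *)
Lemma torus_disc_glue (u : punctured_torus R * circle R) (w : disc R * circle R) :
  piece_embed (i := true) u = piece_embed (i := false) w ->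
  meridian_glue b%:Z (existT (piece R) true u) (existT (piece R) false w).
Proof.
case: u w => p x [z y] h.
have h1 := congr1 (fun m : model => m.1) h.
have h2 := congr1 (fun m : model => m.2.1) h.
have pE : set_val p = disc_in_torus ((set_val z).1, - (set_val z).2).
  by apply: torus_val_inj; rewrite torus_val_disc.
have zd : sqnorm (set_val z) <= 1 := set_valP z.
have [t [_ _ tz]] : exists t, [/\ - pi <= t, t <= pi & cis t = set_val z].
  apply: cis_surj; apply/eqP; rewrite eq_le zd /=.
  have /punctured_torusE : punctured_torus_set (set_val p) := set_valP p.
  by rewrite pE torus_val_disc /= radius2_disc sqrrN.
have [s [_ _ sy]] := cis_surj (set_valP y : sqnorm (set_val y) = 1).
exists (p, x), (z, y), t, s; split=> //=.
  split; first by rewrite pE -tz.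
  apply: val_inj; rewrite /= -/(cis _) addrC cisD -[b%:~R]/(b%:R) -cpow_cis tz sy.
  exact: h2.
by split; [rewrite -tz|apply: val_inj; exact: esym sy].
Qed.

Lemma sum_embed_inj a c : sum_embed a = sum_embed c -> MT_rel b%:Z a c.
Proof.
case: a c => -[] u [[] w] => /= h; apply/asboolP.
- have -> : u = w; last exact: rst_refl.
  apply: pair_ext; apply: val_inj.
    exact: torus_val_inj (congr1 (fun m : model => m.1) h).
  exact: (congr1 (fun m : model => m.2.1) h).
- by apply: rst_step; exact: torus_disc_glue.
- by apply: rst_sym; apply: rst_step; exact: torus_disc_glue.
- have -> : u = w; last exact: rst_refl.
  by case: u w h => z x [z' y]; exact: disc_circle_inj.
Qed.

Lemma MT_embed_inj : injective MT_embed.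
Proof.
move=> x y; rewrite -(reprK x) -(reprK y) !MT_embed_mk => /sum_embed_inj h.
exact/eqmodP.
Qed.

Lemma MT_hausdorff : hausdorff_space (MT R b%:Z).
Proof.
apply: (inj_hausdorff MT_embed_continuous MT_embed_inj).
exact: (@norm_hausdorff _ model).
Qed.

Lemma MT_compact : compact [set: MT R b%:Z].
Proof.
have -> : [set: MT R b%:Z] = MT_mk b%:Z @` setT.
  by apply/seteqP; split=> // x _; exists (repr x) => //; rewrite /MT_mk reprK.
apply: continuous_compact; first by apply: continuous_subspaceT; exact: pi_continuous.
apply: sigT_compact => [|[]]; first exact: finite_finset.
  rewrite -setXTT; apply: compact_setX; apply: set_type_compact.
    exact: punctured_torus_compact.
  exact: circle_compact.
rewrite -setXTT; apply: compact_setX; apply: set_type_compact.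
  exact: disc_compact.
exact: circle_compact.
Qed.

End Embedding.

(** * The universal covering *)

Section Strip.
Context {R : realType}.
Implicit Types (x y : R) (p : (R * R) * (R * R)).

(** The offset [pi] puts the lattice points over the base point [(-1, -1)] and the centre of the
    disc at [(1/2, 1/2)], the middle of the unit square. *)
Definition turn x := cis (pi + x * (2 * pi)).

Lemma turnE x : turn x = (- cos (x * (2 * pi)), - sin (x * (2 * pi))).
Proof. by rewrite /turn /cis addrC cosDpi sinDpi. Qed.

Lemma turn_int x (m : int) : turn (x + m%:~R) = turn x.
Proof. by rewrite /turn mulrDl addrA cis_int. Qed.

Lemma turn_inj x x' : turn x = turn x' -> exists m : int, x = x' + m%:~R.
Proof.
move=> /cis_inj[k h]; exists k.
have p0 : 2 * pi != 0 :> R by rewrite mulf_neq0 // gt_eqF // pi_gt0.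
by apply: (mulIf p0); rewrite mulrDl; lra.
Qed.

Lemma turn_surj (c : R * R) : sqnorm c = 1 -> exists x, [/\ 0 <= x, x <= 1 & turn x = c].
Proof.
move=> /cis_surj[t [tl tr <-]]; have p0 := @pi_gt0 R.
have p20 : 0 < 2 * pi :> R by lra.
exists ((t + pi) / (2 * pi)); split.
- by apply: divr_ge0; lra.
- by rewrite ler_pdivrMr // mul1r; lra.
- rewrite /turn divfK ?gt_eqF // -(cis_int t 1); congr cis; lra.
Qed.

Lemma sqnorm_turn x : sqnorm (turn x) = 1.
Proof. exact: sqnorm_cis. Qed.

Definition ramp (c : R) : R := Num.max 0 (Num.min 1 (2 * c)).

(** Equal to 1 on the disc by [cos_ge_half], and to 0 wherever one of the cosines is nonpositive, in
    particular over the edges of the unit square. *)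
Definition plateau p : R := ramp p.1.1 * ramp p.2.1.

(* In the strip [0 <= y <= 1] this is a convex combination of
   [i ((1 - y) + y e^(2 pi i x))], which gains the factor [e^(2 pi i x)] from
   the lower to the upper edge, and of the coordinate of the disc; both have the
   centre of the disc as their only zero. *)
Definition section y p : R * R :=
  ((1 - plateau p) * (y * p.1.2) + plateau p * half_angle p.1,
   (1 - plateau p) * (1 - y - y * p.1.1) - plateau p * half_angle p.2).

Definition depth p : R := Num.max 0 (1 - Num.sqrt (radius2 p)).

(** The denominator is the norm of the section where [depth] vanishes, that is outside the disc, and
    [r + (1 - r) = 1] at radius [r] inside it. One continuous formula thus gives a unit vector
    outside and the disc coordinate inside. *)
Definition unit_section y p : R * R :=
  cscale (Num.sqrt (sqnorm (section y p)) + depth p)^-1 (section y p).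

Lemma depth_eq0 p : 1 <= radius2 p -> depth p = 0.
Proof.
move=> r1; have : 1 <= Num.sqrt (radius2 p) by rewrite -(sqrtr1 R) ler_wsqrtr.
by rewrite /depth maxEle; case: ifPn; lra.
Qed.

Lemma depth_disc (s t : R) : s ^+ 2 + t ^+ 2 <= 1 ->
  depth (cis s, cis t) = 1 - Num.sqrt (s ^+ 2 + t ^+ 2).
Proof.
move=> st; rewrite /depth radius2_disc //.
have : Num.sqrt (s ^+ 2 + t ^+ 2) <= 1 by rewrite -(sqrtr1 R) ler_wsqrtr.
by rewrite maxEle; case: ifPn; lra.
Qed.

Lemma ramp_itv c : 0 <= ramp c /\ ramp c <= 1.
Proof. by rewrite /ramp minEle; case: ifPn => ?; rewrite maxEle; case: ifPn => *; lra. Qed.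

Lemma plateau_itv p : 0 <= plateau p /\ plateau p <= 1.
Proof.
rewrite /plateau; have [h0 h1] := ramp_itv p.1.1; have [k0 k1] := ramp_itv p.2.1.
by split; [exact: mulr_ge0|exact: mulr_ile1].
Qed.

Lemma ramp_le0 c : c <= 0 -> ramp c = 0.
Proof. by rewrite /ramp minEle; case: ifPn => ?; rewrite maxEle; case: ifPn => *; lra. Qed.

Lemma ramp_ge_half c : 2^-1 <= c -> ramp c = 1.
Proof. by rewrite /ramp minEle; case: ifPn => ?; rewrite maxEle; case: ifPn => *; lra. Qed.

(** The two sections that are mixed cannot cancel, since [h] has the sign of [s1] and [k] the sign
    opposite to [1 - 2 y]. Multiplying the first coordinate by [s1] and the second by [1 - 2 y]
    produces sums of nonnegative terms. *)
Lemma convex_section_eq0 (l h k c1 s1 c2 s2 y : R) :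
  0 <= l <= 1 -> 0 <= y ->
  (c1 <= 0 -> l = 0) -> (c2 <= 0 -> l = 0) ->
  0 <= h * s1 -> (h = 0 -> s1 = 0) -> k * (1 - 2 * y) <= 0 -> (k = 0 -> s2 = 0) ->
  (y = 2^-1 -> c2 = 1 /\ s2 = 0) ->
  c1 ^+ 2 + s1 ^+ 2 = 1 -> c2 ^+ 2 + s2 ^+ 2 = 1 ->
  (1 - l) * (y * s1) + l * h = 0 -> (1 - l) * (1 - y - y * c1) - l * k = 0 ->
  [/\ c1 = 1, s1 = 0, c2 = 1 & s2 = 0].
Proof.
move=> /andP[l0 l1] y0 lc1 lc2 hs h0 ky k0 yh n1 n2 f1 f2.
have e0 : s1 = 0.
  have [//|s0] := eqVneq s1 0.
  have s2p : 0 < s1 ^+ 2 by rewrite exprn_even_gt0.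
  have lh : l * (h * s1) = 0.
    have : 0 <= l * (h * s1) by exact: mulr_ge0.
    have : 0 <= (1 - l) * (y * s1 ^+ 2).
      by apply: mulr_ge0; [lra|apply: mulr_ge0; lra].
    have : ((1 - l) * (y * s1) + l * h) * s1 = 0 by rewrite f1 mul0r.
    by nra.
  have l00 : l = 0.
    move/eqP: lh; rewrite !mulf_eq0 (negbTE s0) orbF => /orP[/eqP //|/eqP/h0 e].
    by move: s0; rewrite e eqxx.
  have y00 : y = 0.
    by move: f1; rewrite l00 subr0 mul1r mul0r addr0 => /eqP;
      rewrite mulf_eq0 (negbTE s0) orbF => /eqP.
  by move: f2; rewrite l00 y00; lra.
have c1E : c1 = 1.
  have [c|c] := leP c1 0; last by move: n1; rewrite e0; nra.
  have c1N : c1 = -1 by move: n1; rewrite e0; nra.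
  by move: f2; rewrite (lc1 c) c1N; lra.
(* With [c1 = 1] the second coordinate reads [(1 - l) (1 - 2 y) - l k]. If [y] is not [2^-1], both
   terms vanish after multiplication by [1 - 2 y], so that [l = 1] and [k = 0]. *)
suff [-> ->] : c2 = 1 /\ s2 = 0 by [].
have [/yh //|yn] := eqVneq y 2^-1.
have y1 : 0 < (1 - 2 * y) ^+ 2.
  rewrite exprn_even_gt0 //=; apply: contra yn => /eqP h1; apply/eqP; lra.
move: f2; rewrite c1E => f2.
have lE : l = 1.
  have : 0 <= (1 - l) * (1 - 2 * y) ^+ 2 by apply: mulr_ge0; lra.
  have : l * (k * (1 - 2 * y)) <= 0 by exact: mulr_ge0_le0.
  have : ((1 - l) * (1 - y - y * 1) - l * k) * (1 - 2 * y) = 0 by rewrite f2 mul0r.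
  move=> e1 e2 e3.
  have : (1 - l) * (1 - 2 * y) ^+ 2 = 0 by nra.
  by move/eqP; rewrite mulf_eq0 (gt_eqF y1) orbF subr_eq0 => /eqP.
have kE : s2 = 0 by apply: k0; move: f2; rewrite lE; lra.
split=> //; have [/lc2|c] := leP c2 0; first by rewrite lE; lra.
by move: n2; rewrite kE; nra.
Qed.

Lemma section_eq0 x y : 0 <= y -> y <= 1 ->
  sqnorm (section y (turn x, turn y)) = 0 ->
  (turn x, turn y) = (cis 0, cis 0).
Proof.
move=> y0 y1 /sqnorm_eq0[] f1 f2; have p0 := @pi_gt0 R.
have sy : (turn y).2 * (1 - 2 * y) <= 0.
  rewrite /turn /= addrC sinDpi.
  have [h|h] := leP y 2^-1.
    have : 0 <= sin (y * (2 * pi)) by apply: sin_ge0_pi; apply/andP; split; nra.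
    by nra.
  have : 0 <= sin (y * (2 * pi) - pi) by apply: sin_ge0_pi; apply/andP; split; nra.
  rewrite sinB cospi sinpi; nra.
have yhalf : y = 2^-1 -> turn y = cis 0.
  move=> ->; rewrite /turn -(cis_int 0 1); congr cis; lra.
have [l0 l1] := plateau_itv (turn x, turn y).
have [] := @convex_section_eq0 (plateau (turn x, turn y)) (half_angle (turn x))
  (half_angle (turn y)) (turn x).1 (turn x).2 (turn y).1 (turn y).2 y.
- by rewrite l0 l1.
- exact: y0.
- by move=> h; rewrite /plateau (ramp_le0 h) mul0r.
- by move=> h; rewrite /plateau (@ramp_le0 (turn y).1 h) mulr0.
- have [h|/ltW h] := leP 0 (turn x).2.
    by apply: mulr_ge0 => //; exact: half_angle_ge0.
  by apply: mulr_le0 => //; exact: half_angle_le0.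
- exact: half_angle_eq0.
- have [h|h|->] := ltgtP y 2^-1; last by rewrite divff // subrr mulr0.
    have : (turn y).2 <= 0 by nra.
    by move/half_angle_le0; nra.
  have : 0 <= (turn y).2 by nra.
  by move/half_angle_ge0; nra.
- exact: half_angle_eq0.
- by move=> /yhalf ->; rewrite /cis cos0 sin0.
- exact: sqnorm_turn.
- exact: sqnorm_turn.
- exact: f1.
- exact: f2.
- by move=> e1 e2 e3 e4; congr pair; apply: pair_ext; rewrite /= ?cos0 ?sin0.
Qed.

(** Since this exceeds 1, the edges of the unit square stay outside the disc. *)
Lemma angle_size_turn0 : angle_size (turn 0) = 3.
Proof.
rewrite /angle_size /half_angle /turn mul0r addr0 /= cospi sinpi mul0r atan0 mulr0 normr0.
by rewrite maxEle; case: ifPn; lra.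
Qed.

Lemma turn1 : turn 1 = turn 0.
Proof. by rewrite -[1](add0r 1) (turn_int 0 1). Qed.

Lemma depth_edge x : depth (turn x, turn 0) = 0.
Proof.
apply: depth_eq0; rewrite /radius2 /= angle_size_turn0.
by have := sqr_ge0 (angle_size (turn x)); lra.
Qed.

Lemma plateau_edge x : plateau (turn x, turn 0) = 0.
Proof.
by rewrite /plateau (@ramp_le0 (turn 0).1) ?mulr0 //= mul0r addr0 cospi; lra.
Qed.

Lemma unit_section_bottom x : unit_section 0 (turn x, turn 0) = (0, 1).
Proof.
have sE : section 0 (turn x, turn 0) = (0, 1).
  by rewrite /section plateau_edge; apply: pair_ext; rewrite /=; ring.
rewrite /unit_section sE depth_edge /sqnorm /cscale /= expr0n expr1n add0r.
by rewrite sqrtr1 addr0 invr1 mulr0 mulr1.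
Qed.

Lemma unit_section_top x :
  unit_section 1 (turn x, turn 1) = cmul (cis (x * (2 * pi))) (0, 1).
Proof.
have sE : section 1 (turn x, turn 0) = cmul (cis (x * (2 * pi))) (0, 1).
  rewrite /section plateau_edge; rewrite turnE; apply: pair_ext; rewrite /=; ring.
rewrite turn1 /unit_section sE depth_edge sqnormM sqnorm_cis.
rewrite {1}/sqnorm /= expr0n expr1n add0r mulr1 sqrtr1 addr0 invr1.
by rewrite /cscale !mul1r.
Qed.

Lemma unit_section_disc y (s t : R) : s ^+ 2 + t ^+ 2 <= 1 ->
  unit_section y (cis s, cis t) = (s, - t).
Proof.
move=> st.
have s1 : `|s| <= 1.
  by rewrite -(@expr_le1 _ 2) // real_normK ?num_real //; have := sqr_ge0 t; lra.
have t1 : `|t| <= 1.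
  by rewrite -(@expr_le1 _ 2) // real_normK ?num_real //; have := sqr_ge0 s; lra.
have pE : plateau (cis s, cis t) = 1.
  by rewrite /plateau !ramp_ge_half ?mulr1 //; exact: cos_ge_half.
have sE : section y (cis s, cis t) = (s, - t).
  rewrite /section pE !half_angle_cis //; apply: pair_ext; rewrite /=; ring.
rewrite /unit_section sE depth_disc //.
have -> : sqnorm (s, - t) = s ^+ 2 + t ^+ 2 by rewrite /sqnorm sqrrN.
by rewrite addrC subrK invr1 /cscale !mul1r.
Qed.

(** At the only zero of the section, the centre of the disc, [depth] equals 1. *)
Lemma section_norm_gt0 x y : 0 <= y -> y <= 1 ->
  0 < Num.sqrt (sqnorm (section y (turn x, turn y))) + depth (turn x, turn y).
Proof.
move=> y0 y1.
have d0 : 0 <= depth (turn x, turn y) by rewrite /depth le_max lexx.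
have [e|n0] := eqVneq (sqnorm (section y (turn x, turn y))) 0; last first.
  by rewrite ltr_pwDl // sqrtr_gt0 lt_neqAle eq_sym n0 sqnorm_ge0.
rewrite e sqrtr0 add0r section_eq0 // /depth radius2_disc expr0n ?addr0 //.
by rewrite sqrtr0 subr0 lt_max ltr01 orbT.
Qed.

Lemma sqnorm_unit_section x y : 0 <= y -> y <= 1 ->
  1 <= radius2 (turn x, turn y) -> sqnorm (unit_section y (turn x, turn y)) = 1.
Proof.
move=> y0 y1 r1; have := @section_norm_gt0 x y y0 y1.
have dE := depth_eq0 r1.
rewrite /unit_section dE addr0 => n0.
by rewrite sqnormZ exprVn sqr_sqrtr ?sqnorm_ge0 // mulVf // gt_eqF // -sqrtr_gt0.
Qed.

Lemma ramp_continuous : continuous ramp.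
Proof.
move=> c; apply: (@continuous_max R R (fun=> 0) (fun c : R => Num.min 1 (2 * c))).
  exact: cvg_cst.
apply: (@continuous_min R R (fun=> 1) (fun c : R => 2 * c)); first exact: cvg_cst.
by apply: cvgM; [exact: cvg_cst|exact: cvg_id].
Qed.

Lemma depth_continuous : continuous depth.
Proof.
move=> p; apply: (@continuous_max _ _ (fun=> 0) (fun p => 1 - Num.sqrt (radius2 p))).
  exact: cvg_cst.
apply: cvgB; first exact: cvg_cst.
apply: (@continuous_comp _ _ _ radius2 Num.sqrt); first exact: radius2_continuous.
exact: sqrt_continuous.
Qed.

Section Limits.
Context {T : Type} {F : set_system T} {FF : Filter F}.
Variables (g : T -> R) (f : T -> (R * R) * (R * R)).

Lemma cvg_section y p : g @ F --> y -> f @ F --> p ->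
  (fun u => section (g u) (f u)) @ F --> section y p.
Proof.
move=> gy fp; have f1 := cvg_fst_fun fp; have f2 := cvg_snd_fun fp.
have f11 := cvg_fst_fun f1; have f12 := cvg_snd_fun f1.
have f21 := cvg_fst_fun f2; have f22 := cvg_snd_fun f2.
have cl : (fun u => plateau (f u)) @ F --> plateau p.
  apply: cvgM.
    by apply: (cvg_comp _ ramp f11); exact: ramp_continuous.
  by apply: (cvg_comp _ ramp f21); exact: ramp_continuous.
have ch1 : (fun u => half_angle (f u).1) @ F --> half_angle p.1.
  by apply: (cvg_comp _ half_angle f1); exact: half_angle_continuous.
have ch2 : (fun u => half_angle (f u).2) @ F --> half_angle p.2.
  by apply: (cvg_comp _ half_angle f2); exact: half_angle_continuous.
have c1 : (fun u => 1 - plateau (f u)) @ F --> 1 - plateau p.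
  by apply: cvgB => //; exact: cvg_cst.
apply: cvg_pair_fun; first by apply: cvgD; apply: cvgM => //; exact: cvgM.
apply: cvgB; apply: cvgM => //; apply: cvgB; last exact: cvgM.
by apply: cvgB => //; exact: cvg_cst.
Qed.

Lemma cvg_unit_section y p : g @ F --> y -> f @ F --> p ->
  0 < Num.sqrt (sqnorm (section y p)) + depth p ->
  (fun u => unit_section (g u) (f u)) @ F --> unit_section y p.
Proof.
move=> gy fp n0; have cs := cvg_section gy fp.
apply: cvg_cscale => //; apply: cvgV; first by rewrite gt_eqF.
apply: cvgD; last by apply: (cvg_comp _ depth fp); exact: depth_continuous.
apply: (cvg_comp _ Num.sqrt (cvg_sqnorm cs)); exact: sqrt_continuous.
Qed.

End Limits.

End Strip.

Lemma concat_left (R : realType) (X : topologicalType) (f g : R -> X) (t : R) :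
  0 <= t <= 1 -> concat f g (t / 2 + 0) = f t.
Proof.
by move=> t01; rewrite /concat; case: ifPn => h; [congr f|exfalso]; lra.
Qed.

Lemma concat_right (R : realType) (X : topologicalType) (f g : R -> X) (t : R) :
  0 <= t <= 1 -> f 1 = g 0 -> concat f g (t / 2 + 2^-1) = g t.
Proof.
rewrite /concat; case: ifPn => h t01 fg; last by clear fg; congr g; lra.
have t0 : t = 0 by clear fg; lra.
by rewrite t0 -fg; congr f; clear; lra.
Qed.

(** * The quotient map from [R^3] and the action of the Heisenberg group *)

Section Cover.
Context {R : realType}.
Variable b : nat.
Implicit Types (u v : R * R * R) (x y z : R).
Local Notation model := (((R * R) * (R * R)) * ((R * R) * (R * R)))%type.

(* The factor [cpow _ b] makes the fibre coordinate that of the trivialization over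
   the punctured torus; on the disc, [unit_section] is the disc coordinate. *)
Definition strip_cover u : model :=
  let p := (turn u.1.1, turn u.1.2) in
  (p, (cmul (cis (u.2 * (2 * pi))) (cpow (unit_section u.1.2 p) b),
       cscale (depth p) (cis (u.2 * (2 * pi))))).

Lemma turn_continuous : continuous (@turn R).
Proof.
move=> x; apply: cvg_cis; apply: cvgD; first exact: cvg_cst.
by apply: cvgM; [exact: cvg_id|exact: cvg_cst].
Qed.

(** Continuity is in all of [R^3], also at the edges [y = 0] and [y = 1]; this lets neighbouring
    strips be patched without one-sided limits. *)
Lemma strip_cover_continuous u : 0 <= u.1.2 -> u.1.2 <= 1 ->
  {for u, continuous strip_cover}.
Proof.
move=> y0 y1.
have c1 : v.1 @[v --> u] --> u.1 by exact: cvg_fst.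
have cx := cvg_fst_fun c1; have cy := cvg_snd_fun c1.
have cz : v.2 @[v --> u] --> u.2 by exact: cvg_snd.
have cp : (turn v.1.1, turn v.1.2) @[v --> u] --> (turn u.1.1, turn u.1.2).
  by apply: cvg_pair_fun; [apply: (cvg_comp _ turn cx)|apply: (cvg_comp _ turn cy)];
    exact: turn_continuous.
have ce : cis (v.2 * (2 * pi)) @[v --> u] --> cis (u.2 * (2 * pi)).
  by apply: cvg_cis; apply: cvgM => //; exact: cvg_cst.
apply: cvg_pair_fun => //; apply: cvg_pair_fun.
  apply: cvg_cmul => //; apply: cvg_cpow; apply: cvg_unit_section => //.
  exact: section_norm_gt0.
apply: cvg_cscale => //; apply: (cvg_comp _ depth cp); exact: depth_continuous.
Qed.

Lemma strip_cover_int x y z (m k : int) :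
  strip_cover ((x + m%:~R, y), z + k%:~R) = strip_cover ((x, y), z).
Proof. by rewrite /strip_cover /= turn_int mulrDl cis_int. Qed.

(** The factor [e^(2 pi i x)] gained by the section, raised to the power [b], becomes the shift
    [b x] of the fibre coordinate. *)
Lemma strip_cover_edge x z :
  strip_cover ((x, 1), z) = strip_cover ((x, 0), z + b%:R * x).
Proof.
rewrite /strip_cover /= unit_section_bottom unit_section_top turn1 depth_edge.
rewrite !/(cscale 0 _) !mul0r cpowM cpow_cis cmulA -cisD.
by congr (_, (cmul (cis _) _, _)); ring.
Qed.

Lemma strip_cover_embed u : 0 <= u.1.2 -> u.1.2 <= 1 ->
  exists a, sum_embed b a = strip_cover u.
Proof.
case: u => [[x y] z] /= y0 y1.
have pE : torus_val (ang (pi + x * (2 * pi)), ang (pi + y * (2 * pi))) =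
  (turn x, turn y) by [].
have [r1|r1] := leP 1 (radius2 (turn x, turn y)).
  have P1 : punctured_torus_set (ang (pi + x * (2 * pi)), ang (pi + y * (2 * pi))).
    exact/punctured_torusE.
  have C1 : circle_set (cmul (cis (z * (2 * pi)))
      (cpow (unit_section y (turn x, turn y)) b)).
    suff : sqnorm (cmul (cis (z * (2 * pi)))
      (cpow (unit_section y (turn x, turn y)) b)) = 1 by [].
    by rewrite sqnormM sqnorm_cis sqnormX sqnorm_unit_section // expr1n mulr1.
  pose p : punctured_torus R := exist (fun t => t \in @punctured_torus_set R) _ (mem_set P1).
  pose c : circle R := exist (fun t => t \in @circle_set R) _ (mem_set C1).
  exists (existT (piece R) true (p, c)).
  rewrite /sum_embed /strip_cover /=; congr (_, (_, _)).
  by rewrite depth_eq0 // /cscale !mul0r.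
have [eE rE] := radius2_lt1 (p := (turn x, turn y)) (sqnorm_turn x) (sqnorm_turn y) r1.
move: eE rE => /=; set s := half_angle (turn x); set t := half_angle (turn y) => eE rE.
have st : s ^+ 2 + t ^+ 2 <= 1 by rewrite -rE ltW.
have D1 : disc_set (s, - t) by rewrite /disc_set /= sqrrN.
pose d : disc R := exist (fun t => t \in @disc_set R) _ (mem_set D1).
exists (existT (piece R) false (d, ang (z * (2 * pi)))).
rewrite /sum_embed /strip_cover /= eE unit_section_disc // opprK; congr (_, (_, _)).
have -> : sqnorm (s, - t) = s ^+ 2 + t ^+ 2 by rewrite /sqnorm sqrrN.
by rewrite depth_disc.
Qed.

Lemma strip_cover_surj (a : {i : bool & piece R i}) :
  exists u, [/\ 0 <= u.1.2, u.1.2 <= 1 & strip_cover u = sum_embed b a].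
Proof.
have p20 : 2 * pi != 0 :> R by rewrite mulf_neq0 // gt_eqF // pi_gt0.
case: a => -[] [p w].
  have [n1 n2] := sqnorm_torus_val (set_val p).
  have [x [_ _ xE]] := turn_surj n1; have [y [y0 y1 yE]] := turn_surj n2.
  have pE : torus_val (set_val p) = (turn x, turn y) by rewrite xE yE; case: (torus_val _).
  have r1 : 1 <= radius2 (turn x, turn y).
    by rewrite -pE; apply/punctured_torusE; exact: set_valP p.
  set q := cpow (unit_section y (turn x, turn y)) b.
  have q1 : sqnorm q = 1 by rewrite sqnormX sqnorm_unit_section // expr1n.
  have w1 : sqnorm (set_val w) = 1 := set_valP w.
  (* The equation [e^(it) q = w] is solved by [w] times the conjugate of the unit number [q]. *)
  have [t [_ _ tE]] : exists t, [/\ - pi <= t, t <= pi &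
      cis t = cmul (set_val w) (q.1, - q.2)].
    apply: cis_surj; rewrite sqnormM w1 mul1r -q1 /sqnorm sqrrN //.
  exists ((x, y), t / (2 * pi)); split=> //.
  rewrite /strip_cover /sum_embed /= divfK // tE -/q pE; congr (_, (_, _)).
    rewrite -cmulA.
    have -> : cmul (q.1, - q.2) q = (1, 0).
      by apply: pair_ext; rewrite /= -?q1 /sqnorm; ring.
    by rewrite cmulC cmul1.
  by rewrite depth_eq0 // /cscale !mul0r.
have d1 : sqnorm (set_val p) <= 1 := set_valP p.
have w1 : sqnorm (set_val w) = 1 := set_valP w.
have [x [_ _ xE]] := turn_surj (sqnorm_cis (set_val p).1).
have [y [y0 y1 yE]] := turn_surj (sqnorm_cis (- (set_val p).2)).
have [t [_ _ tE]] := cis_surj w1.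
have d1' : (set_val p).1 ^+ 2 + (- (set_val p).2) ^+ 2 <= 1 by rewrite sqrrN.
exists ((x, y), t / (2 * pi)); split=> //.
rewrite /strip_cover /sum_embed /= divfK // tE xE yE unit_section_disc // opprK.
apply: pair_ext => //; apply: pair_ext => /=.
  by congr (cmul _ (cpow _ b)); exact: pair_ext.
by rewrite depth_disc // sqrrN.
Qed.

(** This is the action of [(0, - n, 0)]: the edge identity applied [n] times. *)
Definition strip_shift (n : int) u : R * R * R :=
  ((u.1.1, u.1.2 - n%:~R), u.2 + b%:R * n%:~R * u.1.1).

Definition plane_cover u : model := strip_cover (strip_shift (Num.floor u.1.2) u).

Definition act (g : int * int * int) u : R * R * R :=
  ((u.1.1 + g.1.1%:~R, u.1.2 + g.1.2%:~R),
   u.2 + g.2%:~R - b%:R * g.1.2%:~R * u.1.1).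

Definition hmul (g h : int * int * int) : int * int * int :=
  ((g.1.1 + h.1.1, g.1.2 + h.1.2), g.2 + h.2 - b%:Z * g.1.2 * h.1.1).

Lemma act_hmul g h u : act (hmul g h) u = act g (act h u).
Proof.
rewrite /act /hmul /=; congr (_, _, _); rewrite ?rmorphD ?rmorphB ?rmorphM /=; ring.
Qed.

Lemma act0 u : act (0, 0, 0) u = u.
Proof. by case: u => [[x y] z]; rewrite /act /=; congr (_, _, _); ring. Qed.

Lemma act_inj g h u : act g u = act h u -> g = h.
Proof.
case: g h => [[m n] k] [[m' n'] k'] [/addrI/intr_inj -> /addrI/intr_inj ->].
by move=> /addIr/addrI/intr_inj ->.
Qed.

Lemma plane_cover_act g u : plane_cover (act g u) = plane_cover u.
Proof.
case: u g => [[x y] z] [[m n] k]; rewrite /plane_cover /act /strip_shift /=.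
have -> : Num.floor (y + n%:~R) = Num.floor y + n.
  apply: floor_def; have := floor_le y; have := floorD1_gt y.
  by rewrite !rmorphD /= => *; apply/andP; split; lra.
set f := Num.floor y.
(* After the shift by [f + n] the two points differ by [m] in the first coordinate and by this
   integer in the third. *)
rewrite -(strip_cover_int x _ _ m (k + b%:Z * (f + n) * m)).
congr (strip_cover (_, _, _)); rewrite !rmorphD ?rmorphM ?rmorphD /=; ring.
Qed.

Lemma strip_shift_itv u :
  0 <= (strip_shift (Num.floor u.1.2) u).1.2 /\
  (strip_shift (Num.floor u.1.2) u).1.2 < 1.
Proof.
rewrite /= subr_ge0 floor_le; split=> //.
by have := floorD1_gt u.1.2; rewrite rmorphD /=; lra.
Qed.

Lemma strip_shift_continuous n : continuous (strip_shift n).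
Proof.
move=> u.
have c1 : v.1 @[v --> u] --> u.1 by exact: cvg_fst.
have cx := cvg_fst_fun c1; have cy := cvg_snd_fun c1.
have cz : v.2 @[v --> u] --> u.2 by exact: cvg_snd.
apply: cvg_pair_fun.
  by apply: cvg_pair_fun => //; apply: cvgB => //; exact: cvg_cst.
by apply: cvgD => //; apply: cvgM => //; exact: cvg_cst.
Qed.

Lemma strip_cover_shift n u : u.1.2 = n%:~R ->
  strip_cover (strip_shift (n - 1) u) = strip_cover (strip_shift n u).
Proof.
case: u => [[x y] z] /= ->; rewrite /strip_shift /= subrr rmorphB /= opprB addrC subrK.
by rewrite strip_cover_edge; congr (strip_cover (_, _, _)); ring.
Qed.

(** Near a point of integral height [n] the floor is [n] or [n - 1]. The two resulting formulas are
    continuous there and agree at the point by [strip_cover_shift]. At other heights the floor is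
    locally constant. *)
Lemma plane_cover_continuous : continuous plane_cover.
Proof.
move=> u; set n := Num.floor u.1.2.
have [s0 s1] := strip_shift_itv u.
have cn : {for u, continuous (strip_cover \o strip_shift n)}.
  apply: continuous_comp; first exact: strip_shift_continuous.
  by apply: strip_cover_continuous => //; exact: ltW.
have cy : v.1.2 @[v --> u] --> u.1.2.
  by apply: cvg_snd_fun; exact: cvg_fst.
have up : \forall v \near u, Num.floor v.1.2 < n + 1.
  have : \forall v \near u, v.1.2 < (n + 1)%:~R.
    apply: (cy [set y | y < (n + 1)%:~R]); apply: open_nbhs_nbhs; split.
      exact: open_lt.
    exact: floorD1_gt.
  by apply: filterS => v; rewrite -floor_lt_int.
move=> A An; rewrite /plane_cover in An.
suff : \forall v \near u, A (plane_cover v) by [].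
have A1 : \forall v \near u, A (strip_cover (strip_shift n v)) by exact: cn.
have [yn|yn] := eqVneq u.1.2 n%:~R.
  have cn' : {for u, continuous (strip_cover \o strip_shift (n - 1))}.
    apply: continuous_comp; first exact: strip_shift_continuous.
    by apply: strip_cover_continuous; rewrite /= yn rmorphB /=; lra.
  have A2 : \forall v \near u, A (strip_cover (strip_shift (n - 1) v)).
    by apply: cn'; rewrite /= strip_cover_shift.
  have lo : \forall v \near u, n - 1 <= Num.floor v.1.2.
    have : \forall v \near u, (n - 1)%:~R < v.1.2.
      apply: (cy [set y | (n - 1)%:~R < y]); apply: open_nbhs_nbhs; split.
        exact: open_gt.
      by rewrite /= yn ltr_int; lia.
    by apply: filterS => v /ltW; rewrite -floor_ge_int.
  near=> v; rewrite /= /plane_cover.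
  have : n - 1 <= Num.floor v.1.2 by near: v.
  have : Num.floor v.1.2 < n + 1 by near: v.
  have [->|ne] := eqVneq (Num.floor v.1.2) n; first by move=> _ _; near: v.
  move=> h1 h2; have -> : Num.floor v.1.2 = n - 1 by lia.
  by near: v.
have lo : \forall v \near u, n <= Num.floor v.1.2.
  have : \forall v \near u, n%:~R < v.1.2.
    apply: (cy [set y | n%:~R < y]); apply: open_nbhs_nbhs; split.
      exact: open_gt.
    by rewrite /= lt_neqAle eq_sym yn floor_le.
  by apply: filterS => v /ltW; rewrite -floor_ge_int.
near=> v; rewrite /= /plane_cover.
have : n <= Num.floor v.1.2 by near: v.
have : Num.floor v.1.2 < n + 1 by near: v.
move=> h1 h2; have -> : Num.floor v.1.2 = n by lia.
by near: v.
Unshelve. all: by end_near. Qed.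

Lemma strip_cover_fibre x y z z' : 0 <= y -> y <= 1 ->
  strip_cover ((x, y), z) = strip_cover ((x, y), z') ->
  exists k : int, z = z' + k%:~R.
Proof.
move=> y0 y1 h.
have h1 := congr1 (fun m : model => m.2.1) h.
have h2 := congr1 (fun m : model => m.2.2) h.
have p20 : 2 * pi != 0 :> R by rewrite mulf_neq0 // gt_eqF // pi_gt0.
suff /cis_inj[k kE] : cis (z * (2 * pi)) = cis (z' * (2 * pi)).
  by exists k; apply: (mulIf p20); rewrite [RHS]mulrDl.
have [d0|d0] := eqVneq (depth (turn x, turn y)) 0; last exact: cscaleI d0 _ _ h2.
apply: cmul_cancel h1; rewrite /= sqnormX sqnorm_unit_section // ?expr1n ?oner_neq0 //.
rewrite leNgt; apply/negP => r1; move: d0; rewrite /depth maxEle.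
have : Num.sqrt (radius2 (turn x, turn y)) < 1 by rewrite -(sqrtr1 R) ltr_sqrt.
by case: ifPn; lra.
Qed.

Lemma plane_cover_fibre u v : plane_cover u = plane_cover v -> exists g, u = act g v.
Proof.
case: u v => [[x y] z] [[x' y'] z'] h.
have [m xE] := turn_inj (congr1 (fun m : model => m.1.1) h).
have [n yE] := turn_inj (congr1 (fun m : model => m.1.2) h).
move: xE yE => /= xE yE.
(* [n] compares the fractional parts of the heights and [n'] the heights themselves. Once [v] is
   moved by [(m, n', 0)], only the fibre coordinate can differ. *)
pose n' := n + Num.floor y - Num.floor y'.
have vE : act (m, n', 0) (x', y', z') = (x, y, z' - b%:R * n'%:~R * x').
  rewrite /act /=; congr (_, _, _); [by rewrite xE| |by rewrite addr0].
  by rewrite /n' rmorphB rmorphD /=; lra.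
have := h; rewrite -(plane_cover_act (m, n', 0) (x', y', z')) vE.
have [s0 s1] := strip_shift_itv ((x, y), z).
move=> /(strip_cover_fibre s0 (ltW s1)) [k kE].
exists (hmul (0, 0, k) (m, n', 0)); rewrite act_hmul vE /act /=.
by move: kE => /= kE; rewrite mulr0z !addr0 mulr0 mul0r subr0; congr (_, _, _); lra.
Qed.

Lemma plane_cover_embed u : exists a, sum_embed b a = plane_cover u.
Proof.
have [s0 s1] := strip_shift_itv u; have [a aE] := strip_cover_embed s0 (ltW s1).
by exists a.
Qed.

Lemma plane_cover_surj (a : {i : bool & piece R i}) :
  exists u, plane_cover u = sum_embed b a.
Proof.
have [[[x y] z] [/= y0 y1 <-]] := strip_cover_surj a.
have [->|yn] := eqVneq y 1.
  exists ((x, 0), z + b%:R * x); rewrite /plane_cover /strip_shift /= floor0 strip_cover_edge.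
  by congr (strip_cover (_, _, _)); ring.
exists ((x, y), z); rewrite /plane_cover /strip_shift /=.
have -> : Num.floor y = 0 by apply: floor_def; rewrite y0 add0r lt_neqAle yn.
by congr (strip_cover (_, _, _)); ring.
Qed.

Definition cover u : MT R b%:Z := MT_mk b%:Z (projT1 (cid (plane_cover_embed u))).

Lemma MT_embed_cover u : MT_embed (cover u) = plane_cover u.
Proof. by rewrite /cover MT_embed_mk; case: cid. Qed.

(** The embedding is a closed map, from a compact space to a Hausdorff one, so the continuity of its
    composite [plane_cover] with [cover] suffices. *)
Lemma cover_continuous : continuous cover.
Proof.
apply/continuous_closedP => A cA.
have -> : cover @^-1` A = plane_cover @^-1` (@MT_embed R b @` A).
  apply/seteqP; split=> u /=; first by exists (cover u) => //; exact: MT_embed_cover.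
  by move=> [x Ax]; rewrite -MT_embed_cover => /MT_embed_inj <-.
apply: preimage_closed => [u _|]; first exact: plane_cover_continuous.
apply: compact_closed; first exact: (@norm_hausdorff _ model).
apply: continuous_compact; first exact/continuous_subspaceT/MT_embed_continuous.
exact: subclosed_compact cA (@MT_compact R b) _.
Qed.

Lemma cover_surj (x : MT R b%:Z) : exists u, cover u = x.
Proof.
have [u uE] := plane_cover_surj (repr x); exists u; apply: MT_embed_inj.
by rewrite MT_embed_cover uE.
Qed.

Lemma coverP u v : cover u = cover v <-> exists g, u = act g v.
Proof.
split=> [h|[g ->]]; first by apply: plane_cover_fibre; rewrite -!MT_embed_cover h.
by apply: MT_embed_inj; rewrite !MT_embed_cover plane_cover_act.
Qed.

Lemma act_continuous g : continuous (act g).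
Proof.
move=> u.
have c1 : v.1 @[v --> u] --> u.1 by exact: cvg_fst.
have cx := cvg_fst_fun c1; have cy := cvg_snd_fun c1.
have cz : v.2 @[v --> u] --> u.2 by exact: cvg_snd.
apply: cvg_pair_fun.
  by apply: cvg_pair_fun; apply: cvgD => //; exact: cvg_cst.
by apply: cvgB; [apply: cvgD => //; exact: cvg_cst|
  apply: cvgM => //; exact: cvg_cst].
Qed.

Lemma act_cube u : exists g, ((`[0, 1] `*` `[0, 1]) `*` `[0, 1])%classic (act g u).
Proof.
case: u => [[x y] z]; pose m := Num.floor x; pose n := Num.floor y.
(* Lowering [y] by [n] changes the fibre coordinate first, hence the correction under the floor. *)
pose k := Num.floor (z + b%:R * n%:~R * x).
exists ((- m, - n), - k); rewrite /act /= !in_itv /= !rmorphN /=.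
have := floor_le x; have := floorD1_gt x; have := floor_le y; have := floorD1_gt y.
have := floor_le (z + b%:R * n%:~R * x); have := floorD1_gt (z + b%:R * n%:~R * x).
rewrite -/m -/n -/k !rmorphD /= => *.
by split; [split|]; apply/andP; split; lra.
Qed.

(** The complement of the image of [A] is the image of the part of the unit cube outside all
    translates of [A]. That part is compact, so its image is closed. *)
Lemma cover_open A : open A -> open (cover @` A).
Proof.
move=> oA; rewrite -closedC.
pose K : set (R * R * R) := (`[0, 1] `*` `[0, 1]) `*` `[0, 1].
have cK : compact K.
  by apply: compact_setX; [apply: compact_setX|]; exact: segment_compact.
pose B := \bigcup_g (act g @^-1` A).
have oB : open B.
  by apply: bigcup_open => g _; apply: open_comp => // u _; exact: act_continuous.
have -> : ~` (cover @` A) = cover @` (K `&` ~` B).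
  apply/seteqP; split=> [x Ax|_ [u [_ Bu] <-] [v Av vu]].
    have [u ux] := cover_surj x; have [g Kg] := act_cube u.
    exists (act g u); last by rewrite -ux; apply/coverP; exists g.
    split=> // -[h _ Ah]; apply: Ax; exists (act h (act g u)) => //.
    by rewrite -ux -act_hmul; apply/coverP; exists (hmul h g).
  by apply: Bu; have /coverP[g gE] := vu; exists g => //=; rewrite -gE.
apply: compact_closed; first exact: MT_hausdorff.
apply: continuous_compact; first exact/continuous_subspaceT/cover_continuous.
apply: (@subclosed_compact _ _ K) => //.
apply: closedI; last exact: open_closedC.
by apply: compact_closed => //; exact: norm_hausdorff.
Qed.

(** * Lifting of paths and homotopies *)

(* Invariant under the action: [v] is the product of [u], in the Heisenberg group
   law extending [hmul], with an element of the cube of side 1 centred at 0. *)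
Definition close u v :=
  [/\ `|v.1.1 - u.1.1| < 2^-1, `|v.1.2 - u.1.2| < 2^-1 &
      `|v.2 - u.2 + b%:R * u.1.2 * (v.1.1 - u.1.1)| < 2^-1].

Lemma close_refl u : close u u.
Proof. by split; rewrite !subrr ?mulr0 ?addr0 normr0. Qed.

Lemma close_act g u v : close u v -> close (act g u) (act g v).
Proof.
have e1 : (act g v).1.1 - (act g u).1.1 = v.1.1 - u.1.1 by rewrite /=; ring.
have e2 : (act g v).1.2 - (act g u).1.2 = v.1.2 - u.1.2 by rewrite /=; ring.
have e3 : (act g v).2 - (act g u).2 + b%:R * (act g u).1.2 * ((act g v).1.1 - (act g u).1.1) =
    v.2 - u.2 + b%:R * u.1.2 * (v.1.1 - u.1.1) by rewrite /=; ring.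
by case=> h1 h2 h3; split; rewrite ?e3 ?e1 ?e2.
Qed.

Lemma close_open : open [set p : (R * R * R) * (R * R * R) | close p.1 p.2].
Proof.
have -> : [set p : (R * R * R) * (R * R * R) | close p.1 p.2] =
  [set p | `|p.2.1.1 - p.1.1.1| < 2^-1] `&` [set p | `|p.2.1.2 - p.1.1.2| < 2^-1] `&`
  [set p | `|p.2.2 - p.1.2 + b%:R * p.1.1.2 * (p.2.1.1 - p.1.1.1)| < 2^-1].
  by apply/seteqP; split=> p; [case=> ? ? ?; split|case=> [[? ?] ?]; split].
have c1 (p : (R * R * R) * (R * R * R)) : q.1 @[q --> p] --> p.1 by exact: cvg_fst.
have c2 (p : (R * R * R) * (R * R * R)) : q.2 @[q --> p] --> p.2 by exact: cvg_snd.
have c1x p := cvg_fst_fun (cvg_fst_fun (c1 p)).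
have c1y p := cvg_snd_fun (cvg_fst_fun (c1 p)).
have c1z p := cvg_snd_fun (c1 p).
have c2x p := cvg_fst_fun (cvg_fst_fun (c2 p)).
have c2y p := cvg_snd_fun (cvg_fst_fun (c2 p)).
have c2z p := cvg_snd_fun (c2 p).
apply: openI; [apply: openI|].
- apply: (@open_comp _ _ (fun p : (R * R * R) * (R * R * R) => `|p.2.1.1 - p.1.1.1|)
    [set r | r < 2^-1]); last exact: open_lt.
  by move=> p _; apply: cvg_norm; exact: (cvgB (c2x p) (c1x p)).
- apply: (@open_comp _ _ (fun p : (R * R * R) * (R * R * R) => `|p.2.1.2 - p.1.1.2|)
    [set r | r < 2^-1]); last exact: open_lt.
  by move=> p _; apply: cvg_norm; exact: (cvgB (c2y p) (c1y p)).
- apply: (@open_comp _ _ (fun p : (R * R * R) * (R * R * R) =>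
    `|p.2.2 - p.1.2 + b%:R * p.1.1.2 * (p.2.1.1 - p.1.1.1)|)
    [set r | r < 2^-1]); last exact: open_lt.
  move=> p _; apply: cvg_norm; apply: cvgD; first exact: (cvgB (c2z p) (c1z p)).
  apply: cvgM; last exact: (cvgB (c2x p) (c1x p)).
  by apply: cvgM; [exact: cvg_cst|exact: c1y].
Qed.

(** The half-width [2^-1] keeps each difference below 1, and an integer of absolute value below 1 is
    0. The third difference is an integer only once the first two vanish. *)
Lemma close_inj w u v : close w u -> close w v -> cover u = cover v -> u = v.
Proof.
move=> wu wv /coverP[[[m n] k] uE].
have small (i : int) : `|i%:~R : R| < 1 -> i = 0.
  by rewrite -intr_norm -[1]/(1%:~R) ltr_int; lia.
have [h1 h2 h3] := wu; have [h1' h2' h3'] := wv.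
have m0 : m = 0.
  apply: small; have -> : m%:~R = (u.1.1 - w.1.1) - (v.1.1 - w.1.1).
    by rewrite uE /=; ring.
  by apply: le_lt_trans (ler_normB _ _) _; lra.
have n0 : n = 0.
  apply: small; have -> : n%:~R = (u.1.2 - w.1.2) - (v.1.2 - w.1.2).
    by rewrite uE /=; ring.
  by apply: le_lt_trans (ler_normB _ _) _; lra.
have k0 : k = 0.
  apply: small; have -> : k%:~R = (u.2 - w.2 + b%:R * w.1.2 * (u.1.1 - w.1.1)) -
      (v.2 - w.2 + b%:R * w.1.2 * (v.1.1 - w.1.1)).
    by rewrite uE m0 n0 /=; ring.
  by apply: le_lt_trans (ler_normB _ _) _; lra.
by rewrite uE m0 n0 k0 act0.
Qed.

Lemma nbhs_close u v : close u v -> exists A B,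
  [/\ nbhs u A, nbhs v B & forall u' v', A u' -> B v' -> close u' v'].
Proof.
move=> uv.
have : nbhs (u, v) [set p | close p.1 p.2].
  by apply: open_nbhs_nbhs; split=> //; exact: close_open.
case=> -[A B] /= [Au Bv] AB; exists A, B; split=> // u' v' Au' Bv'.
exact: (AB (u', v')).
Qed.

(* The point of the fibre over [x] that is close to [u]; [u] itself if there is none. *)
Definition transport u (x : MT R b%:Z) : R * R * R :=
  xget u [set v | close u v /\ cover v = x].

Lemma transportE u v : close u v -> transport u (cover v) = v.
Proof.
move=> uv; rewrite /transport; case: xgetP => [w _ [uw wv]|/(_ v) []//].
exact: close_inj uw uv wv.
Qed.

Lemma cover_nbhs u A : nbhs u A -> nbhs (cover u) (cover @` A).
Proof.
move=> Au; have sA : cover @` A° `<=` cover @` A.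
  by apply: image_subset; exact: interior_subset.
apply: (filterS sA); apply: open_nbhs_nbhs; split; last by exists u.
by apply: cover_open; exact: open_interior.
Qed.

(** [transport] is a local inverse of [cover]; its joint continuity in the starting point and the
    target comes from the openness of [cover]. *)
Lemma cvg_transport (T : Type) (F : set_system T) {FF : Filter F}
    (f : T -> R * R * R) (g : T -> MT R b%:Z) u v :
  f @ F --> u -> g @ F --> cover v -> close u v ->
  (fun t => transport (f t) (g t)) @ F --> v.
Proof.
move=> fu gv uv A Av; have [B [C [Bu Cv BC]]] := nbhs_close uv.
have h1 : F (f @^-1` B) by exact: fu.
have h2 : F (g @^-1` (cover @` (A `&` C))).
  by apply: gv; apply: cover_nbhs; exact: filterI.
have sub : f @^-1` B `&` g @^-1` (cover @` (A `&` C)) `<=`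
    [set t | A (transport (f t) (g t))].
  by move=> t [/= Bft [w [Aw Cw] <-]]; rewrite transportE //; exact: BC.
exact: (filterS sub (filterI h1 h2)).
Qed.

Definition transportable (x y : MT R b%:Z) :=
  forall u, cover u = x -> exists2 v, close u v & cover v = y.

(** Since [close] is invariant, a neighbourhood found at one lift of [x] serves all points of the
    fibres. *)
Lemma transportable_nbhs (x : MT R b%:Z) : exists2 A, nbhs x A &
  forall y z : MT R b%:Z, A y -> A z -> transportable y z.
Proof.
have [u <-] := cover_surj x; have [B [C [Bu Cu BC]]] := nbhs_close (close_refl u).
exists (cover @` (B `&` C)); first by apply: cover_nbhs; exact: filterI.
move=> _ _ [v [Bv Cv] <-] [w [Bw Cw] <-] v' /coverP[g ->].
exists (act g w); first by apply: close_act; exact: BC.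
by apply/coverP; exists g.
Qed.

Local Notation I01 := (`[0, 1]%classic : set R).

(** A Lebesgue number argument on the compact square, with large [n] in the role of a small
    radius. *)
Lemma uniform_transport (f : R * R -> MT R b%:Z) : continuous f ->
  exists n : nat, forall p q, (I01 `*` I01) p -> (I01 `*` I01) q ->
    transportable (f p) (f (p.1 + n.+1%:R^-1 * q.1, p.2 + n.+1%:R^-1 * q.2)).
Proof.
move=> cf.
have cK : compact (I01 `*` I01) by apply: compact_setX; exact: segment_compact.
have ncK := (compact_near_coveringP _).1 cK.
pose P (n : nat) (p : R * R) := forall q, (I01 `*` I01) q ->
  transportable (f p) (f (p.1 + n.+1%:R^-1 * q.1, p.2 + n.+1%:R^-1 * q.2)).
have := ncK nat \oo P _.
case=> [p Kp|N _ NP]; last by exists N => p q Kp Kq; exact: (NP N (leqnn N)).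
have [A Afp tA] := transportable_nbhs (f p).
have : nbhs p (f @^-1` A) by exact: cf.
rewrite -nbhs_ballE => -[e /= e0 pe].
exists (ball p (e / 2), [set n | n.+1%:R^-1 < e / 2]).
  split; first by apply: nbhsx_ballx; rewrite divr_gt0.
  have e20 : 0 < e / 2 by rewrite divr_gt0.
  exact: (near_infty_natSinv_lt (PosNum e20)).
move=> [p' n] /= [[b1 b2] ne] q [Iq1 Iq2]; apply: tA.
  by apply: pe; apply: (@le_ball _ _ _ (e / 2)); [lra|split].
apply: pe; move: Iq1 Iq2 b1 b2; rewrite /ball /= !in_itv /= => /andP[q10 q11] /andP[q20 q21].
rewrite /ball_ => b1 b2.
have n0 : 0 <= n.+1%:R^-1 :> R by rewrite invr_ge0.
have h1 : 0 <= n.+1%:R^-1 * q.1 < e / 2.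
  rewrite mulr_ge0 //=; apply: le_lt_trans ne; exact: ler_piMr.
have h2 : 0 <= n.+1%:R^-1 * q.2 < e / 2.
  rewrite mulr_ge0 //=; apply: le_lt_trans ne; exact: ler_piMr.
move: h1 h2 b1 b2; move: (_ * q.1) (_ * q.2) => d1 d2; rewrite !ltr_norml.
move=> /andP[? ?] /andP[? ?] /andP[? ?] /andP[? ?].
by rewrite /prod_ball; split; rewrite /ball /= /ball_ ltr_norml; apply/andP; split; lra.
Qed.

(* The lift is transported along the segment from the corner to [p], in finitely
   many steps. *)
Lemma lift_square (f : R * R -> MT R b%:Z) u : continuous f -> cover u = f (0, 0) ->
  exists F : R * R -> R * R * R,
    [/\ forall p, (I01 `*` I01) p -> {for p, continuous F},
        forall p, (I01 `*` I01) p -> cover (F p) = f p & F (0, 0) = u].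
Proof.
move=> cf uf; have [n fn] := uniform_transport cf.
(* [F i p] lifts the value of [f] at the fraction [i / (n + 1)] of the segment from the origin to
   [p]. *)
pose F := fix F i (p : R * R) := if i is j.+1 then
  transport (F j p) (f (n.+1%:R^-1 * i%:R * p.1, n.+1%:R^-1 * i%:R * p.2)) else u.
have n0 : 0 < n.+1%:R^-1 :> R by rewrite invr_gt0.
have step i p : (i <= n)%N -> (I01 `*` I01) p ->
    transportable (f (n.+1%:R^-1 * i%:R * p.1, n.+1%:R^-1 * i%:R * p.2))
      (f (n.+1%:R^-1 * i.+1%:R * p.1, n.+1%:R^-1 * i.+1%:R * p.2)).
  move=> iN Kp.
  have : (I01 `*` I01) (n.+1%:R^-1 * i%:R * p.1, n.+1%:R^-1 * i%:R * p.2).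
    have i1 : 0 <= (n.+1%:R^-1 * i%:R : R) <= 1.
      apply/andP; split; first by rewrite mulr_ge0 // ltW.
      by rewrite mulrC ler_pdivrMr // mul1r ler_nat ltnW.
    move: Kp i1 => [] /=; rewrite !in_itv /= => /andP[? ?] /andP[? ?] /andP[? ?].
    by split; apply/andP; split; try exact: mulr_ge0; exact: mulr_ile1.
  move=> /fn/(_ Kp) /=; rewrite -[i.+1%:R]natr1.
  by rewrite mulrDr mulr1 !mulrDl.
have FP i : (i <= n.+1)%N -> forall p, (I01 `*` I01) p ->
    {for p, continuous (F i)} /\
    cover (F i p) = f (n.+1%:R^-1 * i%:R * p.1, n.+1%:R^-1 * i%:R * p.2).
  elim: i => [_ p Kp|i ih iN p Kp].
    by split; [exact: cvg_cst|rewrite mulr0 !mul0r].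
  have [ci fi] := ih (ltnW iN) p Kp.
  have [v cv vE] := step i p iN Kp _ fi.
  rewrite /= -vE transportE //; split=> //.
  have e : transport (F i p) (f (n.+1%:R^-1 * i.+1%:R * p.1, n.+1%:R^-1 * i.+1%:R * p.2)) = v.
    by rewrite -vE transportE.
  suff : transport (F i q) (f (n.+1%:R^-1 * i.+1%:R * q.1, n.+1%:R^-1 * i.+1%:R * q.2))
    @[q --> p] --> v by rewrite -e.
  apply: cvg_transport cv; first exact: ci.
  rewrite vE.
  apply: (@continuous_comp _ _ _ (fun p : R * R =>
    (n.+1%:R^-1 * i.+1%:R * p.1, n.+1%:R^-1 * i.+1%:R * p.2)) f); last exact: cf.
  by apply: cvg_pair_fun; apply: cvgM; try exact: cvg_cst; [exact: cvg_fst|exact: cvg_snd].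
exists (F n.+1); split=> [p Kp|p Kp|].
- by have [] := FP n.+1 (leqnn _) p Kp.
- by have [_ ->] := FP n.+1 (leqnn _) p Kp; rewrite mulVf ?pnatr_eq0 // !mul1r; case: p Kp.
- elim: n.+1 => //= i ->; rewrite !mulr0 -uf transportE //; exact: close_refl.
Qed.


(** A retraction onto the unit interval: it extends paths and homotopies to globally continuous
    maps, as [lift_square] requires. *)
Definition clamp (t : R) : R := Num.max 0 (Num.min 1 t).

Lemma clamp_itv t : I01 (clamp t).
Proof.
by rewrite /= in_itv /= /clamp le_max lexx ge_max ler01 ge_min lexx.
Qed.

Lemma clampK t : I01 t -> clamp t = t.
Proof.
by rewrite /= in_itv /= => /andP[t0 t1]; rewrite /clamp (min_idPr t1) (max_idPr t0).
Qed.

Lemma clamp_continuous : continuous clamp.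
Proof.
move=> t; apply: (@continuous_max R R (fun=> 0) (fun t : R => Num.min 1 t)).
  exact: cvg_cst.
by apply: (@continuous_min R R (fun=> 1) (fun t : R => t)); [exact: cvg_cst|exact: cvg_id].
Qed.

Lemma continuous_clamp (X : topologicalType) (c : R -> X) :
  {within I01, continuous c} -> continuous (c \o clamp).
Proof.
move=> cc; apply/continuous_subspace_setT.
apply: (@within_comp R R X setT I01 clamp c) => //.
- by apply: continuous_subspaceT; exact: clamp_continuous.
- by move=> t _; exact: clamp_itv.
Qed.

Lemma continuous_within (X Y : topologicalType) (A : set X) (f : X -> Y) :
  (forall x : X, A x -> {for x, continuous f}) -> {within A, continuous f}.
Proof.
move=> cf; apply/subspace_continuousP => x Ax; apply: cvg_within_filter.
exact: cf.
Qed.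

Lemma lift_path (c : R -> MT R b%:Z) u : {within I01, continuous c} ->
  cover u = c 0 -> exists F : R -> R * R * R,
    [/\ {within I01, continuous F}, forall t, I01 t -> cover (F t) = c t & F 0 = u].
Proof.
move=> cc uc.
have c0 : clamp 0 = 0 by apply: clampK; rewrite /= in_itv /= lexx ler01.
have [||F [cF Fc F0]] := @lift_square (c \o clamp \o snd) u.
- move=> p; apply: (@continuous_comp _ _ _ snd (c \o clamp)); first exact: cvg_snd.
  exact: continuous_clamp.
- by rewrite /= c0.
exists (F \o (fun t => (0, t))); split=> [|t It|] //.
  apply: continuous_within => t It.
  apply: (@continuous_comp _ _ _ (fun t => (0, t)) F).
    by apply: cvg_pair_fun; [exact: cvg_cst|exact: cvg_id].
  by apply: cF; split=> //=; rewrite in_itv /= lexx ler01.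
rewrite /= Fc /= ?clampK //.
by split=> //=; rewrite in_itv /= lexx ler01.
Qed.

Lemma lift_homotopy (H : R * R -> MT R b%:Z) u :
  {within I01 `*` I01, continuous H} -> cover u = H (0, 0) ->
  exists F : R * R -> R * R * R,
    [/\ {within I01 `*` I01, continuous F},
        forall p, (I01 `*` I01) p -> cover (F p) = H p & F (0, 0) = u].
Proof.
move=> cH uH.
have c0 : clamp 0 = 0 by apply: clampK; rewrite /= in_itv /= lexx ler01.
pose cl (p : R * R) := (clamp p.1, clamp p.2).
have [||F [cF FH F0]] := @lift_square (H \o cl) u.
- apply/continuous_subspace_setT.
  apply: (@within_comp _ _ _ setT (I01 `*` I01) cl H) => //.
    apply: continuous_subspaceT => p; apply: cvg_pair_fun.
      by apply: (@continuous_comp _ _ _ fst clamp); [exact: cvg_fst|exact: clamp_continuous].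
    by apply: (@continuous_comp _ _ _ snd clamp); [exact: cvg_snd|exact: clamp_continuous].
  by move=> p _; split; exact: clamp_itv.
- by rewrite /cl /= c0.
exists F; split=> // [|p Kp]; first by apply: continuous_within.
by rewrite FH //= /cl; case: p Kp => s t [? ?]; rewrite !clampK.
Qed.

(** The set where the lifts agree is open by [close_inj], closed because [R^3] is Hausdorff, and
    contains 0; the line is connected. *)
Lemma lift_unique (F G : R -> R * R * R) :
  {within I01, continuous F} -> {within I01, continuous G} ->
  (forall t, I01 t -> cover (F t) = cover (G t)) -> F 0 = G 0 ->
  forall t, I01 t -> F t = G t.
Proof.
move=> /continuous_clamp cF /continuous_clamp cG FG FG0.
pose A : set R := [set t | F (clamp t) = G (clamp t)].
suff AT : A = setT.
  by move=> t It; have : A t by [rewrite AT]; rewrite /A /= clampK.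
have : connected [set: R] by apply/connected_intervalP.
apply.
- exists 0; rewrite /A /= clampK //= in_itv /= lexx ler01 //.
- exists A; last by rewrite setTI.
  rewrite openE => t At; have := nbhs_close (close_refl (F (clamp t))).
  case=> B [C [Bu Cu BC]].
  have BF s : C s -> close (F (clamp t)) s.
    by move=> Cs; apply: BC => //; exact: nbhs_singleton.
  have n1 : nbhs t ((F \o clamp) @^-1` C) by exact: cF.
  have n2 : nbhs t ((G \o clamp) @^-1` C) by apply: cG; rewrite /= -At.
  apply: filterS2 n1 n2 => s /= Fs Gs; rewrite /A /=.
  apply: (close_inj (BF _ Fs) (BF _ Gs)); apply: FG; exact: clamp_itv.
- exists A; last by rewrite setTI.
  have -> : A = (fun t => F (clamp t) - G (clamp t)) @^-1` [set 0].
    apply/seteqP; split=> t /=; first by rewrite /A /= => ->; rewrite subrr.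
    by move/eqP; rewrite subr_eq0 => /eqP.
  apply: preimage_closed => [t _|]; first by apply: cvgB; [exact: cF|exact: cG].
  apply: accessible_closed_set1; apply: hausdorff_accessible; exact: norm_hausdorff.
Qed.


Definition hinv (g : int * int * int) : int * int * int :=
  ((- g.1.1, - g.1.2), - g.2 - b%:Z * g.1.1 * g.1.2).

Lemma actK g : cancel (act g) (act (hinv g)).
Proof.
move=> [[x y] z]; rewrite /act /=.
by congr (_, _, _); rewrite ?rmorphB ?rmorphN ?rmorphM ?rmorphN /=; ring.
Qed.

Lemma actVK g : cancel (act (hinv g)) (act g).
Proof.
move=> [[x y] z]; rewrite /act /=.
by congr (_, _, _); rewrite ?rmorphB ?rmorphN ?rmorphM ?rmorphN /=; ring.
Qed.

(** * The fundamental group and its abelianization *)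

(* The section of the line bundle is [i] at the corners of the square, and
   [i^b e^(2 pi i z)] must be 1. *)
Definition base_lift : R * R * R := ((0, 0), - (b%:R / 4)).

Lemma cis_base :
  cmul (cis (- (b%:R / 4) * (2 * pi))) (cpow (0, 1) b) = (1, 0) :> R * R.
Proof.
have -> : (0, 1) = cis (pi / 2) :> R * R by rewrite /cis cos_pihalf sin_pihalf.
rewrite cpow_cis -cisD; have -> : - (b%:R / 4) * (2 * pi) + b%:R * (pi / 2) = 0 :> R by field.
by rewrite /cis cos0 sin0.
Qed.

Lemma strip_cover_bottom x z : strip_cover ((x, 0), z) =
  ((turn x, turn 0), (cmul (cis (z * (2 * pi))) (cpow (0, 1) b), (0, 0))).
Proof.
by rewrite /strip_cover /= unit_section_bottom depth_edge /cscale !mul0r.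
Qed.

Lemma cover_bottom x z a : sum_embed b a = strip_cover ((x, 0), z) ->
  cover ((x, 0), z) = MT_mk b%:Z a.
Proof.
move=> aE; apply: MT_embed_inj; rewrite MT_embed_cover MT_embed_mk aE.
rewrite /plane_cover /strip_shift /= floor0.
by congr (strip_cover (_, _, _)); ring.
Qed.

Lemma ang_val (t : R) : set_val (ang t) = cis t.
Proof. by []. Qed.

Lemma cover_v1 (t : R) : cover ((t, 0), - (b%:R / 4)) = v1_path b%:Z t.
Proof.
apply: cover_bottom; rewrite strip_cover_bottom cis_base /sum_embed /=.
apply: pair_ext; last by apply: pair_ext => //; rewrite ang_val /cis /= cos0 sin0.
by apply: pair_ext => //=; rewrite /turn mul0r addr0.
Qed.

Lemma cover_h (t : R) : cover ((0, 0), - (b%:R / 4) + t) = h_path b%:Z t.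
Proof.
apply: cover_bottom; rewrite strip_cover_bottom [X in cis X]mulrDl addrC cisD -cmulA.
by rewrite cis_base cmulC cmul1 /sum_embed /= /torus_val /turn /= mul0r addr0.
Qed.

(** Over [x = 0] the section is constantly [i], outside the plateau, so the fibre coordinate stays
    put at every height. *)
Lemma cover_v2 (t : R) : I01 t -> cover ((0, t), - (b%:R / 4)) = v2_path b%:Z t.
Proof.
rewrite /= in_itv /= => /andP[t0 t1].
apply: MT_embed_inj; rewrite MT_embed_cover /plane_cover MT_embed_mk.
set f := Num.floor t.
have fE : turn (t - f%:~R) = turn t by rewrite -(turn_int (t - f%:~R) f) subrK.
have pE : plateau (turn 0, turn t) = 0.
  by rewrite /plateau (@ramp_le0 _ (turn 0).1) ?mul0r //= mul0r addr0 cospi; lra.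
have dE : depth (turn 0, turn t) = 0.
  apply: depth_eq0; rewrite /radius2 /= angle_size_turn0.
  by have := sqr_ge0 (angle_size (turn t)); lra.
have sE y : unit_section y (turn 0, turn t) = (0, 1).
  have e : section y (turn 0, turn t) = (0, 1).
    rewrite /section pE turnE mul0r cos0 sin0; apply: pair_ext; rewrite /=; ring.
  rewrite /unit_section e dE /sqnorm /cscale /= expr0n expr1n add0r.
  by rewrite sqrtr1 addr0 invr1 mulr0 mulr1.
rewrite /strip_cover /strip_shift /= mulr0 addr0 fE sE dE cis_base /sum_embed /=.
rewrite /cscale !mul0r.
apply: pair_ext; last by apply: pair_ext => //; rewrite ang_val /cis /= cos0 sin0.
by apply: pair_ext => //=; rewrite /turn mul0r addr0.
Qed.

Lemma cover_base : cover base_lift = MT_base R b%:Z.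
Proof. by rewrite (cover_v1 0) /v1_path mul0r addr0. Qed.

Local Notation x0 := (MT_base R b%:Z).

Definition path_lift (c : R -> MT R b%:Z) (F : R -> R * R * R) u v :=
  [/\ {within I01, continuous F}, forall t, I01 t -> cover (F t) = c t,
      F 0 = u & F 1 = v].

Lemma itv01_0 : I01 0. Proof. by rewrite /= in_itv /= lexx ler01. Qed.
Lemma itv01_1 : I01 1. Proof. by rewrite /= in_itv /= lexx ler01. Qed.

Lemma path_lift_unique c F G u v w : path_lift c F u v -> path_lift c G u w -> v = w.
Proof.
move=> [cF Fc F0 <-] [cG Gc G0 <-]; apply: lift_unique => //; last exact: itv01_1.
  by move=> t It; rewrite Fc // Gc.
by rewrite F0 G0.
Qed.

Lemma act_path_lift g c F u v : path_lift c F u v ->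
  path_lift c (act g \o F) (act g u) (act g v).
Proof.
move=> [cF Fc <- <-]; split=> // [|t It].
  apply: (@within_comp R (R * R * R)%type _ I01 setT) => //.
  by apply: continuous_subspaceT; exact: act_continuous.
by rewrite -Fc //; apply/coverP; exists g.
Qed.

Lemma loop_lift (c : R -> MT R b%:Z) u : is_loop (cover u) c ->
  exists g F, path_lift c F u (act g u).
Proof.
move=> [cc c0 c1]; have [F [cF Fc F0]] := lift_path cc (esym c0).
have : cover (F 1) = cover u by rewrite Fc ?c1 //; exact: itv01_1.
by move=> /coverP[g gE]; exists g, F; split.
Qed.

Lemma loop_degree_subproof (c : loop R x0) :
  exists g, exists F, path_lift c F base_lift (act g base_lift).
Proof. by apply: loop_lift; rewrite cover_base; exact: loopP. Qed.

Definition degree (c : loop R x0) : int * int * int :=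
  projT1 (cid (loop_degree_subproof c)).

Lemma degreeP (c : loop R x0) : exists F, path_lift c F base_lift (act (degree c) base_lift).
Proof. by rewrite /degree; case: cid. Qed.

Lemma degree_eq (c : loop R x0) F g :
  path_lift c F base_lift (act g base_lift) -> degree c = g.
Proof.
move=> Fg; have [G Gc] := degreeP c.
exact: act_inj (path_lift_unique Gc Fg).
Qed.

Lemma degree_homotopic (c d : loop R x0) : loop_homotopic x0 c d -> degree c = degree d.
Proof.
move=> [H [cH H0 H1 Hx]]; have i0 := itv01_0; have i1 := itv01_1.
have [|F [cF FH F0]] := lift_homotopy (u := base_lift) cH.
  by rewrite cover_base; have [-> _] := Hx _ i0.
have row s : I01 s -> {within I01, continuous (fun t => F (s, t))}.
  move=> Is; apply: (@within_comp R (R * R)%type _ I01 (I01 `*` I01) (fun t => (s, t)) F) => //.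
  by apply: continuous_subspaceT => t; apply: cvg_pair_fun; [exact: cvg_cst|exact: cvg_id].
have col t : I01 t -> {within I01, continuous (fun s => F (s, t))}.
  move=> It; apply: (@within_comp R (R * R)%type _ I01 (I01 `*` I01) (fun s => (s, t)) F) => //.
  by apply: continuous_subspaceT => s; apply: cvg_pair_fun; [exact: cvg_id|exact: cvg_cst].
have const t : I01 t -> (forall s, I01 s -> H (s, t) = x0) -> F (1, t) = F (0, t).
  move=> It Ht; apply: (@lift_unique (fun s => F (s, t)) (fun=> F (0, t))) => //.
  - exact: col.
  - by apply: continuous_subspaceT => s; exact: cvg_cst.
  - by move=> s Is; rewrite !FH // !Ht.
have e0 : F (1, 0) = F (0, 0) by apply: const => // s Is; have [] := Hx _ Is.
have e1 : F (1, 1) = F (0, 1) by apply: const => // s Is; have [] := Hx _ Is.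
have [G cG] := degreeP c.
have Fc : path_lift c (fun t => F (0, t)) base_lift (F (0, 1)).
  by split=> // [|t It]; [exact: row|rewrite FH // H0].
apply/esym; apply: (@degree_eq d (fun t => F (1, t))).
rewrite -(path_lift_unique Fc cG) -e1.
by split=> // [|t It|]; [exact: row|rewrite FH // H1|rewrite e0].
Qed.

(** The lifts have the same end points, and the straight-line homotopy between them in [R^3] is
    projected. *)
Lemma degree_inj (c d : loop R x0) : degree c = degree d -> loop_homotopic x0 c d.
Proof.
move=> cd; have [F [cF Fc F0 F1]] := degreeP c; have [G [cG Gd G0 G1]] := degreeP d.
pose H (p : R * R) := F p.2 + p.1 *: (G p.2 - F p.2).
have i0 := itv01_0; have i1 := itv01_1.
exists (cover \o H); split.
- apply: (@within_comp (R * R)%type _ _ (I01 `*` I01) setT) => //; last first.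
    by apply: continuous_subspaceT; exact: cover_continuous.
  have snd_within (K : R -> R * R * R) : {within I01, continuous K} ->
      {within I01 `*` I01, continuous (fun p : R * R => K p.2)}.
    move=> cK; apply: (@within_comp (R * R)%type R _ (I01 `*` I01) I01 snd K) => //.
      by apply: continuous_subspaceT => p; exact: cvg_snd.
    by move=> p [].
  have wF := snd_within _ cF; have wG := snd_within _ cG.
  move=> p; apply: cvgD; first exact: wF.
  apply: cvgZ; last by apply: cvgB; [exact: wG|exact: wF].
  have : {within I01 `*` I01, continuous (fst : R * R -> R)}.
    by apply: continuous_subspaceT => q; exact: cvg_fst.
  exact.
- by move=> t It; rewrite /= /H /= scale0r addr0 Fc.
- by move=> t It; rewrite /= /H /= scale1r addrC subrK Gd.
- move=> s Is; rewrite /= /H /= F0 G0 F1 G1 cd !subrr !scaler0 !addr0; split.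
    exact: cover_base.
  by rewrite -cover_base; apply/coverP; exists (degree d).
Qed.

(** The second half of the lift starts at the translate of [base_lift] by [degree c], hence is the
    translate by [degree c] of the lift of [d]. *)
Lemma degree_mul (c d : loop R x0) :
  degree (loop_mul c d) = hmul (degree c) (degree d).
Proof.
have [F Fc] := degreeP c; have [G Gd] := degreeP d.
have [K [cK Kcd K0 K1]] := degreeP (loop_mul c d).
have [cF Fc' F0 F1] := Fc.
have half (a : R) : 0 <= a <= 2^-1 -> {within I01, continuous (fun t => K (t / 2 + a))}.
  move=> /andP[a0 a1].
  apply: (@within_comp R R _ I01 I01 (fun t => t / 2 + a) K) => //.
    apply: continuous_subspaceT => t; apply: cvgD; last exact: cvg_cst.
    by apply: cvgM; [exact: cvg_id|exact: cvg_cst].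
  by move=> t; rewrite /= !in_itv /= => /andP[? ?]; apply/andP; split; lra.
have half1 : 1 / 2 + 2^-1 = 1 :> R by clear; lra.
have K1' : path_lift c (fun t => K (t / 2 + 0)) base_lift (K 2^-1).
  split=> [|t It||]; [by apply: half; rewrite lexx invr_ge0 ler0n| |by rewrite mul0r addr0|
    by rewrite mul1r addr0].
  have := It; rewrite /= in_itv /= => t01.
  have I2 : I01 (t / 2 + 0).
    by rewrite /= in_itv /=; clear -t01; apply/andP; split; lra.
  by rewrite Kcd //= concat_left.
have K2' : path_lift d (fun t => K (t / 2 + 2^-1)) (K 2^-1)
    (act (degree (loop_mul c d)) base_lift).
  split=> [|t It||]; [by apply: half; rewrite lexx invr_ge0 ler0n| |by rewrite mul0r add0r|
    by rewrite half1].
  have [_ d0 _] := loopP d; have [_ _ c1] := loopP c.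
  have := It; rewrite /= in_itv /= => t01.
  have I2 : I01 (t / 2 + 2^-1).
    by rewrite /= in_itv /=; clear -t01; apply/andP; split; lra.
  by rewrite Kcd //= concat_right // c1 d0.
have h := path_lift_unique K1' Fc; rewrite h in K2'.
apply: act_inj (path_lift_unique K2' _); rewrite act_hmul.
exact: act_path_lift Gd.
Qed.

Lemma continuous_coordinates (F : R -> R * R * R) :
  continuous (fun t => (F t).1.1) -> continuous (fun t => (F t).1.2) ->
  continuous (fun t => (F t).2) -> {within I01, continuous F}.
Proof.
move=> c1 c2 c3; apply: continuous_subspaceT => t.
have -> : F = (fun t => (((F t).1.1, (F t).1.2), (F t).2)).
  by apply/funext => u; case: (F u) => -[].
by apply: cvg_pair_fun; [apply: cvg_pair_fun; [exact: c1|exact: c2]|exact: c3].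
Qed.

Lemma degree_v1 : degree (Loop (v1_loop R b%:Z)) = (1, 0, 0).
Proof.
apply: (@degree_eq _ (fun t => ((t, 0), - (b%:R / 4)))); split=> //.
- by apply: continuous_coordinates => /= t; try exact: cvg_id; exact: cvg_cst.
- by move=> t _; exact: cover_v1.
- by rewrite /base_lift /act; congr (_, _, _); rewrite /=; ring.
Qed.

Lemma degree_v2 : degree (Loop (v2_loop R b%:Z)) = (0, 1, 0).
Proof.
apply: (@degree_eq _ (fun t => ((0, t), - (b%:R / 4)))); split=> //.
- by apply: continuous_coordinates => /= t; try exact: cvg_id; exact: cvg_cst.
- exact: cover_v2.
- by rewrite /base_lift /act; congr (_, _, _); rewrite /=; ring.
Qed.

Lemma degree_h : degree (Loop (h_loop R b%:Z)) = (0, 0, 1).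
Proof.
apply: (@degree_eq _ (fun t => ((0, 0), - (b%:R / 4) + t))); split=> //.
- apply: continuous_coordinates => /= t; try exact: cvg_cst.
  by apply: cvgD; [exact: cvg_cst|exact: cvg_id].
- by move=> t _; exact: cover_h.
- by rewrite /base_lift addr0.
- by rewrite /base_lift /act; congr (_, _, _); rewrite /=; ring.
Qed.

Lemma hmulVg g h : hmul g h = h -> g = (0, 0, 0).
Proof.
case: g h => [[m n] k] [[m' n'] k'] [] /= e1 e2.
have -> : m = 0 by lia.
have -> : n = 0 by lia.
by rewrite mulr0 mul0r subr0 => e3; congr (_, _, _); lia.
Qed.

Lemma hinvE g h : hmul g h = (0, 0, 0) -> g = hinv h.
Proof.
case: g h => [[m n] k] [[m' n'] k'] [] /= e1 e2 e3; rewrite /hinv /=.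
have -> : m = - m' by lia.
have nE : n = - n' by lia.
by move: e3; rewrite nE => e3; congr (_, _, _); lia.
Qed.

Local Open Scope quotient_scope.

Definition pi1_degree (a : pi1 R x0) : int * int * int := degree (repr a).

Lemma pi1_degreeE c : pi1_degree (loop_class c) = degree c.
Proof. by apply: degree_homotopic; apply/loop_classP; rewrite /loop_class reprK. Qed.

Lemma pi1_degree_inj : injective pi1_degree.
Proof.
apply: loop_classW => c; apply: loop_classW => d; rewrite !pi1_degreeE => cd.
by apply/loop_classP; exact: degree_inj.
Qed.

Lemma pi1_degreeM (a c : pi1 R x0) :
  pi1_degree (a * c)%g = hmul (pi1_degree a) (pi1_degree c).
Proof.
move: a; apply: loop_classW => a; move: c; apply: loop_classW => c.
rewrite [(_ * _)%g](_ : _ = loop_class (loop_mul a c)); last exact: pi1_mulE.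
by rewrite !pi1_degreeE degree_mul.
Qed.

Lemma pi1_degree1 : pi1_degree 1%g = (0, 0, 0).
Proof. by apply: (@hmulVg _ (pi1_degree 1%g)); rewrite -pi1_degreeM mul1g. Qed.

Lemma pi1_degreeV (a : pi1 R x0) : pi1_degree (a^-1)%g = hinv (pi1_degree a).
Proof. by apply: hinvE; rewrite -pi1_degreeM mulVg pi1_degree1. Qed.

Lemma hurewiczM (a c : pi1 R x0) : hurewicz (a * c)%g = hurewicz a + hurewicz c.
Proof. by rewrite /hurewicz -ab_addE. Qed.

Lemma hurewiczV (a : pi1 R x0) : hurewicz (a^-1)%g = - hurewicz a.
Proof. by rewrite /hurewicz -ab_oppE. Qed.

Lemma derived_degree (a : pi1 R x0) : derived a ->
  [/\ (pi1_degree a).1.1 = 0, (pi1_degree a).1.2 = 0 &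
      exists k : int, (pi1_degree a).2 = b%:Z * k].
Proof.
elim=> {a} [|a c _ [a1 a2 [k a3]] _ [c1 c2 [l c3]]|a _ [a1 a2 [k a3]]|a c].
- by rewrite pi1_degree1; split=> //; exists 0; rewrite mulr0.
- rewrite pi1_degreeM /hmul a1 a2 a3 c1 c2 c3 /=; split=> //.
  by exists (k + l); ring.
- rewrite pi1_degreeV /hinv a1 a2 a3 /=; split; rewrite ?oppr0 //.
  by exists (- k); ring.
- rewrite /commg /conjg !pi1_degreeM !pi1_degreeV.
  case: (pi1_degree a) (pi1_degree c) => [[m n] k] [[m' n'] k'].
  rewrite /hmul /hinv /=; split; [ring|ring|].
  by exists (m * n' - n * m'); ring.
Qed.

(** [e] is the one-parameter subgroup through the degree of [a]; this gives integer powers of [a]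
    with explicit degrees. *)
Lemma pi1_power (a : pi1 R x0) (e : int -> int * int * int) :
  pi1_degree a = e 1 -> (forall i j, hmul (e i) (e j) = e (i + j)) ->
  forall i, exists2 c : pi1 R x0, pi1_degree c = e i & hurewicz c = hurewicz a *~ i.
Proof.
move=> a1 eD.
have e0 : e 0 = (0, 0, 0) by apply: (@hmulVg _ (e 0)); rewrite eD.
have nat (n : nat) : exists2 c : pi1 R x0, pi1_degree c = e n & hurewicz c = hurewicz a *+ n.
  elim: n => [|n [c cn ca]]; first by exists 1%g; rewrite ?pi1_degree1.
  by exists (a * c)%g; rewrite ?pi1_degreeM ?hurewiczM ?cn ?a1 ?eD ?ca ?mulrS.
case=> n; first exact: nat.
have [c cn ca] := nat n.+1; exists (c^-1)%g.
  by rewrite pi1_degreeV cn; apply/esym/hinvE; rewrite eD NegzE addNr e0.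
by rewrite hurewiczV ca NegzE mulrNz.
Qed.

Local Notation v1 := (gen_v1 R b%:Z).
Local Notation v2 := (gen_v2 R b%:Z).
Local Notation h := (gen_h R b%:Z).

(** The normal form [v1^i v2^j h^k] has degree [(i, j, k)], and the degree is injective. *)
Lemma hurewicz_degree (a : pi1 R x0) : hurewicz a =
  v1 *~ (pi1_degree a).1.1 + v2 *~ (pi1_degree a).1.2 + h *~ (pi1_degree a).2.
Proof.
case aE : (pi1_degree a) => [[i j] k] /=.
have [c1 d1 <-] := @pi1_power (loop_class (Loop (v1_loop R b%:Z)))
  (fun i => (i, 0, 0)) (etrans (pi1_degreeE _) degree_v1)
  (fun i j => ltac:(rewrite /hmul /=; congr (_, _, _); ring)) i.
have [c2 d2 <-] := @pi1_power (loop_class (Loop (v2_loop R b%:Z)))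
  (fun i => (0, i, 0)) (etrans (pi1_degreeE _) degree_v2)
  (fun i j => ltac:(rewrite /hmul /=; congr (_, _, _); ring)) j.
have [c3 d3 <-] := @pi1_power (loop_class (Loop (h_loop R b%:Z)))
  (fun i => (0, 0, i)) (etrans (pi1_degreeE _) degree_h)
  (fun i j => ltac:(rewrite /hmul /=; congr (_, _, _); ring)) k.
rewrite -(hurewiczM c1 c2) -(hurewiczM (c1 * c2)%g c3); congr hurewicz; apply: pi1_degree_inj.
by rewrite aE !pi1_degreeM d1 d2 d3 /hmul /=; congr (_, _, _); ring.
Qed.

Lemma H1_span (c : H1 R x0) : exists i j k : int, c = v1 *~ i + v2 *~ j + h *~ k.
Proof.
move: c; apply: to_abW => a; exists (pi1_degree a).1.1, (pi1_degree a).1.2, (pi1_degree a).2.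
exact: hurewicz_degree.
Qed.

Lemma pi1_degree_surj g : exists a : pi1 R x0, pi1_degree a = g.
Proof.
have [F [cF F0 F1]] : exists F : R -> R * R * R,
    [/\ continuous F, F 0 = base_lift & F 1 = act g base_lift].
  exists (fun t => base_lift + t *: (act g base_lift - base_lift)); split.
  - move=> t; apply: cvgD; first exact: cvg_cst.
    by apply: cvgZ; [exact: cvg_id|exact: cvg_cst].
  - by rewrite scale0r addr0.
  - by rewrite scale1r addrC subrK.
have lF : is_loop x0 (cover \o F).
  split; rewrite /= ?F0 ?F1 ?cover_base //.
    by apply: continuous_subspaceT => t; apply: continuous_comp;
      [exact: cF|exact: cover_continuous].
  by rewrite -cover_base; apply/coverP; exists g.
exists (loop_class (Loop lF)); rewrite pi1_degreeE.
by apply: (@degree_eq _ F); split=> //; exact: continuous_subspaceT.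
Qed.

Lemma H1_relations (i j k : int) :
  v1 *~ i + v2 *~ j + h *~ k = 0 <-> [/\ i = 0, j = 0 & (b%:Z %| k)%Z].
Proof.
split=> [e|[-> -> /dvdzP[l ->]]].
  have [a aE] := pi1_degree_surj (i, j, k).
  have : to_ab a = to_ab 1%g.
    by rewrite -[LHS]/(hurewicz a) hurewicz_degree aE.
  move=> /to_ab_eqP /derived_degree; rewrite invg1 mulg1 aE /= => -[-> -> [l ->]].
  by split=> //; exact: dvdz_mulr.
rewrite !mulr0z !add0r.
(* The commutator of these two elements has degree [(0, 0, b)], hence [h *~ b = 0]. *)
have [a aE] := pi1_degree_surj (1, 0, 0); have [c cE] := pi1_degree_surj (0, 1, 0).
have d0 : derived [~ a, c]%g := derivedR a c.
have hz : hurewicz [~ a, c]%g = 0.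
  by apply/to_ab_eqP; rewrite invg1 mulg1.
have := hurewicz_degree [~ a, c]%g; rewrite hz.
rewrite /commg /conjg !pi1_degreeM !pi1_degreeV aE cE.
set d := hmul _ _; have -> : d = (0, 0, b%:Z).
  by rewrite /d /hmul /hinv /=; congr (_, _, _); ring.
rewrite /= !mulr0z !add0r => /esym hb.
by rewrite mulrC mulrzA hb mul0rz.
Qed.

End Cover.

Lemma MT_connected (R : realType) (b : nat) : connected [set: MT R b%:Z].
Proof.
have cR : connected [set: R] by apply/connected_intervalP.
have -> : [set: MT R b%:Z] = @cover R b @` setT.
  by apply/seteqP; split=> // x _; have [u] := cover_surj x; exists u.
apply: connected_continuous_connected; last first.
  by apply: continuous_subspaceT; exact: cover_continuous.
have -> : [set: R * R * R] = \bigcup_(u in setT) ((fun t : R => t *: u) @` setT).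
  by apply/seteqP; split=> // u _; exists u => //; exists 1; rewrite ?scale1r.
apply: bigcup_connected; first by exists 0 => u _; exists 0; rewrite ?scale0r.
move=> u _; apply: connected_continuous_connected => //.
by apply: continuous_subspaceT => t; apply: cvgZ; [exact: cvg_id|exact: cvg_cst].
Qed.

Lemma zmod_morphism_facts (A B : zmodType) (f : A -> B) : zmod_morphism f ->
  [/\ f 0 = 0, forall u v, f (u + v) = f u + f v &
      forall u (n : int), f (u *~ n) = f u *~ n].
Proof.
move=> fB; have f0 : f 0 = 0 by rewrite -[0 in LHS](subrr 0) fB subrr.
have fN u : f (- u) = - f u by rewrite -sub0r fB f0 sub0r.
have fD u v : f (u + v) = f u + f v by rewrite -[v in LHS]opprK fB fN opprK.
have fM u (n : nat) : f (u *+ n) = f u *+ n.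
  by elim: n => [|n ih]; rewrite ?f0 // !mulrS fD ih.
by split=> // u [] n; rewrite ?NegzE ?mulrNz ?fN; [exact: fM|congr (- _); exact: fM].
Qed.

(** * Maps between the manifolds induced by maps of [R^3] *)

Section Descent.
Context {R : realType}.

Definition descend (b' b : nat) (L : R * R * R -> R * R * R) (x : MT R b'%:Z) : MT R b%:Z :=
  cover b (L (projT1 (cid (cover_surj x)))).

Definition equivariant (b' b : nat) (lam : int * int * int -> int * int * int)
    (L : R * R * R -> R * R * R) :=
  forall g u, L (act b' g u) = act b (lam g) (L u).

Lemma descendE b' b lam L u : equivariant b' b lam L ->
  descend b L (cover b' u) = cover b (L u).
Proof.
move=> eL; rewrite /descend; case: cid => v /= /coverP[g ->]; rewrite eL.
by apply/coverP; exists (lam g).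
Qed.

Lemma descend_continuous b' b lam L : equivariant b' b lam L -> continuous L ->
  continuous (@descend b' b L).
Proof.
move=> eL cL; apply/continuousP => A oA.
have -> : descend b L @^-1` A = cover b' @` ((cover b \o L) @^-1` A).
  apply/seteqP; split=> [x /= Ax|_ [u /= Au <-]]; last by rewrite /= (descendE _ eL).
  have [u ux] := cover_surj x; exists u => //=; rewrite -(descendE _ eL) ux //.
apply: cover_open; apply: open_comp => // u _.
by apply: continuous_comp; [exact: cL|exact: cover_continuous].
Qed.

(** [L] is invertible on [R^3], but [lam] goes one way only: it may have as image a proper subgroup,
    and then [L] descends to a nontrivial covering. *)
Definition plane_iso (b' b : nat) L L' lam :=
  [/\ continuous L, continuous L', cancel L L', cancel L' L & equivariant b' b lam L].

Definition plane_auto (b : nat) A A' :=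
  exists lam lam', plane_iso b b A A' lam /\ plane_iso b b A' A lam'.

Lemma descend_homeomorphism b A A' : plane_auto b A A' ->
  homeomorphism (@descend b b A).
Proof.
move=> [lam [lam' [[cA cA' AK A'K eA] [_ _ _ _ eA']]]].
split; first exact: descend_continuous eA cA.
exists (descend b A'); split; first exact: descend_continuous eA' cA'.
- by move=> x; have [u <-] := cover_surj x; rewrite !(descendE _ eA, descendE _ eA') AK.
- by move=> x; have [u <-] := cover_surj x; rewrite !(descendE _ eA, descendE _ eA') A'K.
Qed.

Lemma plane_iso_comp b' b L L' lam A A' mu :
  plane_iso b' b L L' lam -> plane_iso b b A A' mu ->
  plane_iso b' b (A \o L) (L' \o A') (mu \o lam).
Proof.
move=> [cL cL' LK L'K eL] [cA cA' AK A'K eA]; split.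
- by move=> u; exact: continuous_comp (cL u) (cA _).
- by move=> u; exact: continuous_comp (cA' u) (cL' _).
- exact: can_comp.
- exact: can_comp.
- by move=> g u; rewrite /= eL eA.
Qed.

(** * Double coverings from subgroups of index two *)

Section Covering.
Variables (b' b : nat) (L L' : R * R * R -> R * R * R).
Variable lam : int * int * int -> int * int * int.
Hypothesis iL : plane_iso b' b L L' lam.
Variable phi : H1 R (MT_base R b%:Z) -> 'Z_2.
Hypothesis epi : epimorphism phi.

(** [phi] read on the Heisenberg group, through the degree. *)
Let par (g : int * int * int) : 'Z_2 :=
  phi (gen_v1 R b%:Z) *~ g.1.1 + phi (gen_v2 R b%:Z) *~ g.1.2 + phi (gen_h R b%:Z) *~ g.2.

Hypothesis kerL : forall g, par g = 0 <-> exists g', g = lam g'.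

Lemma phi_hurewicz (a : pi1 R (MT_base R b%:Z)) : phi (hurewicz a) = par (pi1_degree a).
Proof.
have [/zmod_morphism_facts[_ phiD phiMz] _] := epi.
by rewrite hurewicz_degree !phiD !phiMz.
Qed.

Lemma par_hmul g h : par (hmul b g h) = par g + par h.
Proof.
have [a <-] := @pi1_degree_surj R b g; have [c <-] := @pi1_degree_surj R b h.
have [/zmod_morphism_facts[_ phiD _] _] := epi.
by rewrite -pi1_degreeM -!phi_hurewicz hurewiczM phiD.
Qed.

Let p := @descend b' b L.

Let pE u : p (cover b' u) = cover b (L u).
Proof. by case: iL => _ _ _ _ eL; exact: descendE eL. Qed.

Lemma par_hinv g : par (hinv b g) = - par g.
Proof.
have [a <-] := @pi1_degree_surj R b g.
have [phiB _] := epi; have [phi0 _ _] := zmod_morphism_facts phiB.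
by rewrite -pi1_degreeV -!phi_hurewicz hurewiczV -sub0r phiB phi0 sub0r.
Qed.

(** The base neighbourhood is the image of a cell [W] that meets each orbit at most once. Its two
    sheets are the images of the preimages under [L] of [W] and of a translate of [W] by an element
    outside the kernel of [par]. *)
Lemma descend_double_covering : double_covering p.
Proof.
have [cL cL' LK L'K eL] := iL.
split; first exact: descend_continuous eL cL.
have [del dn0] : exists del, par del != 0.
  have [_ /(_ 1)[c c1]] := epi.
  have [a aE] : exists a, hurewicz a = c by move: c {c1}; apply: to_abW => a; exists a.
  by exists (pi1_degree a); rewrite -phi_hurewicz aE c1.
move=> y; have [w <-] := cover_surj y; pose W := [set v | close b w v].
have oW : open W.
  have -> : W = (fun v => (w, v)) @^-1` [set q | close b q.1 q.2] by [].
  apply: open_comp; last exact: close_open.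
  by move=> v _; apply: cvg_pair_fun; [exact: cvg_cst|exact: cvg_id].
pose D (i : bool) : int * int * int := if i then del else (0, 0, 0).
pose S i := [set u | W (act b (hinv b (D i)) (L u))].
have oS i : open (S i).
  apply: (@open_comp _ _ (act b (hinv b (D i)) \o L)) => // u _.
  by apply: continuous_comp; [exact: cL|exact: act_continuous].
exists (cover b @` W), (fun i => cover b' @` S i); split.
- by split; [exact: cover_open|exists w => //; exact: close_refl].
- by move=> i; exact: cover_open.
- rewrite -subset0 => x [[u Su <-] [u' Su' /coverP[g uE]]].
  (* A point common to both sheets gives two points of [W] in one orbit, which coincide by
     [close_inj]; the action being free, [del] would equal [lam g], against its parity. *)
  have /act_inj e : act b (hmul b (hinv b del) (lam g)) (L u) = act b (hinv b (0,0,0)) (L u).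
    rewrite act_hmul -eL -uE; apply: (close_inj (w := w) Su' Su).
    apply/coverP; exists (hmul b (hinv b del) (hmul b (lam g) (D false))).
    rewrite act_hmul (act_hmul _ (lam g)); congr act.
    by rewrite actVK uE eL.
  have : par (hmul b (hinv b del) (lam g)) = par (hinv b (0, 0, 0)) by rewrite e.
  have -> : par (hinv b (0, 0, 0)) = 0.
    by rewrite par_hinv /par !mulr0z !addr0 oppr0.
  have -> : par (hmul b (hinv b del) (lam g)) = - par del.
    have z : par (lam g) = 0 by apply/kerL; exists g.
    by rewrite par_hmul par_hinv z addr0.
  by move/eqP; rewrite oppr_eq0 (negbTE dn0).
- apply/seteqP; split=> [x [v Wv vx]|x [] [u Su <-]]; last first.
  + exists (act b (hinv b (D true)) (L u)) => //; rewrite pE.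
    by apply/coverP; exists (hinv b (D true)).
  + exists (act b (hinv b (D false)) (L u)) => //; rewrite pE.
    by apply/coverP; exists (hinv b (D false)).
  have [u ux] := cover_surj x.
  have : cover b (L u) = cover b v by rewrite -pE ux vx.
  move=> /coverP[g gE].
  (* The parity of [g] selects the sheet: dividing by the matching [D] leaves an element of the
     kernel, which comes from the group upstairs. *)
  have [g' gg'] : exists g', hmul b g (hinv b (D (par g != 0))) = lam g'.
    have : par (hmul b g (hinv b (D (par g != 0)))) = 0.
      rewrite par_hmul par_hinv; case: eqP => [->|/eqP].
        by rewrite /D /par /= !mulr0z !addr0 subr0.
      have : par del = 1 by move: dn0; case: (par del) => -[|[|]] //= i _; exact: val_inj.
      rewrite /D => /= -> gn0.
      have -> : par g = 1 by move: gn0; case: (par g) => -[|[|]] //= i _; exact: val_inj.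
      by rewrite subrr.
    by move=> /kerL[g' ->]; exists g'.
  have Vx : (cover b' @` S (par g != 0)) x.
    exists (act b' (hinv b' g') u); last by rewrite -ux; apply/coverP; exists (hinv b' g').
    rewrite /S /=.
    suff -> : act b (hinv b (D (par g != 0))) (L (act b' (hinv b' g') u)) = v by [].
    apply: (can_inj (actK b (D (par g != 0)))); rewrite actVK.
    apply: (can_inj (actK b (lam g'))); rewrite -eL actVK gE -gg' act_hmul.
    by rewrite actK.
  by move: Vx; case: (par g != 0) => ?; [right|left].
(* The inverse of [p] on a sheet: lift to [W], translate to the chosen copy, then go back through
   [L']. *)
- move=> i; exists (fun z => cover b' (L' (act b (D i) (transport w z)))); split.
  + apply: continuous_within => z [v Wv <-].
    apply: (@continuous_comp _ _ _ (fun z => L' (act b (D i) (transport w z))) (cover b'));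
      last exact: cover_continuous.
    apply: (@continuous_comp _ _ _ (fun z => act b (D i) (transport w z)) L'); last exact: cL'.
    apply: (@continuous_comp _ _ _ (transport w) (act b (D i))); last exact: act_continuous.
    change (transport w z @[z --> cover b v] --> transport w (cover b v)).
    rewrite transportE //.
    have c1 : (fun=> w) @ nbhs (cover b v) --> w by exact: cvg_cst.
    have c2 : id @ nbhs (cover b v) --> cover b v by exact: cvg_id.
    exact: (cvg_transport c1 c2 Wv).
  + move=> z [v Wv <-]; rewrite transportE //; split.
      exists (L' (act b (D i) v)) => //; rewrite /S /= L'K actK //.
    by rewrite pE L'K; apply/coverP; exists (D i).
  + move=> e [u Su <-]; rewrite pE.
    have -> : cover b (L u) = cover b (act b (hinv b (D i)) (L u)).
      by apply/esym/coverP; exists (hinv b (D i)).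
    by rewrite transportE // actVK LK.
Qed.

(** Through [L], the lift of a loop to [R^3] is also a lift starting over the covering space; it
    closes up there exactly when its degree lies in the image of [lam], which is the kernel of
    [par]. *)
Lemma descend_associated_covering : associated_covering phi p.
Proof.
have [cL cL' LK L'K eL] := iL.
split; [exact: descend_double_covering|exact: MT_connected|].
exists (cover b' (L' (@base_lift R b))); first by rewrite pE L'K cover_base.
have pcont : continuous p by exact: descend_continuous eL cL.
move=> c; rewrite phi_hurewicz pi1_degreeE kerL; split=> [[g gE]|[d pdc]].
  have [F [cF Fc F0 F1]] := degreeP c.
  have ld : is_loop (cover b' (L' (@base_lift R b))) (cover b' \o L' \o F).
    split; rewrite /= ?F0 ?F1 //.
      apply: (@within_comp R (R * R * R)%type _ `[0, 1]%classic setT F (cover b' \o L')) => //.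
      apply: continuous_subspaceT => u.
      by apply: continuous_comp; [exact: cL'|exact: cover_continuous].
    apply/coverP; exists g; apply: (can_inj LK); rewrite eL !L'K -gE //.
  exists (Loop ld); apply: (@loop_homotopic_ext _ _ _ c _ c) => //.
    by move=> t It; rewrite /= pE L'K Fc.
  exact/loop_homotopic_refl/loopP.
have [g [G [cG Gd G0 G1]]] := loop_lift (loopP d).
have lpd : is_loop (MT_base R b%:Z) (p \o d).
  have [cd d0 d1] := loopP d.
  split; rewrite /= ?d0 ?d1 ?pE ?L'K ?cover_base //.
  apply: (@within_comp R _ _ `[0, 1]%classic setT d p) => //.
  exact: continuous_subspaceT.
exists g; rewrite -(degree_homotopic (c := Loop lpd) pdc).
apply: (@degree_eq _ _ _ (L \o G)); split=> /= [|t It||].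
- apply: (@within_comp R (R * R * R)%type _ `[0, 1]%classic setT G L) => //.
  exact: continuous_subspaceT.
- by rewrite -Gd // pE.
- by rewrite G0 L'K.
- by rewrite G1 eL L'K.
Qed.

End Covering.

(** * The explicit maps of [R^3] *)

Lemma cvg_coordinates (u : R * R * R) : [/\ v.1.1 @[v --> u] --> u.1.1,
  v.1.2 @[v --> u] --> u.1.2 & v.2 @[v --> u] --> u.2].
Proof.
have c1 : v.1 @[v --> u] --> u.1 by exact: cvg_fst.
by split; [exact: cvg_fst_fun|exact: cvg_snd_fun|exact: cvg_snd].
Qed.

(** The twist [b n (2 x)] downstairs is [(2 b) n x] upstairs, so the covering space has parameter
    [2 b]. *)
Definition double_base u : R * R * R := ((2 * u.1.1, u.1.2), u.2).
Definition halve_base u : R * R * R := ((2^-1 * u.1.1, u.1.2), u.2).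
Definition double_base_int (g : int * int * int) : int * int * int :=
  ((2 * g.1.1, g.1.2), g.2).

Lemma double_base_iso b : plane_iso (2 * b) b double_base halve_base double_base_int.
Proof.
split.
- move=> u; have [cx cy cz] := cvg_coordinates u.
  exact: cvg_pair_fun (cvg_pair_fun (cvgM (cvg_cst _) cx) cy) cz.
- move=> u; have [cx cy cz] := cvg_coordinates u.
  exact: cvg_pair_fun (cvg_pair_fun (cvgM (cvg_cst _) cx) cy) cz.
- by move=> [[x y] z]; congr (_, _, _); rewrite /= mulKf // pnatr_eq0.
- by move=> [[x y] z]; congr (_, _, _); rewrite /= mulVKf // pnatr_eq0.
- move=> [[m n] k] [[x y] z]; congr (_, _, _); rewrite /= ?natrM ?rmorphM /=; ring.
Qed.

(** Here the twist itself is doubled, [2 (b n x) = (2 b) n x], so the parameter is halved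
    upstairs. *)
Definition double_fibre u : R * R * R := (u.1, 2 * u.2).
Definition halve_fibre u : R * R * R := (u.1, 2^-1 * u.2).
Definition double_fibre_int (g : int * int * int) : int * int * int := (g.1, 2 * g.2).

Lemma double_fibre_iso b : plane_iso b (2 * b) double_fibre halve_fibre double_fibre_int.
Proof.
split.
- move=> u; have [cx cy cz] := cvg_coordinates u.
  by apply: cvg_pair_fun; [exact: cvg_fst|exact: cvgM (cvg_cst _) cz].
- move=> u; have [cx cy cz] := cvg_coordinates u.
  by apply: cvg_pair_fun; [exact: cvg_fst|exact: cvgM (cvg_cst _) cz].
- by move=> [[x y] z]; congr (_, _); rewrite /= mulKf // pnatr_eq0.
- by move=> [[x y] z]; congr (_, _); rewrite /= mulVKf // pnatr_eq0.
- move=> [[m n] k] [[x y] z]; congr (_, _, _); rewrite /= ?natrM ?rmorphM /=; ring.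
Qed.

Lemma plane_iso_id b : plane_iso b b id id id.
Proof. by split=> // u; exact: cvg_id. Qed.

(** Exchanging [x] and [y] reverses the base, which the sign of the fibre compensates; the term
    [b x y] trades a twist by [n x] for one by [m y]. *)
Definition swap (b : nat) u : R * R * R := ((u.1.2, u.1.1), - u.2 - b%:R * u.1.1 * u.1.2).
Definition swap_int (b : nat) (g : int * int * int) : int * int * int :=
  ((g.1.2, g.1.1), - g.2 - b%:Z * g.1.1 * g.1.2).

Lemma swap_iso b : plane_iso b b (swap b) (swap b) (swap_int b).
Proof.
have c : continuous (swap b).
  move=> u; have [cx cy cz] := cvg_coordinates u.
  apply: cvg_pair_fun (cvg_pair_fun cy cx) _.
  exact: cvgB (cvgN cz) (cvgM (cvgM (cvg_cst _) cx) cy).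
split=> //; try by move=> [[x y] z]; congr (_, _, _); rewrite /=; ring.
move=> [[m n] k] [[x y] z]; congr (_, _, _); rewrite //= ?rmorphB ?rmorphN ?rmorphM /=; ring.
Qed.

(** The quadratic correction in [shear] uses [x (x - 1) / 2] instead of [x^2 / 2] because it is
    integral at integers for every parity of [b]. *)
Definition triangular (m : int) : int := (m * (m - 1) %/ 2)%Z.

Lemma triangularE m : (triangular m)%:~R = m%:~R * (m%:~R - 1) / 2 :> R.
Proof.
have : (triangular m * 2 = m * (m - 1))%R.
  rewrite /triangular divzK //.
  have : ((m %% 2)%Z == 0) || ((m %% 2)%Z == 1).
    by have := modz_ge0 m (isT : 2 != 0 :> int); have := @ltz_pmod m 2 isT; lia.
  by move=> /orP[] /eqP h; apply/dvdzP; [exists ((m %/ 2)%Z * (m - 1))|exists ((m %/ 2)%Z * m)];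
    have := divz_eq m 2; rewrite h; nia.
move=> /(congr1 (intr : int -> R)); rewrite !rmorphM rmorphB /= => <-.
by rewrite mulfK // intr_eq0.
Qed.

Definition shear (b : nat) (s : R) u : R * R * R :=
  ((u.1.1, u.1.2 + s * u.1.1), u.2 - s * (b%:R * u.1.1 * (u.1.1 - 1) / 2)).
Definition shear_int (b : nat) (s : int) (g : int * int * int) : int * int * int :=
  ((g.1.1, g.1.2 + s * g.1.1), g.2 - s * b%:Z * triangular g.1.1).

Lemma shear_iso b (s : int) :
  plane_iso b b (shear b s%:~R) (shear b (- s)%:~R) (shear_int b s).
Proof.
have c (t : R) : continuous (shear b t).
  move=> u; have [cx cy cz] := cvg_coordinates u.
  exact: cvg_pair_fun (cvg_pair_fun cx (cvgD cy (cvgM (cvg_cst _) cx)))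
    (cvgB cz (cvgM (cvg_cst _)
      (cvgM (cvgM (cvgM (cvg_cst _) cx) (cvgB cx (cvg_cst _))) (cvg_cst _)))).
split=> //; try by move=> [[x y] z]; congr (_, _, _); rewrite /= rmorphN /=; ring.
move=> [[m n] k] [[x y] z]; congr (_, _, _).
  by rewrite /= rmorphD rmorphM /=; ring.
by rewrite /= !rmorphB rmorphD !rmorphM /= triangularE; field.
Qed.

(** Multiplication by a central element depending additively on [(x, y)]; it changes the values of
    an epimorphism at [v1] and [v2] by multiples of its value at [h]. *)
Definition tilt (s t : R) u : R * R * R := (u.1, u.2 + s * u.1.1 + t * u.1.2).
Definition tilt_int (s t : int) (g : int * int * int) : int * int * int :=
  (g.1, g.2 + s * g.1.1 + t * g.1.2).

Lemma tilt_iso b (s t : int) :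
  plane_iso b b (tilt s%:~R t%:~R) (tilt (- s)%:~R (- t)%:~R) (tilt_int s t).
Proof.
have c (s' t' : R) : continuous (tilt s' t').
  move=> u; have [cx cy cz] := cvg_coordinates u.
  apply: cvg_pair_fun; first exact: cvg_fst.
  exact: cvgD (cvgD cz (cvgM (cvg_cst _) cx)) (cvgM (cvg_cst _) cy).
split=> //; try by move=> [[x y] z]; congr (_, _); rewrite /= !rmorphN /=; ring.
move=> [[m n] k] [[x y] z]; congr (_, _); rewrite /= !rmorphD !rmorphM /=; ring.
Qed.

Lemma plane_auto_id b : plane_auto b id id.
Proof. by exists id, id; split; exact: plane_iso_id. Qed.

Lemma plane_auto_comp b A A' B B' : plane_auto b A A' -> plane_auto b B B' ->
  plane_auto b (A \o B) (B' \o A').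
Proof.
move=> [l [l' [h h']]] [m [m' [k k']]]; exists (l \o m), (m' \o l').
by split; exact: plane_iso_comp.
Qed.

Lemma plane_auto_sym b A A' : plane_auto b A A' -> plane_auto b A' A.
Proof. by move=> [l [l' [h h']]]; exists l', l. Qed.

Lemma swap_auto b : plane_auto b (swap b) (swap b).
Proof. by exists (swap_int b), (swap_int b); split; exact: swap_iso. Qed.

Lemma shear_auto b s : plane_auto b (shear b s%:~R) (shear b (- s)%:~R).
Proof.
exists (shear_int b s), (shear_int b (- s)); split; first exact: shear_iso.
by rewrite -{2}(opprK s); exact: shear_iso.
Qed.

Lemma tilt_auto b s t : plane_auto b (tilt s%:~R t%:~R) (tilt (- s)%:~R (- t)%:~R).
Proof.
exists (tilt_int s t), (tilt_int (- s) (- t)); split; first exact: tilt_iso.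
by rewrite -{2}(opprK s) -{2}(opprK t); exact: tilt_iso.
Qed.

(** The map [B \o A'] descends to the base and carries one projection to the other, while the common
    total space is left fixed. *)
Lemma equivalent_descend b' b L L' lam A A' B B'
    (phi psi : H1 R (MT_base R b%:Z) -> 'Z_2) :
  plane_iso b' b L L' lam -> plane_auto b A A' -> plane_auto b B B' ->
  associated_covering phi (@descend b' b (A \o L)) ->
  associated_covering psi (@descend b' b (B \o L)) -> equivalent_epi phi psi.
Proof.
move=> iL aA aB cphi cpsi.
have [l [_ [iA _]]] := aA; have [m [_ [iB _]]] := aB.
have aF := plane_auto_comp aB (plane_auto_sym aA).
have [n [_ [[_ _ _ _ eF] _]]] := aF.
have [_ _ _ _ eAL] := plane_iso_comp iL iA.
have [_ _ _ _ eBL] := plane_iso_comp iL iB.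
have [_ _ AK _ _] := iA.
exists (MT R b'%:Z), (MT R b'%:Z), (@descend b' b (A \o L)), (@descend b' b (B \o L)).
split=> //; exists (@descend b b (B \o A')), id; split.
- exact: descend_homeomorphism aF.
- by split; [move=> x; exact: cvg_id|exists id; split=> // x; exact: cvg_id].
- apply/funext => x; have [u <-] := cover_surj x.
  by rewrite /= (descendE _ eAL) (descendE _ eBL) (descendE _ eF) /= AK.
Qed.

End Descent.

(** * Epimorphisms onto [Z_2] *)

Lemma Z2_intr_eq0 (k : int) : (k%:~R == 0 :> 'Z_2) = (2 %| k)%Z.
Proof.
have two : (2 : int)%:~R = 0 :> 'Z_2 by exact: val_inj.
apply/eqP/idP => [h|/dvdzP[q ->]]; last by rewrite intrM two mulr0.
rewrite (divz_eq k 2) intrD intrM /= two mulr0 add0r in h.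
apply/dvdz_mod0P; have := modz_ge0 k (isT : 2 != 0 :> int).
have := @ltz_pmod k 2 isT; case: (k %% 2)%Z h => [[|[|n]]|n] //= h.
Qed.

Lemma Z2_case (x : 'Z_2) : x = 0 \/ x = 1.
Proof. by case: x => -[|[|//]] i; [left|right]; exact: val_inj. Qed.

Lemma Z2_neq0 (x : 'Z_2) : x <> 0 -> x = 1.
Proof. by have [|] := Z2_case x. Qed.

Lemma Z2_mulrn_odd (x : 'Z_2) n : odd n -> x *+ n = 0 -> x = 0.
Proof.
have [-> //|->] := Z2_case x => on /eqP.
rewrite -[1 *+ n]/(n%:R) -[n%:R]/(n%:Z%:~R) Z2_intr_eq0 => n2.
by move: n2; rewrite dvdzE /= dvdn2 on.
Qed.

Lemma card_eq_code (T : Type) (E : set T) (f : T -> nat) n :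
  (forall x, E x -> (f x < n)%N) -> (forall x y, E x -> E y -> f x = f y -> x = y) ->
  (forall i, (i < n)%N -> exists2 x, E x & f x = i) -> E #= `I_n.
Proof.
move=> fn fI fS; have <- : f @` E = `I_n.
  by apply/seteqP; split=> [_ [x Ex <-]|i /fS[x Ex <-]]; [exact: fn|exists x].
rewrite card_eq_sym; apply: inj_card_eq => x y; rewrite !inE; exact: fI.
Qed.

Lemma mulrz_span3B (A : zmodType) (u v w : A) (i j k i' j' k' : int) :
  (u *~ i + v *~ j + w *~ k) - (u *~ i' + v *~ j' + w *~ k') =
  u *~ (i - i') + v *~ (j - j') + w *~ (k - k').
Proof. by rewrite !mulrzBr !opprD addrACA; congr (_ + _); rewrite addrACA. Qed.

Section Epimorphisms.
Context {R : realType}.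
Variable b : nat.
Local Notation H := (H1 R (MT_base R b%:Z)).
Local Notation v1 := (gen_v1 R b%:Z).
Local Notation v2 := (gen_v2 R b%:Z).
Local Notation h := (gen_h R b%:Z).
Implicit Types phi psi : H -> 'Z_2.

Lemma hom_generators phi : zmod_morphism phi -> forall i j k : int,
  phi (v1 *~ i + v2 *~ j + h *~ k) = phi v1 *~ i + phi v2 *~ j + phi h *~ k.
Proof. by move=> /zmod_morphism_facts[_ fD fM] i j k; rewrite !fD !fM. Qed.

Lemma hom_ext phi psi : zmod_morphism phi -> zmod_morphism psi ->
  phi v1 = psi v1 -> phi v2 = psi v2 -> phi h = psi h -> phi = psi.
Proof.
move=> mphi mpsi e1 e2 e3; apply/funext => c.
have [i [j [k ->]]] := H1_span c.
by rewrite !hom_generators // e1 e2 e3.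
Qed.

(** Coordinates of a class are chosen arbitrarily; by [H1_relations] only the coefficient of [h] is
    ambiguous, by multiples of [b], which the hypothesis on [z] absorbs. *)
Lemma hom_exists (x y z : 'Z_2) : z *+ b = 0 ->
  exists phi, [/\ zmod_morphism phi, phi v1 = x, phi v2 = y & phi h = z].
Proof.
move=> zb.
have coord (c : H) : exists g : int * int * int,
    c = v1 *~ g.1.1 + v2 *~ g.1.2 + h *~ g.2.
  by have [i [j [k ->]]] := H1_span c; exists (i, j, k).
pose val3 (g : int * int * int) := x *~ g.1.1 + y *~ g.1.2 + z *~ g.2.
pose phi (c : H) := val3 (projT1 (cid (coord c))).
have phiE (i j k : int) : phi (v1 *~ i + v2 *~ j + h *~ k) = val3 (i, j, k).
  rewrite /phi; case: cid => -[[i' j'] k'] /= e.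
  have : v1 *~ (i - i') + v2 *~ (j - j') + h *~ (k - k') = 0.
    by rewrite -mulrz_span3B e subrr.
  move=> /H1_relations[/eqP + /eqP + /dvdzP[l le]].
  rewrite !subr_eq0 => /eqP -> /eqP ->.
  have -> : k = k' + l * b%:Z by lia.
  by rewrite /val3 /= mulrzDr mulrC mulrzA -[z *~ b]/(z *+ b) zb mul0rz addr0.
exists phi; split.
- move=> c d; have [i [j [k ->]]] := H1_span c; have [i' [j' [k' ->]]] := H1_span d.
  by rewrite mulrz_span3B !phiE /val3 /= mulrz_span3B.
- by have := phiE 1 0 0; rewrite /val3 /= !mulr0z !addr0.
- by have := phiE 0 1 0; rewrite /val3 /= !mulr0z !addr0 !add0r.
- by have := phiE 0 0 1; rewrite /val3 /= !mulr0z !add0r.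
Qed.

Lemma hom_epi phi : zmod_morphism phi ->
  (exists c, phi c = 1) -> epimorphism phi.
Proof.
move=> mphi [c c1]; split=> // z; have [phi0 _ _] := zmod_morphism_facts mphi.
by have [->|->] := Z2_case z; [exists 0|exists c].
Qed.

Lemma hom_h_mulrn phi : zmod_morphism phi -> phi h *+ b = 0.
Proof.
move=> mphi; have [phi0 _ phiM] := zmod_morphism_facts mphi.
have [_ /(_ (And3 erefl erefl (dvdzz b%:Z)))] := @H1_relations R b 0 0 b%:Z.
by rewrite !mulr0z !add0r => e; rewrite -[_ *+ b]/(phi h *~ b%:Z) -phiM e.
Qed.

Lemma epi_odd phi : odd b -> epimorphism phi -> phi h = 0.
Proof. by move=> ob [mphi _]; exact: Z2_mulrn_odd ob (hom_h_mulrn mphi). Qed.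

Lemma epi_neq0 phi : epimorphism phi -> phi h = 0 -> phi v1 = 0 -> phi v2 = 1.
Proof.
move=> [mphi /(_ 1)[c c1]] h0 e1; have [i [j [k cE]]] := H1_span c.
move: c1; rewrite cE hom_generators // h0 e1 !mul0rz add0r addr0.
by have [->|//] := Z2_case (phi v2); rewrite mul0rz.
Qed.

Lemma card_epi_h0 : [set phi | epimorphism phi /\ phi h = 0] #= `I_3.
Proof.
(* The binary code takes the values 1, 2, 3, since 0 would be the zero map; the predecessor moves
   them to 0, 1, 2. *)
apply: (@card_eq_code _ _ (fun phi => (val (phi v1) + 2 * val (phi v2)).-1)%N).
- move=> phi [ephi h0].
  by have [->|->] := Z2_case (phi v1); have [->|->] := Z2_case (phi v2).
- move=> phi psi [ephi h0] [epsi h0'] e; have [mphi _] := ephi; have [mpsi _] := epsi.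
  have n1 := epi_neq0 ephi h0; have n2 := epi_neq0 epsi h0'.
  suff [e1 e2] : phi v1 = psi v1 /\ phi v2 = psi v2 by apply: hom_ext; rewrite ?h0.
  move: e n1 n2.
  by have [->|->] := Z2_case (phi v1); have [->|->] := Z2_case (phi v2);
    have [->|->] := Z2_case (psi v1); have [->|->] := Z2_case (psi v2) => //= _ n1 n2;
    split=> //; try (by have := n1 erefl); by have := n2 erefl.
- have ex (x y : 'Z_2) : x = 1 \/ y = 1 -> exists2 phi,
      [set phi | epimorphism phi /\ phi h = 0] phi & phi v1 = x /\ phi v2 = y.
    move=> xy; have [phi [mphi p1 p2 p3]] := hom_exists x y (mul0rn _ b).
    exists phi => //; split=> //; apply: hom_epi => //.
    by case: xy => e; [exists v1; rewrite p1|exists v2; rewrite p2].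
  move=> [|[|[|//]]] _.
  + by have [|phi ephi [p1 p2]] := ex 1 0; [left|exists phi; rewrite ?p1 ?p2].
  + by have [|phi ephi [p1 p2]] := ex 0 1; [right|exists phi; rewrite ?p1 ?p2].
  + by have [|phi ephi [p1 p2]] := ex 1 1; [left|exists phi; rewrite ?p1 ?p2].
Qed.

Lemma card_epi_h1 : ~~ odd b -> [set phi | epimorphism phi /\ phi h <> 0] #= `I_4.
Proof.
move=> eb; apply: (@card_eq_code _ _ (fun phi => val (phi v1) + 2 * val (phi v2))%N).
- move=> phi _.
  by have [->|->] := Z2_case (phi v1); have [->|->] := Z2_case (phi v2).
- move=> phi psi [[mphi _] /Z2_neq0 h0] [[mpsi _] /Z2_neq0 h0'] e.
  suff [e1 e2] : phi v1 = psi v1 /\ phi v2 = psi v2 by apply: hom_ext; rewrite ?h0.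
  move: e.
  by have [->|->] := Z2_case (phi v1); have [->|->] := Z2_case (phi v2);
    have [->|->] := Z2_case (psi v1); have [->|->] := Z2_case (psi v2).
- have ex (x y : 'Z_2) : exists2 phi,
      [set phi | epimorphism phi /\ phi h <> 0] phi & phi v1 = x /\ phi v2 = y.
    have [|phi [mphi p1 p2 p3]] := @hom_exists x y 1.
      rewrite -[b]odd_double_half (negbTE eb) add0n -mul2n mulrnA.
      by rewrite (_ : 1 *+ 2 = 0) ?mul0rn //; exact: val_inj.
    exists phi => //; split; last by rewrite p3.
    by apply: hom_epi => //; exists h.
  move=> [|[|[|[|//]]]] _.
  + by have [phi ephi [p1 p2]] := ex 0 0; exists phi; rewrite ?p1 ?p2.
  + by have [phi ephi [p1 p2]] := ex 1 0; exists phi; rewrite ?p1 ?p2.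
  + by have [phi ephi [p1 p2]] := ex 0 1; exists phi; rewrite ?p1 ?p2.
  + by have [phi ephi [p1 p2]] := ex 1 1; exists phi; rewrite ?p1 ?p2.
Qed.

(** [double_base] realizes the subgroup where the first coordinate [m] is even. [swap] carries it to
    [n] even, and [shear] after [swap] to [m + n] even: these are the three kernels. *)
Lemma covering_h0 phi : epimorphism phi -> phi h = 0 -> exists A A',
  plane_auto b A A' /\ associated_covering phi (@descend R (2 * b) b (A \o double_base)).
Proof.
move=> ephi h0; have := epi_neq0 ephi h0.
have [e1|e1] := Z2_case (phi v1) => [/(_ e1) e2|_].
  exists (swap b), (swap b); split; first exact: swap_auto.
  apply: (descend_associated_covering (plane_iso_comp (double_base_iso b) (swap_iso b)) ephi).
  move=> [[m n] k]; rewrite /= e1 e2 h0 !mul0rz add0r addr0.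
  split=> [/eqP|[[[m' n'] k'] [_ -> _]]]; last by apply/eqP; rewrite Z2_intr_eq0 dvdz_mulr.
  rewrite Z2_intr_eq0 => /dvdzP[q ->].
  by exists (q, m, - k - b%:Z * (2 * q) * m); rewrite /swap_int /=; congr (_, _, _); ring.
have [e2|e2] := Z2_case (phi v2).
  exists id, id; split; first exact: plane_auto_id.
  apply: (descend_associated_covering (plane_iso_comp (double_base_iso b) (plane_iso_id b)) ephi).
  move=> [[m n] k]; rewrite /= e1 e2 h0 !mul0rz !addr0.
  split=> [/eqP|[[[m' n'] k'] [-> _ _]]]; last by apply/eqP; rewrite Z2_intr_eq0 dvdz_mulr.
  rewrite Z2_intr_eq0 => /dvdzP[q ->].
  by exists (q, n, k); rewrite /double_base_int /= mulrC.
exists (shear b 1%:~R \o swap b), (swap b \o shear b (- 1)%:~R).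
split; first exact: plane_auto_comp (shear_auto b 1) (swap_auto b).
apply: (descend_associated_covering (plane_iso_comp (double_base_iso b)
  (plane_iso_comp (swap_iso b) (shear_iso b 1))) ephi).
move=> [[m n] k]; rewrite /= e1 e2 h0 mul0rz addr0 -mulrzDr.
split=> [/eqP|[[[m' n'] k'] [-> -> _]]]; last first.
  by apply/eqP; rewrite Z2_intr_eq0; apply/dvdzP; exists (n' + m'); ring.
rewrite Z2_intr_eq0 => /dvdzP[q qE].
exists (q - m, m, - k - b%:Z * (2 * (q - m)) * m - b%:Z * triangular m).
by rewrite /swap_int /shear_int /=; congr (_, _, _); [lia|ring].
Qed.

End Epimorphisms.

(** [double_fibre] realizes the subgroup where [k] is even; [tilt] carries it to [s m + t n + k]
    even, where [s] and [t] are integers representing the values of [phi] at [v1] and [v2]. *)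
Lemma covering_h1 (R : realType) (c : nat)
    (phi : H1 R (MT_base R (2 * c)%N%:Z) -> 'Z_2) : epimorphism phi ->
  phi (gen_h R (2 * c)%N%:Z) <> 0 -> exists A A',
  plane_auto (2 * c) A A' /\ associated_covering phi (@descend R c (2 * c) (A \o double_fibre)).
Proof.
move=> ephi /Z2_neq0 h1.
have Z2int (x : 'Z_2) : exists s : int, x = s%:~R.
  by have [->|->] := Z2_case x; [exists 0|exists 1].
have [s e1] := Z2int (phi (gen_v1 R (2 * c)%N%:Z)).
have [t e2] := Z2int (phi (gen_v2 R (2 * c)%N%:Z)).
exists (tilt s%:~R t%:~R), (tilt (- s)%:~R (- t)%:~R); split; first exact: tilt_auto.
apply: (descend_associated_covering (plane_iso_comp (double_fibre_iso c) (tilt_iso _ s t)) ephi).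
move=> [[m n] k]; rewrite /= e1 e2 h1 -!mulrzA -!mulrzDr.
split=> [/eqP|[[[m' n'] k'] [-> -> ->]]]; last first.
  by apply/eqP; rewrite Z2_intr_eq0; apply/dvdzP; exists (s * m' + t * n' + k'); ring.
rewrite Z2_intr_eq0 => /dvdzP[q qE].
exists (m, n, q - s * m - t * n); rewrite /tilt_int /double_fibre_int /=.
by congr (_, _, _); lia.
Qed.

Lemma epimorphisms_h1 (R : realType) (b : nat) : ~~ odd b ->
  (forall phi psi : H1 R (MT_base R b%:Z) -> 'Z_2,
     epimorphism phi -> phi (gen_h R b%:Z) <> 0 ->
     epimorphism psi -> psi (gen_h R b%:Z) <> 0 -> equivalent_epi phi psi) /\
  (forall phi : H1 R (MT_base R b%:Z) -> 'Z_2,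
     epimorphism phi -> phi (gen_h R b%:Z) <> 0 ->
     exists p : MT R (b %/ 2)%:Z -> MT R b%:Z, associated_covering phi p).
Proof.
move=> eb; have [c ->] : exists c, b = (2 * c)%N.
  by exists b./2; rewrite mul2n -[LHS]odd_double_half (negbTE eb).
rewrite mulKn //; split=> [phi psi ephi hphi epsi hpsi|phi ephi hphi].
  have [A [A' [aA cA]]] := covering_h1 ephi hphi.
  have [B [B' [aB cB]]] := covering_h1 epsi hpsi.
  exact: equivalent_descend (double_fibre_iso c) aA aB cA cB.
by have [A [A' [_ cA]]] := covering_h1 ephi hphi; exists (@descend R c (2 * c) (A \o double_fibre)).
Qed.

Theorem proposition5 (R : realType) (b : nat) (b_ge1 : (1 <= b)%N) :
  let v1 : H1 R (MT_base R b%:Z) := gen_v1 R b%:Z in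
  let v2 : H1 R (MT_base R b%:Z) := gen_v2 R b%:Z in
  let h : H1 R (MT_base R b%:Z) := gen_h R b%:Z in
  [/\ (* H_1(M_T(b)) = v1 Z (+) v2 Z (+) h Z_b *)
      (forall c : H1 R (MT_base R b%:Z),
          exists i j k : int, c = v1 *~ i + v2 *~ j + h *~ k) /\
      (forall i j k : int,
          v1 *~ i + v2 *~ j + h *~ k = 0 <->
          [/\ i = 0, j = 0 & (b%:Z %| k)%Z]),
      (* the epimorphisms that kill h *)
      [/\ [set phi : H1 R (MT_base R b%:Z) -> 'Z_2 |
             epimorphism phi /\ phi h = 0] #= `I_3,
          forall phi psi : H1 R (MT_base R b%:Z) -> 'Z_2,
            epimorphism phi -> phi h = 0 ->
            epimorphism psi -> psi h = 0 -> equivalent_epi phi psi &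
          forall phi : H1 R (MT_base R b%:Z) -> 'Z_2,
            epimorphism phi -> phi h = 0 ->
            exists p : MT R (2 * b)%:Z -> MT R b%:Z,
              associated_covering phi p],
      odd b -> forall phi : H1 R (MT_base R b%:Z) -> 'Z_2,
        epimorphism phi -> phi h = 0 &
      ~~ odd b ->
      [/\ [set phi : H1 R (MT_base R b%:Z) -> 'Z_2 |
             epimorphism phi /\ phi h <> 0] #= `I_4,
          forall phi psi : H1 R (MT_base R b%:Z) -> 'Z_2,
            epimorphism phi -> phi h <> 0 ->
            epimorphism psi -> psi h <> 0 -> equivalent_epi phi psi &
          forall phi : H1 R (MT_base R b%:Z) -> 'Z_2,
            epimorphism phi -> phi h <> 0 ->
            exists p : MT R (b %/ 2)%:Z -> MT R b%:Z,
              associated_covering phi p]].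
Proof.
move=> v1 v2 h; split.
- by split; [exact: H1_span|exact: H1_relations].
- split=> [|phi psi ephi hphi epsi hpsi|phi ephi hphi]; first exact: card_epi_h0.
    have [A [A' [aA cA]]] := covering_h0 ephi hphi.
    have [B [B' [aB cB]]] := covering_h0 epsi hpsi.
    exact: equivalent_descend (double_base_iso b) aA aB cA cB.
  by have [A [A' [_ cA]]] := covering_h0 ephi hphi; exists (descend b (A \o double_base)).
- by move=> ob phi; exact: epi_odd.
- move=> eb; have [eqv cov] := @epimorphisms_h1 R b eb.
  by split; [exact: card_epi_h1|exact: eqv|exact: cov].
Qed.
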